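(* Let $p>3$ be prime and $1\le\ell\le p-1$. Then the function $\eta(p^2z)\,q^{-1/24}\,C(\zeta_p^{\ell},q)$ is a weakly holomorphic modular form of weight $1$ on the group $\Gamma_0(p^2)\cap\Gamma_1(p)$.
   Context: $z$ lies in the upper half-plane, $q=e^{2\pi i z}$, $q^r=e^{2\pi i r z}$, $\zeta_p=e^{2\pi i/p}$, $\eta(z)=q^{1/24}\prod_{n\ge1}(1-q^n)$, and $(a;q)_\infty=\prod_{k\ge0}(1-aq^k)$. The crank generating function is $C(x,q)=\dfrac{(q;q)_\infty}{(xq;q)_\infty(x^{-1}q;q)_\infty}$ (Andrews–Garvan). *)

(* Defs.v *)
From Stdlib Require Import Reals ZArith Znumtheory.
From Coquelicot Require Import Coquelicot.
Open Scope R_scope.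

Definition cexp (z : C) : C :=
  (exp (fst z) * cos (snd z), exp (fst z) * sin (snd z)).

Definition upper (z : C) : Prop := 0 < Im z.

Definition qpow (r : R) (z : C) : C := cexp (RtoC (2 * PI * r) * Ci * z).

Fixpoint partial_prod (u : nat -> C) (N : nat) : C :=
  match N with
  | O => RtoC 1
  | S n => Cmult (partial_prod u n) (u n)
  end.
Definition inf_prod (u : nat -> C) : C :=
  @lim C_CompleteNormedModule (filtermap (partial_prod u) eventually).

Definition qpoch (a q : C) : C :=
  inf_prod (fun k => Cminus (RtoC 1) (Cmult a (pow_n q k))).

Definition crank (x q : C) : C :=
  Cdiv (qpoch q q) (Cmult (qpoch (Cmult x q) q) (qpoch (Cmult (Cinv x) q) q)).

Definition eta (z : C) : C :=
  Cmult (qpow (1/24) z) (inf_prod (fun n => Cminus (RtoC 1) (qpow (INR (S n)) z))).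

Definition zeta (p : Z) : C := cexp (Cmult (RtoC (2 * PI / IZR p)) Ci).

Definition Fcrank (p : Z) (l : nat) (z : C) : C :=
  Cmult (Cmult (eta (Cmult (RtoC (IZR (p ^ 2))) z)) (qpow (-1/24) z))
        (crank (pow_n (zeta p) l) (qpow 1 z)).

Definition holo_on (U : C -> Prop) (f : C -> C) : Prop :=
  forall z, U z -> @ex_derive C_AbsRing C_NormedModule f z.

Definition in_SL2Z (a b c d : Z) : Prop := (a * d - b * c = 1)%Z.

Definition in_Gamma0p2_Gamma1p (p : Z) (a b c d : Z) : Prop :=
  in_SL2Z a b c d /\ (p ^ 2 | c)%Z /\ (p | a - 1)%Z /\ (p | d - 1)%Z.

Definition mobius (a b c d : Z) (z : C) : C :=
  Cdiv (Cplus (Cmult (RtoC (IZR a)) z) (RtoC (IZR b)))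
       (Cplus (Cmult (RtoC (IZR c)) z) (RtoC (IZR d))).

Definition automorphy (c d : Z) (z : C) : C :=
  Cplus (Cmult (RtoC (IZR c)) z) (RtoC (IZR d)).

Definition slash (k : nat) (f : C -> C) (a b c d : Z) (z : C) : C :=
  Cdiv (f (mobius a b c d z)) (pow_n (automorphy c d z) k).

(* meromorphic at the cusp i*oo: for some width h >= 1, g(z) = G(q_h) with
   q_h = e^{2 pi i z / h} and G(w) = w^{-m} H(w), H holomorphic on |w| < 1;
   i.e. the q_h-expansion has only finitely many negative terms. *)
Definition mero_at_infty (g : C -> C) : Prop :=
  exists (h : nat) (m : nat) (H : C -> C),
    (0 < h)%nat /\ holo_on (fun w => Cmod w < 1) H /\
    forall z, upper z ->
      Cmult (g z) (pow_n (qpow (1 / INR h) z) m) = H (qpow (1 / INR h) z).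

Definition weakly_hol_modular_form (k : nat) (Gam : Z -> Z -> Z -> Z -> Prop)
  (f : C -> C) : Prop :=
  holo_on upper f /\
  (forall a b c d, Gam a b c d -> forall z, upper z ->
      f (mobius a b c d z) = Cmult (pow_n (automorphy c d z) k) (f z)) /\
  (forall a b c d, in_SL2Z a b c d -> mero_at_infty (slash k f a b c d)).

(* Main.v *)
Require Import Defs.
From Stdlib Require Import Reals ZArith Znumtheory Lra Lia Classical ClassicalEpsilon List.
From Coquelicot Require Import Coquelicot.
Import ListNotations.
Local Open Scope C_scope.

Local Notation "x < y" := (Rlt x%R y%R) : C_scope.
Local Notation "x <= y" := (Rle x%R y%R) : C_scope.
Local Notation "x < y < z" := (x%R < y%R /\ y%R < z%R)%R : C_scope.
Local Notation "x <= y <= z" := (x%R <= y%R /\ y%R <= z%R)%R : C_scope.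
Local Notation "x <= y < z" := (x%R <= y%R /\ y%R < z%R)%R : C_scope.
Local Notation "x < y <= z" := (x%R < y%R /\ y%R <= z%R)%R : C_scope.

(** Write [q = ee z], [x = ee u] and let [Phi u z] be the Klein form
    [(x^(1/2) - x^(-1/2)) prod (1 - q^n x)(1 - q^n / x) / (1 - q^n)^2].
    The crank function is a constant times
    [eta(p^2 z) / (eta(z) Phi(l/p, z))].  Taking products of [Phi] over the
    [p]-torsion points of the real axis gives [eta(pz) / eta(z)^p], so that
    [eta(p^2 z) / eta(z)] is a product of values of [Phi] at [z] and [p z] times
    a power of the discriminant (as [24] divides [p^2 - 1]), and the
    discriminant is a power of the product of [Phi] over the half periods.
    So everything follows from
    [Phi (u/(cz+d), gz) = (cz+d)^-1 ee (c u^2 / (2 (cz+d))) Phi (u, z)].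

    By quasi-periodicity the ratio of the two sides, for [z -> -1/z], is an
    elliptic function of [u] without zeros or poles.  Its third logarithmic
    derivative [f] satisfies [8 f(u) = sum f((u + w)/2)] over the four classes [w]
    of periods modulo twice the periods; being bounded, it vanishes. *)

(** * Limits and complex derivatives *)

(** Why the third derivative: duplication of the k-th logarithmic derivative sets a factor 2^k
    against four terms, so k = 3 is the least order at which every bound implies a smaller one (k =
    2 gives 4 against 4). It is also the first order at which the Gaussian factor, whose logarithm
    is quadratic in u, disappears. This takes the place of Liouville's theorem and, at the lattice
    points, of the removable singularity theorem. On integrating back, period 1 and evenness remove
    the quadratic and the linear term, and the constant is 1 because [Phi u z] behaves like 2 pi i
    u, whatever z is.

    The quotient eta(p^2 z) / eta(z) has to be written in two ways. Points of order p^2 at z alone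
    obey the law of all of SL2(Z), which gives the expansions at every cusp; but the group does not
    fix these points. Points of order p, at z and at p z, are fixed modulo periods, which gives the
    invariance; but at p z a general matrix of SL2(Z) no longer acts through an integral matrix of
    determinant 1. With p = 2M + 1, the condition p > 3 enters as 6 | M (M + 1), which is the same
    as 24 | p^2 - 1. *)

Lemma Cmod_minus_sym (a b : C) : Cmod (a - b) = Cmod (b - a).
Proof. rewrite <- Cmod_opp; f_equal; ring. Qed.

Lemma Cmod_triangle_rev (a b : C) : Cmod a - Cmod b <= Cmod (a - b).
Proof.
  assert (H := Cmod_triangle (a - b) b).
  replace (a - b + b) with a in H by ring. lra.
Qed.

Lemma Cmod_minus_le (a b : C) : Cmod (a - b) <= Cmod a + Cmod b.
Proof. unfold Cminus. rewrite <- (Cmod_opp b). apply Cmod_triangle. Qed.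

Lemma im_le_Cmod (c : C) : Rabs (Im c) <= Cmod c.
Proof.
  destruct c as [a b]. unfold Cmod; simpl. rewrite <- sqrt_Rsqr_abs.
  apply sqrt_le_1_alt. unfold Rsqr. nra.
Qed.

Lemma Cmod_pos_of_ne (a : C) : a <> 0 -> 0 < Cmod a.
Proof. apply Cmod_gt_0. Qed.

Lemma Rlt_Rmin_inv (x a b : R) : (x < Rmin a b -> x < a /\ x < b)%R.
Proof. intros H. split; eapply Rlt_le_trans; [exact H|apply Rmin_l|exact H|apply Rmin_r]. Qed.

Lemma geo_small (A r eps : R) : 0 <= r < 1 -> 0 < eps ->
  exists N, forall n, (N <= n)%nat -> A * r ^ n < eps.
Proof.
  intros Hr He. pose proof (Rabs_pos A) as HA.
  destruct (pow_lt_1_zero r) with (y := (eps / (Rabs A + 1))%R) as [N HN].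
  { rewrite Rabs_pos_eq; lra. } { apply Rdiv_lt_0_compat; lra. }
  exists N. intros n Hn. specialize (HN n Hn).
  assert (Hp : 0 <= r ^ n) by (apply pow_le; lra).
  rewrite Rabs_pos_eq in HN by easy. pose proof (Rle_abs A).
  apply Rle_lt_trans with ((Rabs A + 1) * r ^ n)%R; [nra|].
  replace eps with ((Rabs A + 1) * (eps / (Rabs A + 1)))%R by (field; lra).
  apply Rmult_lt_compat_l; lra.
Qed.

(* The norm topology on [C]; Coquelicot's default uniform structure on [C] is
   that of [R * R], for which the product and chain rules are not stated. *)
Definition ccv (s : nat -> C) (l : C) : Prop :=
  filterlim s eventually (@locally (AbsRing_UniformSpace C_AbsRing) l).

Lemma ccv_eps s l : ccv s l <-> forall eps : R, 0 < eps ->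
  exists N, forall n, (N <= n)%nat -> Cmod (s n - l) < eps.
Proof.
  split.
  - intros H eps He. apply (H (fun y => Cmod (y - l) < eps)%R).
    now exists (mkposreal eps He).
  - intros H P [eps HP]. destruct (H eps (cond_pos eps)) as [N HN].
    exists N. intros n Hn. apply HP, HN, Hn.
Qed.

Lemma ccv_const (c : C) : ccv (fun _ => c) c.
Proof. exact (@filterlim_const nat (AbsRing_UniformSpace C_AbsRing) eventually _ c). Qed.

Lemma ccv_unique s a b : ccv s a -> ccv s b -> a = b.
Proof. exact (filterlim_locally_unique (V := AbsRing_NormedModule C_AbsRing) s a b). Qed.

Lemma ccv_ext s t l : (forall n, s n = t n) -> ccv s l -> ccv t l.
Proof. apply filterlim_ext. Qed.

Lemma ccv_subseq s l (k : nat -> nat) :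
  (forall n, (n <= k n)%nat) -> ccv s l -> ccv (fun n => s (k n)) l.
Proof.
  rewrite !ccv_eps. intros Hk H eps He. destruct (H eps He) as [N HN].
  exists N. intros n Hn. apply HN. specialize (Hk n); lia.
Qed.

Lemma ccv_plus s t a b : ccv s a -> ccv t b -> ccv (fun n => s n + t n) (a + b).
Proof.
  intros Ha Hb. exact (filterlim_comp_2 s t Cplus Ha Hb (filterlim_plus (V := AbsRing_NormedModule C_AbsRing) a b)).
Qed.

Lemma ccv_mult s t a b : ccv s a -> ccv t b -> ccv (fun n => s n * t n) (a * b).
Proof.
  intros Ha Hb. exact (filterlim_comp_2 s t Cmult Ha Hb (filterlim_mult (K := C_AbsRing) a b)).
Qed.

Lemma ccv_scal c s a : ccv s a -> ccv (fun n => c * s n) (c * a).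
Proof. intros H. apply ccv_mult; [apply ccv_const|easy]. Qed.

Lemma ccv_minus s t a b : ccv s a -> ccv t b -> ccv (fun n => s n - t n) (a - b).
Proof.
  intros Ha Hb. apply ccv_ext with (fun n => s n + (-(1)) * t n).
  { intros; ring. }
  replace (a - b) with (a + (-(1)) * b) by ring.
  apply ccv_plus; [easy|]. now apply ccv_scal.
Qed.

Lemma ccv_Cmod_le s l B N : ccv s l ->
  (forall n, (N <= n)%nat -> Cmod (s n) <= B) -> Cmod l <= B.
Proof.
  rewrite ccv_eps. intros H HB. apply Rnot_lt_le. intros Hl.
  destruct (H (Cmod l - B)%R ltac:(lra)) as [M HM].
  specialize (HM (N + M)%nat ltac:(lia)). specialize (HB (N + M)%nat ltac:(lia)).
  pose proof (Cmod_triangle_rev l (s (N + M)%nat)) as Ht.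
  rewrite Cmod_minus_sym in Ht. lra.
Qed.

Lemma ccv_of_bound s l A r : 0 <= r < 1 ->
  (forall n, Cmod (s n - l) <= A * r ^ n) -> ccv s l.
Proof.
  intros Hr H. apply ccv_eps. intros eps He.
  destruct (geo_small A r eps Hr He) as [N HN]. exists N. intros n Hn.
  eapply Rle_lt_trans; [apply H|now apply HN].
Qed.

(** Bridge between the two uniform structures: completeness, and the [lim] inside [inf_prod], live
    on the product structure, all the calculus below on the norm. *)
Lemma ccv_locally s l : ccv s l <-> filterlim s eventually (@locally C_UniformSpace l).
Proof.
  rewrite ccv_eps. split.
  - intros H. apply (filterlim_locally_ball_norm (U := C_NormedModule)). intros eps.
    apply (H eps (cond_pos eps)).
  - intros H eps He.
    apply (proj1 (filterlim_locally_ball_norm (U := C_NormedModule) s l) H (mkposreal eps He)).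
Qed.

Lemma C_complete_seq s :
  (forall eps : R, 0 < eps ->
   exists N, forall n m, (N <= n)%nat -> (N <= m)%nat -> Cmod (s n - s m) < eps) ->
  exists l, ccv s l.
Proof.
  intros H. destruct (proj1 (filterlim_locally_cauchy (U := C_CompleteNormedModule)
    (F := eventually) s)) as [l Hl].
  - intros eps. destruct (H eps (cond_pos eps)) as [N HN].
    exists (fun n => (N <= n)%nat). split; [now exists N|].
    intros u v Hu Hv. apply (norm_compat1 (V := C_NormedModule)). now apply HN.
  - exists l. now apply ccv_locally.
Qed.

(** Telescoping. The explicit tail bound is kept because [cder_lim] needs it uniformly in the point,
    not just the existence of a limit. *)
Lemma geo_Cauchy s A r N0 : 0 <= r < 1 ->
  (forall n, (N0 <= n)%nat -> Cmod (s (S n) - s n) <= A * r ^ n) ->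
  forall n k, (N0 <= n)%nat -> Cmod (s (n + k)%nat - s n) <= A / (1 - r) * r ^ n.
Proof.
  intros Hr H n k Hn.
  assert (HC : 0 <= A * r ^ n) by (eapply Rle_trans; [apply Cmod_ge_0|now apply H]).
  assert (HH : Cmod (s (n + k)%nat - s n) <= A * r ^ n * ((1 - r ^ k) / (1 - r))).
  { induction k as [|k IH].
    - rewrite Nat.add_0_r. replace (s n - s n) with (RtoC 0) by ring.
      rewrite Cmod_0. simpl. unfold Rdiv. lra.
    - replace (s (n + S k)%nat - s n)
        with ((s (S (n + k)) - s (n + k)%nat) + (s (n + k)%nat - s n))
        by (rewrite Nat.add_succ_r; ring).
      eapply Rle_trans; [apply Cmod_triangle|].
      specialize (H (n + k)%nat ltac:(lia)). rewrite pow_add in H.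
      eapply Rle_trans; [apply Rplus_le_compat; [exact H|exact IH]|].
      apply Req_le. simpl. field. lra. }
  eapply Rle_trans; [exact HH|].
  replace (A / (1 - r) * r ^ n)%R with (A * r ^ n * (1 / (1 - r)))%R by (field; lra).
  apply Rmult_le_compat_l; [easy|].
  apply Rmult_le_compat_r. { left; apply Rinv_0_lt_compat; lra. }
  assert (0 <= r ^ k) by (apply pow_le; lra). lra.
Qed.

Lemma geo_ccv s A r N0 : 0 <= r < 1 ->
  (forall n, (N0 <= n)%nat -> Cmod (s (S n) - s n) <= A * r ^ n) ->
  exists l, ccv s l.
Proof.
  intros Hr H. apply C_complete_seq. intros eps He.
  pose proof (geo_Cauchy s A r N0 Hr H) as HC.
  destruct (geo_small (A / (1 - r)) r (eps / 2)) as [N HN]; [easy|lra|].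
  set (K := (N + N0)%nat).
  assert (Hd : forall n, (K <= n)%nat -> Cmod (s n - s K) < eps / 2).
  { intros n Hn. replace n with (K + (n - K))%nat by lia.
    eapply Rle_lt_trans; [apply HC; unfold K; lia|]. apply HN; unfold K; lia. }
  exists K. intros n m Hn Hm.
  replace (s n - s m) with ((s n - s K) - (s m - s K)) by ring.
  eapply Rle_lt_trans; [apply Cmod_minus_le|].
  specialize (Hd n Hn) as H1. specialize (Hd m Hm) as H2. lra.
Qed.

(** The target is C as a module over itself, the setting in which the product rule is available;
    [cder_ex_derive] returns to the module structure that [holo_on] mentions. *)
Definition cder (f : C -> C) (z l : C) : Prop :=
  @is_derive C_AbsRing (AbsRing_NormedModule C_AbsRing) f z l.

Lemma cder_eps (f : C -> C) (z l : C) : cder f z l <->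
  forall eps : R, 0 < eps -> exists d : R, 0 < d /\
  forall h, Cmod h < d -> Cmod (f (z + h)%C - f z - l * h)%C <= eps * Cmod h.
Proof.
  assert (E : forall y : C, y = z + (y - z)) by (intros; ring).
  split.
  - intros [_ H] eps He.
    destruct (H z (fun P HP => HP) (mkposreal eps He)) as [[d Hd] Hf].
    exists d. split; [easy|]. intros h Hh. specialize (Hf (z + h)).
    assert (Eh : z + h - z = h) by ring.
    change (Cmod (z + h - z) < d -> Cmod (f (z + h)%C - f z - (z + h - z) * l)%C <= eps * Cmod (z + h - z))%R in Hf.
    rewrite Eh, (Cmult_comm h) in Hf. now apply Hf.
  - intros H. split; [apply is_linear_scal_l|].
    intros x Hx. apply (@is_filter_lim_locally_unique _ (AbsRing_NormedModule C_AbsRing)) in Hx. subst x.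
    intros eps. destruct (H eps (cond_pos eps)) as [d [Hd Hf]].
    exists (mkposreal d Hd). intros y Hy.
    change (Cmod (f y - f z - (y - z) * l) <= eps * Cmod (y - z)).
    rewrite (Cmult_comm _ l), (E y) at 1. exact (Hf (y - z) Hy).
Qed.

Lemma cder_ext f g z l : (forall y, f y = g y) -> cder f z l -> cder g z l.
Proof. exact (is_derive_ext (V := AbsRing_NormedModule C_AbsRing) f g z l). Qed.

Lemma cder_eq f z a b : a = b -> cder f z a -> cder f z b.
Proof. now intros <-. Qed.

Lemma cder_ext_loc f g z l (r : R) : 0 < r ->
  (forall y, Cmod (y - z) < r -> f y = g y) -> cder f z l -> cder g z l.
Proof.
  intros Hr E. apply (is_derive_ext_loc (V := AbsRing_NormedModule C_AbsRing)).
  now exists (mkposreal r Hr).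
Qed.

Lemma cder_const c z : cder (fun _ => c) z 0.
Proof. exact (is_derive_const (V := AbsRing_NormedModule C_AbsRing) c z). Qed.

Lemma cder_id z : cder (fun y => y) z 1.
Proof. exact (is_derive_id (K := C_AbsRing) z). Qed.

Lemma cder_plus f g z a b :
  cder f z a -> cder g z b -> cder (fun y => f y + g y) z (a + b).
Proof. exact (is_derive_plus (V := AbsRing_NormedModule C_AbsRing) f g z a b). Qed.

Lemma cder_minus f g z a b :
  cder f z a -> cder g z b -> cder (fun y => f y - g y) z (a - b).
Proof. exact (is_derive_minus (V := AbsRing_NormedModule C_AbsRing) f g z a b). Qed.

Lemma cder_mult f g z a b :
  cder f z a -> cder g z b -> cder (fun y => f y * g y) z (a * g z + f z * b).
Proof. intros Hf Hg. exact (is_derive_mult (K := C_AbsRing) f g z a b Hf Hg Cmult_comm). Qed.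

Lemma cder_comp f g z a b :
  cder g z b -> cder f (g z) a -> cder (fun y => f (g y)) z (a * b).
Proof.
  intros Hg Hf. rewrite Cmult_comm.
  exact (is_derive_comp (V := AbsRing_NormedModule C_AbsRing) f g z a b Hf Hg).
Qed.

Lemma cder_ccv f z l s : cder f z l -> ccv s z -> ccv (fun n => f (s n)) (f z).
Proof.
  intros Hf Hs. eapply filterlim_comp; [exact Hs|].
  apply (ex_derive_continuous (V := AbsRing_NormedModule C_AbsRing) f z). now exists l.
Qed.

Lemma cder_scal c f z a : cder f z a -> cder (fun y => c * f y) z (c * a).
Proof.
  intros Hf. replace (c * a) with (0 * f z + c * a) by ring.
  apply (cder_mult (fun _ => c) f); [apply cder_const|easy].
Qed.

Lemma cder_cont f z l : cder f z l ->
  forall eps : R, 0 < eps -> exists d : R, 0 < d /\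
  forall y, Cmod (y - z) < d -> Cmod (f y - f z) < eps.
Proof.
  intros Hf eps He.
  destruct (ex_derive_continuous (V := AbsRing_NormedModule C_AbsRing) f z (ex_intro _ l Hf)
    (fun y => Cmod (y - f z) < eps)%R) as [[d Hd] H]; [now exists (mkposreal eps He)|].
  now exists d.
Qed.

Lemma cder_Cinv (z : C) : z <> 0 -> cder Cinv z (- / (z * z)).
Proof.
  intros Hz. apply cder_eps. intros eps He. pose proof (Cmod_pos_of_ne z Hz) as Hm.
  set (m := Cmod z) in *.
  (* The first bound keeps |z + h| above m/2; the second then makes the remainder h^2 / (z^2 (z +
     h)) at most eps |h|. *)
  exists (Rmin (m / 2) (eps * (m * m * m / 2))). split.
  { apply Rmin_pos; [lra|]. repeat apply Rmult_lt_0_compat; lra. }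
  intros h Hh.
  apply Rlt_Rmin_inv in Hh as [Hh1 Hh2].
  assert (Hzh : m / 2 < Cmod (z + h)).
  { pose proof (Cmod_triangle_rev z (- h)) as Ht. rewrite Cmod_opp in Ht.
    replace (z - - h) with (z + h) in Ht by ring. fold m in Ht. lra. }
  assert (Hzh0 : z + h <> 0). { intros E; rewrite E, Cmod_0 in Hzh; lra. }
  replace (/ (z + h) - / z - - / (z * z) * h) with ((h * h) * / (z * z * (z + h)))
    by (field; auto).
  rewrite Cmod_mult, Cmod_inv, !Cmod_mult by (repeat apply Cmult_neq_0; easy).
  fold m.
  apply Rle_trans with (Cmod h * Cmod h * / (m * m * (m / 2)))%R.
  { apply Rmult_le_compat_l; [apply Rmult_le_pos; apply Cmod_ge_0|].
    apply Rinv_le_contravar; [repeat apply Rmult_lt_0_compat; lra|].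
    apply Rmult_le_compat_l; [nra|lra]. }
  replace (eps * Cmod h)%R with (Cmod h * (eps * (m * m * m / 2)) * / (m * m * (m / 2)))%R
    by (field; lra).
  apply Rmult_le_compat_r.
  { left; apply Rinv_0_lt_compat. repeat apply Rmult_lt_0_compat; lra. }
  apply Rmult_le_compat_l; [apply Cmod_ge_0|lra].
Qed.

Lemma cder_inv (f : C -> C) (z a : C) : f z <> 0 -> cder f z a ->
  cder (fun y => / f y) z (- a / (f z * f z)).
Proof.
  intros Hz Hf. apply cder_eq with (- / (f z * f z) * a); [field; easy|].
  apply (cder_comp Cinv f); [easy|]. now apply cder_Cinv.
Qed.

Lemma cder_div (f g : C -> C) (z a b : C) : g z <> 0 -> cder f z a -> cder g z b ->
  cder (fun y => f y / g y) z ((a * g z - f z * b) / (g z * g z)).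
Proof.
  intros Hz Hf Hg. apply cder_eq with (a * / g z + f z * (- b / (g z * g z))).
  { field; easy. }
  apply (cder_mult f (fun y => / g y)); [easy|]. now apply cder_inv.
Qed.

Lemma cder_pow (n : nat) z : cder (fun y => y ^ n) z (INR n * z ^ (n - 1)).
Proof.
  induction n as [|n IH].
  - apply cder_eq with (RtoC 0); [simpl; ring|]. exact (cder_const 1 z).
  - apply cder_ext with (fun y => y * y ^ n); [intros; rewrite Cpow_S; easy|].
    eapply cder_eq; [|apply cder_mult; [apply cder_id|exact IH]]. cbv beta.
    replace (S n - 1)%nat with n by lia. rewrite S_INR, RtoC_plus.
    destruct n as [|n]; [simpl; ring|].
    replace (S n - 1)%nat with n by lia. rewrite !Cpow_S. ring.
Qed.

Lemma cder_ex_derive f z l : cder f z l -> @ex_derive C_AbsRing C_NormedModule f z.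
Proof. intros H. exists l. split; [apply is_linear_scal_l|apply H]. Qed.

Lemma ccv_inv s (a : C) : a <> 0 -> ccv s a -> ccv (fun n => / s n) (/ a).
Proof. intros Ha. exact (cder_ccv Cinv a _ s (cder_Cinv a Ha)). Qed.

(** * Limits of holomorphic functions and infinite products *)

Lemma Re_le_Cmod (c : C) : Re c <= Cmod c.
Proof. eapply Rle_trans; [apply Rle_abs|apply re_le_Cmod]. Qed.

(** There is no mean value theorem for complex values; multiplying by a fixed w and taking the real
    part along a segment reduces to the real one. *)
Lemma cder_segment (f : C -> C) (f' : C -> C) (a b w : C) (t : R) :
  cder f (a + t * (b - a)) (f' (a + t * (b - a))) ->
  derivable_pt_lim (fun t : R => Re (w * f (a + t * (b - a)))) t
    (Re (w * (f' (a + t * (b - a)) * (b - a)))).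
Proof.
  intros H. set (z := a + t * (b - a)) in *.
  pose proof (Cmod_ge_0 w) as Hw. pose proof (Cmod_ge_0 (b - a)) as Hba.
  assert (H1 : cder (fun y => w * f y) z (w * f' z)) by now apply cder_scal.
  rewrite cder_eps in H1.
  intros eps He. cbv beta.
  destruct (H1 (eps / 2 / (Cmod (b - a) + 1))%R) as [d [Hd Hf]].
  { apply Rdiv_lt_0_compat; lra. }
  assert (Hdp : 0 < d / (Cmod (b - a) + 1)) by (apply Rdiv_lt_0_compat; lra).
  exists (mkposreal _ Hdp). intros h Hh Hhd. simpl in Hhd.
  assert (Hm : Cmod (h * (b - a)) = (Rabs h * Cmod (b - a))%R)
    by (now rewrite Cmod_mult, Cmod_R).
  pose proof (Rabs_pos_lt h Hh) as Hh0.
  assert (Hlt : Rabs h * (Cmod (b - a) + 1) < d).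
  { replace d with (d / (Cmod (b - a) + 1) * (Cmod (b - a) + 1))%R by (field; lra).
    apply Rmult_lt_compat_r; lra. }
  specialize (Hf (h * (b - a))). rewrite Hm in Hf. specialize (Hf ltac:(nra)).
  replace (a + (t + h)%R * (b - a)) with (z + h * (b - a))
    by (unfold z; rewrite RtoC_plus; ring). fold z.
  replace ((Re (w * f (z + h * (b - a))%C) - Re (w * f z)) / h - Re (w * (f' z * (b - a))))%R
    with (Re (w * f (z + h * (b - a))%C - w * f z - w * f' z * (h * (b - a))) / h)%R.
  2:{ replace (w * f' z * (h * (b - a))) with (h * (w * (f' z * (b - a)))) by ring.
      unfold Cminus. rewrite !re_plus, !re_opp, re_scal_l. now field. }
  unfold Rdiv. rewrite Rabs_mult, Rabs_inv.
  apply Rmult_lt_reg_r with (Rabs h); [easy|].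
  rewrite Rmult_assoc, Rinv_l, Rmult_1_r by lra.
  eapply Rle_lt_trans; [apply re_le_Cmod|].
  eapply Rle_lt_trans; [exact Hf|].
  apply Rle_lt_trans with (eps / 2 / (Cmod (b - a) + 1) * (Rabs h * (Cmod (b - a) + 1)))%R.
  { apply Rmult_le_compat_l; [left; apply Rdiv_lt_0_compat; lra|nra]. }
  replace (eps / 2 / (Cmod (b - a) + 1) * (Rabs h * (Cmod (b - a) + 1)))%R
    with (eps / 2 * Rabs h)%R by (field; lra).
  nra.
Qed.

Lemma mean_value_ineq (f f' : C -> C) (a b : C) (M : R) :
  (forall t : R, 0 <= t <= 1 -> cder f (a + t * (b - a)) (f' (a + t * (b - a)))) ->
  (forall t : R, 0 <= t <= 1 -> Cmod (f' (a + t * (b - a))%C) <= M) ->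
  Cmod (f b - f a) <= M * Cmod (b - a).
Proof.
  intros Hd HM.
  (* With this multiplier the real increment is |f b - f a|^2, so one factor |f b - f a| can be
     cancelled at the end. *)
  set (w := Cconj (f b - f a)).
  destruct (MVT_cor2 (fun t : R => Re (w * f (a + t * (b - a))))
    (fun t : R => Re (w * (f' (a + t * (b - a)) * (b - a)))) 0 1) as [t [Ht Ht01]]; [lra| |].
  { intros t Ht. apply (cder_segment f f'). now apply Hd. }
  replace (a + 1%R * (b - a)) with b in Ht by ring.
  replace (a + 0%R * (b - a)) with a in Ht by ring.
  assert (Hl : (Re (w * f b) - Re (w * f a))%R = (Cmod (f b - f a) * Cmod (f b - f a))%R).
  { transitivity (Re (w * (f b - f a))).
    { replace (w * (f b - f a)) with (w * f b - w * f a) by ring.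
      unfold Cminus. now rewrite re_plus, re_opp. }
    unfold w. rewrite Cmult_comm, <- Cmod2_conj. simpl. ring. }
  rewrite Hl in Ht.
  assert (Hr : Re (w * (f' (a + t * (b - a))%C * (b - a))) * (1 - 0) <=
            Cmod (f b - f a) * (M * Cmod (b - a))).
  { replace (1 - 0)%R with 1%R by ring. rewrite Rmult_1_r.
    eapply Rle_trans; [apply Re_le_Cmod|]. rewrite !Cmod_mult.
    unfold w. rewrite Cmod_conj. apply Rmult_le_compat_l; [apply Cmod_ge_0|].
    apply Rmult_le_compat_r; [apply Cmod_ge_0|]. apply HM; lra. }
  destruct (Cmod_ge_0 (f b - f a)) as [Hp | Hp].
  - apply Rmult_le_reg_l with (Cmod (f b - f a)); [easy|]. rewrite <- Ht in Hr. lra.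
  - rewrite <- Hp. apply Rmult_le_pos; [|apply Cmod_ge_0].
    eapply Rle_trans; [apply Cmod_ge_0|apply (HM 0%R); lra].
Qed.

Lemma cder_zero_const (U : C -> Prop) (f : C -> C) :
  (forall a b (t : R), U a -> U b -> 0 <= t <= 1 -> U (a + t * (b - a))) ->
  (forall y, U y -> cder f y 0) -> forall a b, U a -> U b -> f a = f b.
Proof.
  intros Hc Hd a b Ha Hb. symmetry. apply Ceq_minus, Cmod_eq_0.
  apply Rle_antisym; [|apply Cmod_ge_0].
  replace 0%R with (0 * Cmod (b - a))%R by ring.
  apply (mean_value_ineq f (fun _ => 0)).
  - intros t Ht. now apply Hd, Hc.
  - intros t Ht. rewrite Cmod_0. lra.
Qed.

Lemma ball_segment (z y : C) (t r : R) :
  0 <= t <= 1 -> Cmod (y - z) < r -> Cmod (z + t * (y - z) - z) < r.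
Proof.
  intros Ht H. replace (z + t * (y - z) - z) with (t * (y - z)) by ring.
  rewrite Cmod_mult, Cmod_R, Rabs_pos_eq by lra.
  pose proof (Cmod_ge_0 (y - z)). nra.
Qed.

(** An eps/3 argument. The mean value inequality applied to [F n - F N] carries the uniform
    geometric bound on the derivatives over to the difference quotients, and the limit in n keeps
    it. *)
Lemma cder_lim (F F' : nat -> C -> C) (L : C -> C) (z l : C) (rho A r : R) (N0 : nat) :
  0 < rho -> 0 <= r < 1 ->
  (forall n y, Cmod (y - z) < rho -> cder (F n) y (F' n y)) ->
  (forall n y, (N0 <= n)%nat -> Cmod (y - z) < rho ->
     Cmod (F' (S n) y - F' n y) <= A * r ^ n) ->
  (forall y, Cmod (y - z) < rho -> ccv (fun n => F n y) (L y)) ->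
  ccv (fun n => F' n z) l ->
  cder L z l.
Proof.
  intros Hrho Hr HF HA HL Hl. apply cder_eps. intros eps He.
  set (D := (A / (1 - r))%R).
  assert (HD : forall n k y, (N0 <= n)%nat -> Cmod (y - z) < rho ->
    Cmod (F' (n + k)%nat y - F' n y) <= D * r ^ n).
  { intros n k y Hn Hy. apply (geo_Cauchy (fun n => F' n y) A r N0); auto. }
  assert (Hz0 : Cmod (z - z) < rho).
  { replace (z - z) with (RtoC 0) by ring. now rewrite Cmod_0. }
  destruct (geo_small D r (eps / 3)) as [N1 HN1]; [easy|lra|].
  set (N := (N1 + N0)%nat).
  assert (HDN : D * r ^ N <= eps / 3) by (left; apply HN1; unfold N; lia).
  assert (HlN : Cmod (l - F' N z) <= eps / 3).
  { apply (ccv_Cmod_le (fun n => F' n z - F' N z) _ _ N).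
    - apply ccv_minus; [easy|apply ccv_const].
    - intros n Hn. replace n with (N + (n - N))%nat by lia.
      eapply Rle_trans; [apply HD; [unfold N; lia|easy]|easy]. }
  destruct (proj1 (cder_eps _ _ _) (HF N z Hz0) (eps / 3)%R ltac:(lra)) as [d [Hd HdN]].
  exists (Rmin d rho). split. { now apply Rmin_pos. }
  intros h Hh. apply Rlt_Rmin_inv in Hh as [Hh Hhr]. specialize (HdN h Hh).
  assert (Hzh : Cmod (z + h - z) < rho) by (now replace (z + h - z) with h by ring).
  assert (HLN : Cmod ((L (z + h)%C - L z) - (F N (z + h)%C - F N z))%C <= eps / 3 * Cmod h).
  { apply (ccv_Cmod_le (fun n => (F n (z + h) - F n z) - (F N (z + h) - F N z)) _ _ N).
    - apply ccv_minus; [|apply ccv_const]. apply ccv_minus; now apply HL.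
    - intros n Hn.
      replace (F n (z + h) - F n z - (F N (z + h) - F N z)) with
        ((F n (z + h) - F N (z + h)) - (F n z - F N z)) by ring.
      replace (Cmod h) with (Cmod (z + h - z)) by (f_equal; ring).
      apply (mean_value_ineq (fun y => F n y - F N y) (fun y => F' n y - F' N y)).
      + intros t Ht. apply cder_minus; apply HF; now apply ball_segment.
      + intros t Ht. replace n with (N + (n - N))%nat by lia.
        eapply Rle_trans; [apply HD; [unfold N; lia|now apply ball_segment]|easy]. }
  replace (L (z + h) - L z - l * h) with
    (((L (z + h) - L z) - (F N (z + h) - F N z)) + (F N (z + h) - F N z - F' N z * h)
     - (l - F' N z) * h) by ring.
  eapply Rle_trans; [apply Cmod_minus_le|].
  eapply Rle_trans; [apply Rplus_le_compat_r, Cmod_triangle|].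
  rewrite Cmod_mult. pose proof (Cmod_ge_0 h). nra.
Qed.

(** The same total limit as in [inf_prod], so that one uniqueness lemma serves both the products of
    the statement and the lattice sums below. *)
Definition clim (s : nat -> C) : C :=
  @lim C_CompleteNormedModule (filtermap s eventually).

Lemma clim_unique (s : nat -> C) (l : C) : ccv s l -> clim s = l.
Proof.
  intros H. apply (ccv_unique s); [|exact H]. apply ccv_locally. apply ccv_locally in H.
  intros P [eps HP]. apply (filter_imp (F := eventually) (fun n => ball (clim s) eps (s n))).
  { intros n. apply HP. }
  apply (complete_cauchy (T := C_CompleteNormedModule) (filtermap s eventually)).
  - apply filtermap_proper_filter, eventually_filter.
  - intros e. exists l. apply H. now exists e.
Qed.

Lemma inf_prod_unique (u : nat -> C) (l : C) :
  ccv (partial_prod u) l -> inf_prod u = l.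
Proof. apply clim_unique. Qed.

Section Products.

Variables (u : nat -> C) (A r : R).
Hypothesis Hr : 0 <= r < 1.
Hypothesis Hu : forall n, Cmod (u n - 1) <= A * r ^ n.

Let gsum (n : nat) : R := (A * ((1 - r ^ n) / (1 - r)))%R.

Lemma geo_factor_nonneg : 0 <= A.
Proof. specialize (Hu 0%nat). simpl in Hu. pose proof (Cmod_ge_0 (u 0%nat - 1)). lra. Qed.

Lemma geo_sum_succ n : gsum (S n) = (gsum n + A * r ^ n)%R.
Proof. unfold gsum. simpl. field. lra. Qed.

Lemma geo_sum_bound n : 0 <= gsum n <= A / (1 - r).
Proof.
  pose proof geo_factor_nonneg as HA.
  assert (Hp : 0 <= r ^ n <= 1).
  { split; [apply pow_le; lra|]. rewrite <- (pow1 n). apply pow_incr; lra. }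
  assert (Hi : 0 < / (1 - r)) by (apply Rinv_0_lt_compat; lra).
  unfold gsum, Rdiv. split.
  - apply Rmult_le_pos; [easy|]. apply Rmult_le_pos; lra.
  - apply Rmult_le_compat_l; [easy|]. nra.
Qed.

(** Each factor is at most 1 + A r^n <= exp (A r^n), so the product is bounded by the exponential of
    a geometric sum. *)
Lemma partial_prod_le_exp n : Cmod (partial_prod u n) <= exp (gsum n).
Proof.
  induction n as [|n IH].
  - simpl. rewrite Cmod_1. unfold gsum. simpl.
    replace (A * ((1 - 1) / (1 - r)))%R with 0%R by (field; lra). rewrite exp_0. lra.
  - change (partial_prod u (S n)) with (partial_prod u n * u n).
    rewrite Cmod_mult, geo_sum_succ, exp_plus.
    apply Rmult_le_compat; try apply Cmod_ge_0; [easy|].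
    apply Rle_trans with (1 + A * r ^ n)%R; [|apply exp_ineq1_le].
    replace (u n) with ((u n - 1) + 1) by ring.
    eapply Rle_trans; [apply Cmod_triangle|]. rewrite Cmod_1. specialize (Hu n). lra.
Qed.

Lemma partial_prod_bound n : Cmod (partial_prod u n) <= exp (A / (1 - r)).
Proof.
  eapply Rle_trans; [apply partial_prod_le_exp|].
  destruct (geo_sum_bound n) as [_ [H|H]]; [left; now apply exp_increasing|rewrite H; lra].
Qed.

Lemma partial_prod_step n :
  Cmod (partial_prod u (S n) - partial_prod u n)
    <= exp (A / (1 - r)) * A * r ^ n.
Proof.
  change (partial_prod u (S n)) with (partial_prod u n * u n).
  replace (partial_prod u n * u n - partial_prod u n)
    with (partial_prod u n * (u n - 1)) by ring.
  rewrite Cmod_mult, Rmult_assoc.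
  apply Rmult_le_compat; try apply Cmod_ge_0; [apply partial_prod_bound|apply Hu].
Qed.

Lemma inf_prod_ccv : ccv (partial_prod u) (inf_prod u).
Proof.
  destruct (geo_ccv (partial_prod u) (exp (A / (1 - r)) * A) r 0 Hr) as [l Hl].
  { intros n _. apply partial_prod_step. }
  now rewrite (inf_prod_unique u l Hl).
Qed.

Variable (du : nat -> C).
Hypothesis Hdu : forall n, Cmod (du n) <= A * r ^ n.

(** The product rule as a recursion, with no division: differentiability then holds also where a
    factor vanishes. The form with logarithmic derivatives is recovered in
    [partial_prod_der_log]. *)
Fixpoint partial_prod_der (u du : nat -> C) (N : nat) : C :=
  match N with
  | O => 0
  | S n => partial_prod_der u du n * u n + partial_prod u n * du n
  end.

Lemma partial_prod_der_le n :
  Cmod (partial_prod_der u du n) <= exp (gsum n) * gsum n.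
Proof.
  induction n as [|n IH].
  - simpl. rewrite Cmod_0. unfold gsum. simpl.
    replace (A * ((1 - 1) / (1 - r)))%R with 0%R by (field; lra). lra.
  - cbn [partial_prod_der]. eapply Rle_trans; [apply Cmod_triangle|].
    rewrite !Cmod_mult, geo_sum_succ, exp_plus.
    pose proof (partial_prod_le_exp n) as H1.
    pose proof (exp_ineq1_le (A * r ^ n)) as H2.
    pose proof (exp_pos (gsum n)) as H3.
    pose proof (geo_sum_bound n) as H4.
    assert (Han : 0 <= A * r ^ n)
      by (apply Rmult_le_pos; [apply geo_factor_nonneg|apply pow_le; lra]).
    assert (H5 : Cmod (u n) <= exp (A * r ^ n)).
    { eapply Rle_trans; [|exact H2].
      replace (u n) with ((u n - 1) + 1) by ring.
      eapply Rle_trans; [apply Cmod_triangle|]. rewrite Cmod_1. specialize (Hu n). lra. }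
    apply Rle_trans with (exp (gsum n) * gsum n * exp (A * r ^ n) + exp (gsum n) * (A * r ^ n))%R.
    + apply Rplus_le_compat; apply Rmult_le_compat; try apply Cmod_ge_0; easy.
    + assert (exp (gsum n) * (A * r ^ n) * 1 <= exp (gsum n) * (A * r ^ n) * exp (A * r ^ n)).
      { apply Rmult_le_compat_l; [|lra]. apply Rmult_le_pos; lra. }
      lra.
Qed.

Lemma partial_prod_der_step n :
  Cmod (partial_prod_der u du (S n) - partial_prod_der u du n)
    <= (exp (A / (1 - r)) * (A / (1 - r)) + exp (A / (1 - r))) * A * r ^ n.
Proof.
  cbn [partial_prod_der].
  replace (partial_prod_der u du n * u n + partial_prod u n * du n - partial_prod_der u du n)
    with (partial_prod_der u du n * (u n - 1) + partial_prod u n * du n) by ring.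
  eapply Rle_trans; [apply Cmod_triangle|]. rewrite !Cmod_mult, Rmult_assoc, Rmult_plus_distr_r.
  pose proof (partial_prod_der_le n) as H1. pose proof (geo_sum_bound n) as H2.
  apply Rplus_le_compat; apply Rmult_le_compat; try apply Cmod_ge_0; auto.
  - eapply Rle_trans; [exact H1|]. apply Rmult_le_compat; [left; apply exp_pos|lra| |lra].
    destruct (geo_sum_bound n) as [_ [H|H]]; [left; now apply exp_increasing|rewrite H; lra].
  - apply partial_prod_bound.
Qed.

Lemma partial_prod_der_ccv : exists l, ccv (partial_prod_der u du) l.
Proof.
  apply (geo_ccv _ ((exp (A / (1 - r)) * (A / (1 - r)) + exp (A / (1 - r))) * A) r 0 Hr).
  intros n _. apply partial_prod_der_step.
Qed.

End Products.

Lemma cder_partial_prod (u u' : nat -> C -> C) (y : C) :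
  (forall n, cder (u n) y (u' n y)) ->
  forall n, cder (fun y => partial_prod (fun n => u n y) n) y
    (partial_prod_der (fun n => u n y) (fun n => u' n y) n).
Proof.
  intros H n. induction n as [|n IH].
  - exact (cder_const 1 y).
  - cbn [partial_prod partial_prod_der].
    apply (cder_mult (fun y => partial_prod (fun n => u n y) n) (u n)); auto.
Qed.

Lemma cder_inf_prod (u u' : nat -> C -> C) (z : C) (rho A r : R) :
  0 < rho -> 0 <= r < 1 ->
  (forall n y, Cmod (y - z) < rho -> cder (u n) y (u' n y)) ->
  (forall n y, Cmod (y - z) < rho -> Cmod (u n y - 1) <= A * r ^ n) ->
  (forall n y, Cmod (y - z) < rho -> Cmod (u' n y) <= A * r ^ n) ->
  exists l, cder (fun y => inf_prod (fun n => u n y)) z l /\ ccv (partial_prod_der (fun n => u n z) (fun n => u' n z)) l.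
Proof.
  intros Hrho Hr Hd Hb Hb'.
  assert (Hz0 : Cmod (z - z) < rho).
  { replace (z - z) with (RtoC 0) by ring. now rewrite Cmod_0. }
  destruct (partial_prod_der_ccv (fun n => u n z) A r Hr) with (du := fun n => u' n z)
    as [l Hl]; auto.
  exists l. split; [|easy].
  eapply (cder_lim (fun n y => partial_prod (fun n => u n y) n)
    (fun n y => partial_prod_der (fun n => u n y) (fun n => u' n y) n)) with (N0 := 0%nat); eauto.
  - intros n y Hy. apply cder_partial_prod. intros k. now apply Hd.
  - intros n y _ Hy. apply partial_prod_der_step; auto.
  - intros y Hy. apply (inf_prod_ccv (fun n => u n y) A r); auto.
Qed.

Lemma partial_prod_der_log (u du : nat -> C) (s : nat -> C) :
  s O = 0 -> (forall n, s (S n) = s n + du n / u n) -> (forall n, u n <> 0) ->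
  forall n, partial_prod_der u du n = partial_prod u n * s n.
Proof.
  intros H0 Hs Hu n. induction n as [|n IH].
  - simpl. rewrite H0. ring.
  - cbn [partial_prod partial_prod_der]. rewrite IH, Hs. field. apply Hu.
Qed.

Lemma partial_prod_ext (u v : nat -> C) n :
  (forall k, (k < n)%nat -> u k = v k) -> partial_prod u n = partial_prod v n.
Proof.
  induction n as [|n IH]; intros H; [easy|].
  cbn [partial_prod]. rewrite IH, (H n); auto.
Qed.

Lemma inf_prod_ext (u v : nat -> C) : (forall k, u k = v k) -> inf_prod u = inf_prod v.
Proof.
  intros H. unfold inf_prod.
  replace (partial_prod u) with (partial_prod v); [easy|].
  apply FunctionalExtensionality.functional_extensionality. intros n.
  apply partial_prod_ext. auto.
Qed.

Lemma partial_prod_mult (u v : nat -> C) n :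
  partial_prod (fun k => u k * v k) n = partial_prod u n * partial_prod v n.
Proof. induction n as [|n IH]; cbn [partial_prod]; [ring|]. rewrite IH; ring. Qed.

Lemma partial_prod_one n : partial_prod (fun _ => 1) n = 1.
Proof. induction n as [|n IH]; cbn [partial_prod]; [easy|]. rewrite IH; ring. Qed.

(** The induction lowers the threshold by one each time, absorbing a single exceptional term into
    the constant. *)
Lemma geo_eventually (a : nat -> R) (A r : R) (N : nat) : 0 < r ->
  (forall n, (N <= n)%nat -> a n <= A * r ^ n) ->
  exists B, 0 <= B /\ forall n, a n <= B * r ^ n.
Proof.
  intros Hr. revert A. induction N as [|N IH]; intros A H.
  - exists (Rmax A 0). split; [apply Rmax_r|]. intros n. specialize (H n ltac:(lia)).
    eapply Rle_trans; [exact H|]. apply Rmult_le_compat_r; [apply pow_le; lra|apply Rmax_l].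
  - apply (IH (Rmax A (a N / r ^ N)%R)). intros n Hn.
    assert (Hp : 0 < r ^ n) by (apply pow_lt; lra).
    destruct (Nat.eq_dec n N) as [->|Hne].
    + apply Rle_trans with (a N / r ^ N * r ^ N)%R; [apply Req_le; field; lra|].
      apply Rmult_le_compat_r; [lra|apply Rmax_r].
    + eapply Rle_trans; [apply H; lia|]. apply Rmult_le_compat_r; [lra|apply Rmax_l].
Qed.

(* The reciprocal product also converges, and the two limits multiply to 1. *)
Lemma inf_prod_neq_0 (u : nat -> C) (A r : R) : 0 < r < 1 ->
  (forall n, Cmod (u n - 1) <= A * r ^ n) -> (forall n, u n <> 0) ->
  inf_prod u <> 0.
Proof.
  intros Hr Hu Hn0.
  destruct (geo_small A r (1 / 2)) as [N HN]; [lra|lra|].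
  destruct (geo_eventually (fun n => Cmod (/ u n - 1)) (2 * A) r N) as [B [_ HB]]; [lra| |].
  { intros n Hn. specialize (HN n Hn). specialize (Hu n).
    assert (H12 : 1 / 2 < Cmod (u n)).
    { pose proof (Cmod_triangle_rev 1 (1 - u n)) as Ht. rewrite Cmod_1 in Ht.
      replace (1 - (1 - u n)) with (u n) in Ht by ring.
      rewrite Cmod_minus_sym in Hu. lra. }
    replace (/ u n - 1) with ((1 - u n) * / u n) by (field; auto).
    rewrite Cmod_mult, Cmod_inv, Cmod_minus_sym by auto.
    apply Rmult_le_reg_r with (Cmod (u n)); [lra|].
    rewrite Rmult_assoc, Rinv_l, Rmult_1_r by lra.
    pose proof (Cmod_ge_0 (u n - 1)). nra. }
  intros E.
  assert (H1 := inf_prod_ccv u A r ltac:(lra) Hu).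
  assert (H2 := inf_prod_ccv _ B r ltac:(lra) HB).
  assert (H3 := ccv_mult _ _ _ _ H1 H2). rewrite E in H3.
  assert (H4 : ccv (fun _ => RtoC 1) (0 * inf_prod (fun n => / u n))).
  { eapply ccv_ext; [|exact H3]. intros n. cbv beta.
    rewrite <- partial_prod_mult. rewrite <- (partial_prod_one n).
    apply partial_prod_ext. intros k _. field. auto. }
  assert (H5 := ccv_unique _ _ _ H4 (ccv_const 1)).
  rewrite Cmult_0_l in H5. now apply C1_nz.
Qed.

(** * The exponential and the theta product *)

Lemma exp_le x y : x <= y -> exp x <= exp y.
Proof. intros [H|H]; [left; now apply exp_increasing|rewrite H; lra]. Qed.

Lemma cexp_plus a b : cexp (a + b) = cexp a * cexp b.
Proof.
  destruct a as [a1 a2], b as [b1 b2]. unfold cexp, Cmult, Cplus; simpl.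
  rewrite exp_plus, cos_plus, sin_plus. f_equal; ring.
Qed.

Lemma cexp_0 : cexp 0 = 1.
Proof. unfold cexp; simpl. rewrite exp_0, cos_0, sin_0. unfold RtoC. f_equal; ring. Qed.

Lemma Cmod_cexp a : Cmod (cexp a) = exp (Re a).
Proof.
  destruct a as [a b]. unfold Cmod, cexp, Re; simpl.
  replace (exp a * cos b * (exp a * cos b * 1) + exp a * sin b * (exp a * sin b * 1))%R
    with (exp a * exp a * (Rsqr (sin b) + Rsqr (cos b)))%R by (unfold Rsqr; ring).
  rewrite sin2_cos2, Rmult_1_r. apply sqrt_square. left; apply exp_pos.
Qed.

Lemma derivable_pt_lim_abs f x l : derivable_pt_lim f x l ->
  forall eps : R, 0 < eps -> exists d : R, 0 < d /\
  forall h : R, Rabs h < d -> Rabs (f (x + h) - f x - l * h) <= eps * Rabs h.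
Proof.
  intros H eps He. destruct (H eps He) as [[d Hd] Hf]. exists d. split; [easy|].
  intros h Hh. destruct (Req_dec h 0) as [->|Hn].
  - replace (f (x + 0) - f x - l * 0)%R with 0%R by (rewrite Rplus_0_r; ring).
    rewrite Rabs_R0. lra.
  - specialize (Hf h Hn Hh).
    replace (f (x + h) - f x - l * h)%R with (((f (x + h) - f x) / h - l) * h)%R by (now field).
    rewrite Rabs_mult. apply Rmult_le_compat_r; [apply Rabs_pos|lra].
Qed.

Lemma cder_cexp_0 : cder cexp 0 1.
Proof.
  (* The errors below add up to 9 e |h| = (1 + 3 + 4 + 1) e |h|, whence eps/10. The bounds e <= 1
     and |h| < e control exp and the product (exp a - 1) sin b. *)
  apply cder_eps. intros eps He. set (e := Rmin 1 (eps / 10)).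
  assert (Hee : (0 < e <= 1 /\ e <= eps / 10)).
  { unfold e. repeat split; [apply Rmin_pos; lra|apply Rmin_l|apply Rmin_r]. }
  destruct (derivable_pt_lim_abs exp 0 1 derivable_pt_lim_exp_0 e ltac:(lra)) as [d1 [Hd1 H1]].
  destruct (derivable_pt_lim_abs sin 0 1 derivable_pt_lim_sin_0 e ltac:(lra)) as [d2 [Hd2 H2]].
  assert (Hc := derivable_pt_lim_cos 0). rewrite sin_0, Ropp_0 in Hc.
  destruct (derivable_pt_lim_abs cos 0 0 Hc e ltac:(lra)) as [d3 [Hd3 H3]].
  exists (Rmin (Rmin d1 d2) (Rmin d3 e)). split. { repeat apply Rmin_pos; lra. }
  intros h Hh.
  apply Rlt_Rmin_inv in Hh as [Hh Hh']. apply Rlt_Rmin_inv in Hh as [Hh1 Hh2].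
  apply Rlt_Rmin_inv in Hh' as [Hh3 Hh4].
  replace (cexp (0 + h) - cexp 0 - 1 * h) with (cexp h - 1 - h)
    by (rewrite cexp_0, Cplus_0_l; ring).
  pose proof (re_le_Cmod h) as Ha. pose proof (im_le_Cmod h) as Hb.
  pose proof (Cmod_ge_0 h) as Hm.
  destruct h as [a b]. cbn [Re Im fst snd] in Ha, Hb. set (m := Cmod (a, b)) in *.
  specialize (H1 a ltac:(lra)). specialize (H2 b ltac:(lra)). specialize (H3 b ltac:(lra)).
  rewrite Rplus_0_l in H1, H2, H3. rewrite exp_0 in H1. rewrite sin_0 in H2. rewrite cos_0 in H3.
  replace (1 * a)%R with a in H1 by ring. replace (1 * b)%R with b in H2 by ring.
  replace (cos b - 1 - 0 * b)%R with (cos b - 1)%R in H3 by ring.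
  replace (sin b - 0 - b)%R with (sin b - b)%R in H2 by ring.
  set (ea := exp a) in *. set (sb := sin b) in *. set (cb := cos b) in *.
  assert (Hea : Rabs (ea - 1) <= 2 * Rabs a).
  { replace (ea - 1)%R with ((ea - 1 - a) + a)%R by ring.
    eapply Rle_trans; [apply Rabs_triang|]. pose proof (Rabs_pos a). nra. }
  assert (Hea2 : Rabs ea <= 3).
  { replace ea with ((ea - 1) + 1)%R by ring.
    eapply Rle_trans; [apply Rabs_triang|]. rewrite Rabs_R1. lra. }
  assert (Hsb : Rabs sb <= 2 * Rabs b).
  { replace sb with ((sb - b) + b)%R by ring.
    eapply Rle_trans; [apply Rabs_triang|]. pose proof (Rabs_pos b). nra. }
  replace (cexp (a, b) - 1 - (a, b)) with
    (RtoC ((ea - 1 - a) + ea * (cb - 1)) + Ci * RtoC ((ea - 1) * sb + (sb - b))).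
  2:{ unfold cexp, Cminus, Cplus, Copp, Cmult, RtoC, Ci; simpl. fold ea sb cb. f_equal; ring. }
  eapply Rle_trans; [apply Cmod_triangle|]. rewrite Cmod_mult, !Cmod_R.
  replace (Cmod Ci) with 1%R
    by (unfold Cmod, Ci; simpl; rewrite <- sqrt_1 at 1; f_equal; ring).
  pose proof (Rabs_triang (ea - 1 - a) (ea * (cb - 1))) as T1. rewrite Rabs_mult in T1.
  pose proof (Rabs_triang ((ea - 1) * sb) (sb - b)) as T2. rewrite Rabs_mult in T2.
  assert (B1 : Rabs ea * Rabs (cb - 1) <= 3 * (e * m)).
  { apply Rmult_le_compat; try apply Rabs_pos; [easy|]. nra. }
  assert (B2 : Rabs (ea - 1) * Rabs sb <= (2 * e) * (2 * m)).
  { apply Rmult_le_compat; try apply Rabs_pos; lra. }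
  assert (B3 : e * Rabs a <= e * m) by (apply Rmult_le_compat_l; lra).
  assert (B4 : e * Rabs b <= e * m) by (apply Rmult_le_compat_l; lra).
  assert (B5 : e * m <= eps / 10 * m) by (apply Rmult_le_compat_r; lra).
  assert (0 <= eps * m) by (apply Rmult_le_pos; lra). lra.
Qed.

Lemma cder_cexp a : cder cexp a (cexp a).
Proof.
  apply cder_ext with (fun y => cexp a * cexp (y - a)).
  { intros y. rewrite <- cexp_plus. f_equal; ring. }
  apply cder_eq with (cexp a * (1 * 1)); [ring|]. apply cder_scal.
  apply (cder_comp cexp (fun y => y - a)).
  - apply cder_eq with (1 - 0); [ring|]. apply cder_minus; [apply cder_id|apply cder_const].
  - replace (a - a) with (RtoC 0) by ring. apply cder_cexp_0.
Qed.

Definition ee (w : C) : C := cexp (RtoC (2 * PI) * Ci * w).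

Definition tpi : C := RtoC (2 * PI) * Ci.

Lemma tpi_neq_0 : tpi <> 0.
Proof.
  apply Cmult_neq_0; [|apply Ci_nz]. intros H. apply RtoC_inj in H.
  pose proof PI_RGT_0; lra.
Qed.

Lemma ee_plus a b : ee (a + b) = ee a * ee b.
Proof. unfold ee. rewrite <- cexp_plus. f_equal; ring. Qed.

Lemma ee_0 : ee 0 = 1.
Proof. unfold ee. rewrite Cmult_0_r. apply cexp_0. Qed.

Lemma Cmod_ee a : Cmod (ee a) = exp (- (2 * PI) * Im a).
Proof.
  unfold ee. rewrite Cmod_cexp. f_equal. destruct a as [x y].
  unfold Re, Im, RtoC, Ci, Cmult; simpl. ring.
Qed.

Lemma ee_neq_0 a : ee a <> 0.
Proof.
  intros H. assert (H' := Cmod_ee a). rewrite H, Cmod_0 in H'.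
  pose proof (exp_pos (- (2 * PI) * Im a)). lra.
Qed.

Lemma ee_opp a : ee (- a) = / ee a.
Proof.
  assert (H : ee a * ee (- a) = 1).
  { rewrite <- ee_plus, Cplus_opp_r. apply ee_0. }
  pose proof (ee_neq_0 a) as H0.
  replace (ee (- a)) with (/ ee a * (ee a * ee (- a))) by (field; easy).
  rewrite H. ring.
Qed.

Lemma ee_minus a b : ee (a - b) = ee a / ee b.
Proof. unfold Cminus. now rewrite ee_plus, ee_opp. Qed.

Lemma ee_nat (n : nat) a : ee (INR n * a) = ee a ^ n.
Proof.
  induction n as [|n IH].
  - simpl. rewrite Cmult_0_l. apply ee_0.
  - rewrite S_INR, RtoC_plus, Cpow_S, <- IH, <- ee_plus. f_equal; ring.
Qed.

Lemma ee_1 : ee 1 = 1.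
Proof.
  unfold ee, cexp, Cmult, RtoC, Ci; simpl.
  replace ((2 * PI * 0 - 0 * 1) * 1 - (2 * PI * 1 + 0 * 0) * 0)%R with 0%R by ring.
  replace ((2 * PI * 0 - 0 * 1) * 0 + (2 * PI * 1 + 0 * 0) * 1)%R with (2 * PI)%R by ring.
  rewrite exp_0, cos_2PI, sin_2PI. f_equal; ring.
Qed.

Lemma ee_half : ee (/ 2) = - (1).
Proof.
  replace (/ 2) with (RtoC (/ 2)) by (apply RtoC_inv; lra).
  unfold ee, cexp, Cmult, RtoC, Ci, Copp; simpl.
  replace ((2 * PI * 0 - 0 * 1) * / 2 - (2 * PI * 1 + 0 * 0) * 0)%R with 0%R by ring.
  replace ((2 * PI * 0 - 0 * 1) * 0 + (2 * PI * 1 + 0 * 0) * / 2)%R with PI by field.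
  rewrite exp_0, cos_PI, sin_PI. f_equal; ring.
Qed.

Lemma ee_IZR (n : Z) : ee (IZR n) = 1.
Proof.
  assert (H : forall m : nat, ee (INR m) = 1).
  { intros m. rewrite <- (Cmult_1_r (INR m)), ee_nat, ee_1. apply Cpow_1_l. }
  destruct (Z.le_ge_cases 0 n) as [Hn | Hn].
  - rewrite <- (Z2Nat.id n), <- INR_IZR_INZ by easy. apply H.
  - replace n with (- Z.of_nat (Z.to_nat (- n)))%Z by lia.
    rewrite opp_IZR, <- INR_IZR_INZ, RtoC_opp, ee_opp, H. field.
Qed.

Lemma ee_plus_IZR a (n : Z) : ee (a + IZR n) = ee a.
Proof. rewrite ee_plus, ee_IZR. ring. Qed.

Lemma ee_eq_1 a : ee a = 1 -> exists n : Z, a = IZR n.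
Proof.
  intros H.
  assert (Hi : Im a = 0%R).
  { assert (H' := Cmod_ee a). rewrite H, Cmod_1, <- exp_0 in H'.
    apply exp_inv in H'. pose proof PI_RGT_0. nra. }
  destruct a as [x y]. cbn in Hi. subst y.
  unfold ee, cexp, Cmult, RtoC, Ci in H; simpl in H.
  injection H. intros Hs Hc.
  replace ((2 * PI * 0 - 0 * 1) * x - (2 * PI * 1 + 0 * 0) * 0)%R with 0%R in Hs, Hc by ring.
  replace ((2 * PI * 0 - 0 * 1) * 0 + (2 * PI * 1 + 0 * 0) * x)%R with (2 * (PI * x))%R in Hs, Hc by ring.
  rewrite exp_0, Rmult_1_l in Hs, Hc.
  (* From cos (2 pi x) = 1 follows sin (pi x) = 0, and the zeros of the sine are known. *)
  rewrite cos_2a_sin in Hc.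
  assert (Hs0 : sin (PI * x) = 0%R) by nra.
  destruct (sin_eq_0_0 _ Hs0) as [k Hk]. exists k.
  unfold RtoC. f_equal. pose proof PI_RGT_0. nra.
Qed.

Lemma cder_ee a : cder ee a (tpi * ee a).
Proof.
  apply cder_eq with (cexp (tpi * a) * (tpi * 1)). { unfold ee, tpi. ring. }
  apply (cder_comp cexp (fun y => tpi * y)).
  - apply cder_scal, cder_id.
  - apply cder_cexp.
Qed.

Lemma cder_ee_comp (f : C -> C) a l : cder f a l ->
  cder (fun y => ee (f y)) a (tpi * ee (f a) * l).
Proof. intros H. apply (cder_comp ee f); [easy|apply cder_ee]. Qed.

Definition nome (z : C) : R := Cmod (ee z).

Lemma nome_bound z : upper z -> 0 < nome z < 1.
Proof.
  intros Hz. unfold nome. rewrite Cmod_ee. split; [apply exp_pos|].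
  rewrite <- exp_0. apply exp_increasing. pose proof PI_RGT_0. unfold upper in Hz. nra.
Qed.

Definition qfac (u z : C) (n : nat) : C := 1 - ee (INR (S n) * z + u).

(** The q-Pochhammer symbol (x q; q) with x = [ee u]: the indices start at 1. In particular
    [qprod 0 z] is the Euler product inside [eta]. *)
Definition qprod (u z : C) : C := inf_prod (qfac u z).

Definition Phi (u z : C) : C :=
  (ee (u / 2) - ee (- (u / 2))) * (qprod u z * qprod (- u) z) / (qprod 0 z * qprod 0 z).

Lemma Cmod_ee_step u z (n : nat) :
  Cmod (ee (INR (S n) * z + u)) = (Cmod (ee u) * nome z * nome z ^ n)%R.
Proof. rewrite ee_plus, ee_nat, Cmod_mult, Cmod_pow. unfold nome. simpl. ring. Qed.

Lemma qfac_bound u z n :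
  Cmod (qfac u z n - 1) <= Cmod (ee u) * nome z * nome z ^ n.
Proof.
  rewrite <- Cmod_ee_step. unfold qfac.
  replace (1 - ee (INR (S n) * z + u) - 1) with (- ee (INR (S n) * z + u)) by ring.
  rewrite Cmod_opp. lra.
Qed.

Lemma qprod_ccv u z : upper z -> ccv (partial_prod (qfac u z)) (qprod u z).
Proof.
  intros Hz. pose proof (nome_bound z Hz).
  apply inf_prod_ccv with (A := (Cmod (ee u) * nome z)%R) (r := nome z); [lra|].
  apply qfac_bound.
Qed.

Lemma qprod_neq_0 u z : upper z -> (forall n, qfac u z n <> 0) -> qprod u z <> 0.
Proof.
  intros Hz. apply inf_prod_neq_0 with (A := (Cmod (ee u) * nome z)%R) (r := nome z).
  - now apply nome_bound.
  - apply qfac_bound.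
Qed.

Lemma one_minus_neq_0 (a : C) : Cmod a < 1 -> 1 - a <> 0.
Proof.
  intros H E. assert (E' : a = 1). { replace a with (1 - (1 - a)) by ring. rewrite E. ring. }
  rewrite E', Cmod_1 in H. lra.
Qed.

Lemma qprod_0_neq_0 z : upper z -> qprod 0 z <> 0.
Proof.
  intros Hz. apply qprod_neq_0; [easy|]. intros n. unfold qfac. apply one_minus_neq_0.
  rewrite Cmod_ee_step, ee_0, Cmod_1. pose proof (nome_bound z Hz) as Hq.
  assert (H1 : 0 <= nome z ^ n <= 1).
  { split; [apply pow_le; lra|]. rewrite <- (pow1 n). apply pow_incr; lra. }
  nra.
Qed.

Lemma partial_prod_shift (u : nat -> C) n :
  partial_prod u (S n) = u O * partial_prod (fun k => u (S k)) n.
Proof.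
  induction n as [|n IH]; [cbn; ring|].
  change (partial_prod u (S (S n))) with (partial_prod u (S n) * u (S n)).
  rewrite IH. cbn [partial_prod]. ring.
Qed.

Lemma qprod_shift u z : upper z -> qprod u z = (1 - ee (u + z)) * qprod (u + z) z.
Proof.
  intros Hz. apply inf_prod_unique.
  pose proof (ccv_scal (1 - ee (u + z)) _ _ (qprod_ccv (u + z) z Hz)) as H.
  assert (H' : ccv (fun n => partial_prod (qfac u z) (S n)) ((1 - ee (u + z)) * qprod (u + z) z)).
  { eapply ccv_ext; [|exact H]. intros n. cbv beta. rewrite partial_prod_shift. f_equal.
    - unfold qfac. simpl. do 2 f_equal. ring.
    - apply partial_prod_ext. intros k _. unfold qfac. do 2 f_equal.
      rewrite !S_INR, !RtoC_plus. ring. }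
  apply ccv_eps. intros eps He. destruct (proj1 (ccv_eps _ _) H' eps He) as [N HN].
  exists (S N). intros n Hn.
  destruct n as [|n]; [lia|]. apply HN. lia.
Qed.

Lemma ee_half_factor u : ee (u / 2) - ee (- (u / 2)) = ee (u / 2) * (1 - ee (- u)).
Proof.
  replace (ee (- (u / 2))) with (ee (u / 2) * ee (- u)); [ring|].
  rewrite <- ee_plus. f_equal. field.
Qed.

Lemma Copp_opp (a : C) : - - a = a.
Proof. ring. Qed.

Lemma Cinv_opp (a : C) : / - a = - / a.
Proof.
  destruct (Ceq_dec a 0) as [->|H]; [|field; easy].
  unfold Cinv, Copp, RtoC; simpl. f_equal; unfold Rdiv; ring.
Qed.

Lemma Phi_opp u z : Phi (- u) z = - Phi u z.
Proof.
  unfold Phi. rewrite Copp_opp.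
  replace (- u / 2) with (- (u / 2)) by field. rewrite Copp_opp.
  unfold Cdiv. ring.
Qed.

Lemma qprod_plus_1 u z : qprod (u + 1) z = qprod u z.
Proof.
  apply inf_prod_ext. intros n. unfold qfac.
  rewrite Cplus_assoc. now rewrite (ee_plus_IZR _ 1).
Qed.

Lemma qprod_minus_1 u z : qprod (u - 1) z = qprod u z.
Proof. rewrite <- qprod_plus_1. f_equal. ring. Qed.

Lemma Phi_plus_1 u z : Phi (u + 1) z = - Phi u z.
Proof.
  unfold Phi. rewrite qprod_plus_1. replace (- (u + 1)) with (- u - 1) by ring.
  rewrite qprod_minus_1. replace ((u + 1) / 2) with (u / 2 + / 2) by field.
  rewrite ee_plus, ee_opp, ee_plus, ee_half, ee_opp.
  unfold Cdiv. replace (/ (ee (u * / 2) * - (1))) with (- / ee (u * / 2)). ring.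
  field. apply ee_neq_0.
Qed.

(** The product in x loses the factor 1 - q x and the product in 1/x gains 1 - 1/x. The latter is
    the vanishing factor of [Phi u z], and the new one, 1 - 1/(q x), differs from 1 - q x by a
    monomial. *)
Lemma Phi_plus_z u z : upper z -> Phi (u + z) z = - ee (- u - z / 2) * Phi u z.
Proof.
  intros Hz. unfold Phi. rewrite (qprod_shift u z Hz).
  rewrite (qprod_shift (- (u + z)) z Hz). replace (- (u + z) + z) with (- u) by ring.
  rewrite !ee_half_factor.
  replace ((u + z) / 2) with (u / 2 + z / 2) by field.
  replace (- u - z / 2) with (- u + - (z / 2)) by ring.
  rewrite !ee_plus. rewrite !ee_opp, ee_plus.
  pose proof (ee_neq_0 u). pose proof (ee_neq_0 z). pose proof (qprod_0_neq_0 z Hz).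
  (* Half exponentials become the only atoms, so that [field] sees all relations among the
     exponentials. *)
  replace (ee u) with (ee (u / 2) * ee (u / 2)) by (rewrite <- ee_plus; f_equal; field).
  replace (ee z) with (ee (z / 2) * ee (z / 2)) by (rewrite <- ee_plus; f_equal; field).
  pose proof (ee_neq_0 (u / 2)). pose proof (ee_neq_0 (z / 2)).
  field. auto.
Qed.

Lemma Phi_0 z : Phi 0 z = 0.
Proof. unfold Phi. replace (- (0 / 2)) with (0 / 2) by field. unfold Cdiv. ring. Qed.

Lemma IZR_nat_C (n : nat) : RtoC (IZR (Z.of_nat n)) = RtoC (INR n).
Proof. now rewrite INR_IZR_INZ. Qed.

Lemma ee_half_IZR (n : Z) : ee (IZR n / 2) = ee (- (IZR n / 2)).
Proof. rewrite <- (ee_plus_IZR (- (IZR n / 2)) n). f_equal. field. Qed.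

(** The sign (-1)^n is written as an exponential, so that all multipliers met later combine by
    adding exponents. *)
Lemma Phi_plus_IZR u z (n : Z) : Phi (u + IZR n) z = ee (IZR n / 2) * Phi u z.
Proof.
  assert (H : forall n : nat, forall u, Phi (u + INR n) z = ee (INR n / 2) * Phi u z).
  { clear u n. induction n as [|n IH]; intros u.
    - simpl. rewrite Cplus_0_r. replace (0 / 2) with (RtoC 0) by field. rewrite ee_0. ring.
    - rewrite S_INR, RtoC_plus. rewrite Cplus_assoc, Phi_plus_1, IH.
      replace ((INR n + 1) / 2) with (INR n / 2 + / 2) by field.
      rewrite ee_plus, ee_half. ring. }
  destruct (Z.le_ge_cases 0 n) as [Hn|Hn].
  - rewrite <- (Z2Nat.id n) by easy. rewrite IZR_nat_C. apply H.
  - rewrite ee_half_IZR. pose proof (H (Z.to_nat (- n)) (u + IZR n)) as E.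
    rewrite INR_IZR_INZ, Z2Nat.id, opp_IZR, RtoC_opp in E by lia.
    replace (u + IZR n + - IZR n) with u in E by ring. rewrite E.
    rewrite Cmult_assoc, <- ee_plus.
    replace (- (IZR n / 2) + - IZR n / 2) with (RtoC (IZR (- n)))
      by (rewrite opp_IZR, RtoC_opp; field).
    rewrite ee_IZR. ring.
Qed.

Lemma Phi_plus_IZR_z u z (m : Z) : upper z ->
  Phi (u + IZR m * z) z = ee (IZR m / 2 - IZR m * u - IZR m * IZR m * z / 2) * Phi u z.
Proof.
  intros Hz.
  assert (H : forall m : nat, forall u,
    Phi (u + INR m * z) z = ee (INR m / 2 - INR m * u - INR m * INR m * z / 2) * Phi u z).
  { clear u m. induction m as [|m IH]; intros u.
    - simpl. replace (u + 0 * z) with u by ring.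
      replace (0 / 2 - 0 * u - 0 * 0 * z / 2) with (RtoC 0) by field. rewrite ee_0. ring.
    - rewrite S_INR, RtoC_plus. replace (u + (INR m + 1) * z) with (u + INR m * z + z) by ring.
      rewrite Phi_plus_z, IH by easy.
      rewrite Cmult_assoc. f_equal.
      replace ((INR m + 1) / 2 - (INR m + 1) * u - (INR m + 1) * (INR m + 1) * z / 2) with
        (- (u + INR m * z) - z / 2 + (INR m / 2 - INR m * u - INR m * INR m * z / 2) + / 2) by field.
      rewrite (ee_plus _ (/ 2)), ee_half, ee_plus. ring. }
  destruct (Z.le_ge_cases 0 m) as [Hm|Hm].
  - rewrite <- (Z2Nat.id m) by easy. rewrite IZR_nat_C. apply H.
  - pose proof (H (Z.to_nat (- m)) (u + IZR m * z)) as E.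
    rewrite INR_IZR_INZ, Z2Nat.id, opp_IZR, RtoC_opp in E by lia.
    replace (u + IZR m * z + - IZR m * z) with u in E by ring. rewrite E.
    rewrite Cmult_assoc, <- ee_plus.
    replace (IZR m / 2 - IZR m * u - IZR m * IZR m * z / 2 +
      (- IZR m / 2 - - IZR m * (u + IZR m * z) - - IZR m * - IZR m * z / 2)) with (RtoC 0) by field.
    rewrite ee_0. ring.
Qed.

Lemma Phi_lattice z (m n : Z) : upper z -> Phi (IZR m * z + IZR n) z = 0.
Proof.
  intros Hz. rewrite Phi_plus_IZR, <- (Cplus_0_l (IZR m * z)), Phi_plus_IZR_z, Phi_0 by easy. ring.
Qed.

Lemma Cmod_ee_le_exp a : Cmod (ee a) <= exp (2 * PI * Cmod a).
Proof.
  rewrite Cmod_ee. pose proof (im_le_Cmod a) as H. pose proof PI_RGT_0.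
  pose proof (Rle_abs (- Im a)) as H1. rewrite Rabs_Ropp in H1. apply exp_le. nra.
Qed.

Lemma Cmod_ee_near u : exists B : R, 0 < B /\ forall y, Cmod (y - u) < 1 ->
  Cmod (ee y) <= B /\ Cmod (ee (- y)) <= B.
Proof.
  exists (exp (2 * PI * (Cmod u + 1))). split; [apply exp_pos|]. intros y Hy.
  pose proof (Cmod_triangle_rev y u). pose proof PI_RGT_0.
  split; (eapply Rle_trans; [apply Cmod_ee_le_exp|apply exp_le]).
  - apply Rmult_le_compat_l; lra.
  - rewrite Cmod_opp. apply Rmult_le_compat_l; lra.
Qed.

(** * Lattice sums *)

(** That u is no lattice point, said multiplicatively: no q^m x equals 1, which is what the factors
    and summands need. [nonlat_iff] gives the additive form. *)
Definition nonlat (u z : C) : Prop := forall m : Z, ee (u + IZR m * z) <> 1.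

(** Sums over |m| <= N. The symmetric window matters for [c1], which tends to -1/2 at 0 and to 1/2
    at infinity: only the pairs m, -m have small sums. *)
Fixpoint bisum (g : Z -> C) (N : nat) : C :=
  match N with
  | O => g 0%Z
  | S n => bisum g n + (g (Z.of_nat (S n)) + g (- Z.of_nat (S n))%Z)
  end.

Definition Eterm (c : C -> C) (u z : C) (m : Z) : C := c (ee (u + IZR m * z)).

Definition Esum (c : C -> C) (u z : C) : C := clim (bisum (Eterm c u z)).

(** Vanishing to first order at 0 and at infinity, uniformly up to any radius below 1;
    [Esum_rest_bound] needs a radius larger than |q|. *)
Definition decay (c : C -> C) : Prop :=
  forall s : R, s < 1 -> exists K : R, 0 <= K /\
  forall y : C, y <> 0 -> Cmod y <= s ->
  Cmod (c y) <= K * Cmod y /\ Cmod (c (/ y)%C) <= K * Cmod y.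

Lemma Cmod_ee_pos_mult u z (n : nat) :
  Cmod (ee (u + IZR (Z.of_nat n) * z)) = (Cmod (ee u) * nome z ^ n)%R.
Proof. rewrite <- INR_IZR_INZ, ee_plus, ee_nat, Cmod_mult, Cmod_pow. easy. Qed.

Lemma ee_neg_mult u z (n : nat) :
  ee (u + IZR (- Z.of_nat n) * z) = / ee (- u + IZR (Z.of_nat n) * z).
Proof. rewrite <- ee_opp, opp_IZR, RtoC_opp. f_equal. ring. Qed.

Lemma Eterm_bound (c : C -> C) (K s B : R) u z (n : nat) :
  0 <= K ->
  (forall y : C, y <> 0 -> Cmod y <= s ->
   Cmod (c y) <= K * Cmod y /\ Cmod (c (/ y)%C) <= K * Cmod y) ->
  Cmod (ee u) <= B -> Cmod (ee (- u)) <= B ->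
  B * nome z ^ n <= s ->
  Cmod (Eterm c u z (Z.of_nat n) + Eterm c u z (- Z.of_nat n)) <= 2 * K * B * nome z ^ n.
Proof.
  intros HK Hc H1 H2 Hs.
  assert (Hp : 0 <= nome z ^ n) by (apply pow_le, Cmod_ge_0).
  assert (H1' : Cmod (ee u) * nome z ^ n <= B * nome z ^ n) by (now apply Rmult_le_compat_r).
  assert (H2' : Cmod (ee (- u)) * nome z ^ n <= B * nome z ^ n) by (now apply Rmult_le_compat_r).
  unfold Eterm. rewrite ee_neg_mult.
  eapply Rle_trans; [apply Cmod_triangle|].
  destruct (Hc (ee (u + IZR (Z.of_nat n) * z))) as [Ha _];
    [apply ee_neq_0|rewrite Cmod_ee_pos_mult; lra|].
  destruct (Hc (ee (- u + IZR (Z.of_nat n) * z))) as [_ Hb];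
    [apply ee_neq_0|rewrite Cmod_ee_pos_mult; lra|].
  rewrite Cmod_ee_pos_mult in Ha, Hb.
  assert (H3 : K * (Cmod (ee u) * nome z ^ n) <= K * (B * nome z ^ n))
    by (now apply Rmult_le_compat_l).
  assert (H4 : K * (Cmod (ee (- u)) * nome z ^ n) <= K * (B * nome z ^ n))
    by (now apply Rmult_le_compat_l).
  lra.
Qed.

Lemma bisum_step g n : bisum g (S n) - bisum g n = g (Z.of_nat (S n)) + g (- Z.of_nat (S n))%Z.
Proof. cbn [bisum]. ring. Qed.

Lemma bisum_step_bound (c : C -> C) u z : upper z -> decay c ->
  exists A N0, forall n y, (N0 <= n)%nat -> Cmod (y - u) < 1 ->
  Cmod (bisum (Eterm c y z) (S n) - bisum (Eterm c y z) n) <= A * nome z ^ n.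
Proof.
  intros Hz Hc. destruct (Hc (1 / 2)%R ltac:(lra)) as [K [HK Hc']].
  pose proof (nome_bound z Hz) as Hq.
  destruct (Cmod_ee_near u) as [B [_ HB]].
  destruct (geo_small B (nome z) (1 / 2)) as [N HN]; [lra|lra|].
  exists (2 * K * B * nome z)%R, N. intros n y Hn Hy. destruct (HB y Hy) as [HB1 HB2].
  rewrite bisum_step.
  replace (2 * K * B * nome z * nome z ^ n)%R with (2 * K * B * nome z ^ S n)%R by (simpl; ring).
  apply Eterm_bound with (s := (1 / 2)%R); auto. left. apply HN. lia.
Qed.

Lemma Esum_ccv (c : C -> C) u z : upper z -> decay c ->
  ccv (bisum (Eterm c u z)) (Esum c u z).
Proof.
  intros Hz Hc. pose proof (nome_bound z Hz) as Hq.
  destruct (bisum_step_bound c u z Hz Hc) as [A [N0 H]].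
  destruct (geo_ccv (bisum (Eterm c u z)) A (nome z) N0) as [l Hl]; [lra| |].
  { intros n Hn. apply H; [easy|]. replace (u - u) with (RtoC 0) by ring. rewrite Cmod_0. lra. }
  unfold Esum. now rewrite (clim_unique _ _ Hl).
Qed.

(** For |m| large, q^m x or its inverse has modulus below 1 on a whole neighbourhood; the finitely
    many other m are handled by continuity. *)
Lemma nonlat_open u z : upper z -> nonlat u z ->
  exists rho : R, 0 < rho <= 1 /\ forall y, Cmod (y - u) < rho -> nonlat y z.
Proof.
  intros Hz Hu. pose proof (nome_bound z Hz) as Hq.
  destruct (Cmod_ee_near u) as [B [_ HB]].
  destruct (geo_small B (nome z) 1) as [N HN]; [lra|lra|].
  assert (Hfar : forall y, Cmod (y - u) < 1 -> forall n, (N <= n)%nat ->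
    ee (y + IZR (Z.of_nat n) * z) <> 1 /\ ee (y + IZR (- Z.of_nat n) * z) <> 1).
  { intros y Hy n Hn. destruct (HB y Hy) as [HB1 HB2].
    assert (Hlt : forall w, Cmod (ee w) <= B -> Cmod (ee (w + IZR (Z.of_nat n) * z)%C) < 1).
    { intros w Hw. rewrite Cmod_ee_pos_mult. eapply Rle_lt_trans; [|apply (HN n Hn)].
      apply Rmult_le_compat_r; [apply pow_le; lra|easy]. }
    split; intros E.
    - assert (H := Hlt y HB1). rewrite E, Cmod_1 in H. lra.
    - rewrite ee_neg_mult in E.
      assert (H := Hlt _ HB2).
      replace (ee (- y + IZR (Z.of_nat n) * z)) with (/ / ee (- y + IZR (Z.of_nat n) * z)) in H.
      + rewrite E in H. replace (/ 1) with (RtoC 1) in H by field. rewrite Cmod_1 in H. lra.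
      + field. apply ee_neq_0. }
  assert (Hone : forall m : Z, exists d : R, 0 < d /\
    forall y, Cmod (y - u) < d -> ee (y + IZR m * z) <> 1).
  { intros m.
    assert (Hd : cder (fun y => ee (y + IZR m * z)) u (tpi * ee (u + IZR m * z) * (1 + 0))).
    { apply (cder_ee_comp (fun y => y + IZR m * z)). apply cder_plus; [apply cder_id|apply cder_const]. }
    destruct (cder_cont _ _ _ Hd (Cmod (ee (u + IZR m * z) - 1))) as [d [Hd0 Hd1]].
    { apply Cmod_pos_of_ne. intros E. apply (Hu m). now apply Ceq_minus. }
    exists d. split; [easy|]. intros y Hy E. specialize (Hd1 y Hy). rewrite E in Hd1.
    rewrite Cmod_minus_sym in Hd1. lra. }
  assert (Hnear : forall M : nat, exists d : R, 0 < d /\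
    forall y, Cmod (y - u) < d -> forall n, (n < M)%nat ->
    ee (y + IZR (Z.of_nat n) * z) <> 1 /\ ee (y + IZR (- Z.of_nat n) * z) <> 1).
  { induction M as [|M [d [Hd IH]]].
    - exists 1%R. split; [lra|]. intros; lia.
    - destruct (Hone (Z.of_nat M)) as [d1 [Hd1 H1]].
      destruct (Hone (- Z.of_nat M)%Z) as [d2 [Hd2 H2]].
      exists (Rmin d (Rmin d1 d2)). split; [repeat apply Rmin_pos; easy|].
      intros y Hy n Hn.
      apply Rlt_Rmin_inv in Hy as [Hy0 Hy]. apply Rlt_Rmin_inv in Hy as [Hy1 Hy2].
      destruct (Nat.eq_dec n M) as [->|Hne]; [split; auto|]. apply IH; [easy|lia]. }
  destruct (Hnear N) as [d [Hd H]].
  exists (Rmin d 1). split. { split; [apply Rmin_pos; lra|apply Rmin_r]. }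
  intros y Hy m.
  apply Rlt_Rmin_inv in Hy as [Hy0 Hy1].
  assert (Hn : forall n, ee (y + IZR (Z.of_nat n) * z) <> 1 /\ ee (y + IZR (- Z.of_nat n) * z) <> 1).
  { intros n. destruct (le_lt_dec N n); [now apply Hfar|now apply H]. }
  destruct (Z.le_ge_cases 0 m) as [Hm|Hm].
  - rewrite <- (Z2Nat.id m) by easy. apply Hn.
  - replace m with (- Z.of_nat (Z.to_nat (- m)))%Z by lia. apply Hn.
Qed.

Lemma cder_bisum (G G' : Z -> C -> C) u :
  (forall m, cder (G m) u (G' m u)) ->
  forall n, cder (fun y => bisum (fun m => G m y) n) u (bisum (fun m => G' m u) n).
Proof.
  intros H n. induction n as [|n IH]; cbn [bisum]; [apply H|].
  apply (cder_plus (fun y => bisum (fun m => G m y) n)); [easy|]. now apply cder_plus.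
Qed.

Lemma bisum_scal a g n : bisum (fun m => a * g m) n = a * bisum g n.
Proof. induction n as [|n IH]; cbn [bisum]; [easy|]. rewrite IH. ring. Qed.

(** Termwise differentiation, where c' is x dc/dx. Convergence of the sum of c is a hypothesis
    rather than a consequence of decay, since [c1] does not decay. *)
Lemma cder_Esum (c c' : C -> C) u z : upper z -> decay c' ->
  (forall y : C, y <> 0 -> y <> 1 -> cder c y (c' y / y)) ->
  (forall y, nonlat y z -> ccv (bisum (Eterm c y z)) (Esum c y z)) ->
  nonlat u z -> cder (fun y => Esum c y z) u (tpi * Esum c' u z).
Proof.
  intros Hz Hc' Hd Hcv Hu. pose proof (nome_bound z Hz) as Hq.
  destruct (nonlat_open u z Hz Hu) as [rho [Hrho Hnl]].
  destruct (bisum_step_bound c' u z Hz Hc') as [A [N0 HA]].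
  apply (cder_lim (fun n y => bisum (Eterm c y z) n)
    (fun n y => tpi * bisum (Eterm c' y z) n)) with (rho := rho) (A := (Cmod tpi * A)%R)
      (r := nome z) (N0 := N0); [lra|lra| | | |].
  - intros n y Hy. rewrite <- bisum_scal.
    apply (cder_bisum (fun m y => Eterm c y z m) (fun m y => tpi * Eterm c' y z m)).
    intros m. unfold Eterm.
    assert (Hx := ee_neq_0 (y + IZR m * z)).
    eapply cder_eq; [|apply (cder_comp c (fun y => ee (y + IZR m * z)))].
    3:{ apply Hd; [easy|now apply Hnl]. }
    2:{ apply (cder_ee_comp (fun y => y + IZR m * z)). apply cder_plus; [apply cder_id|apply cder_const]. }
    field. easy.
  - intros n y Hn Hy.
    replace (tpi * bisum (Eterm c' y z) (S n) - tpi * bisum (Eterm c' y z) n)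
      with (tpi * (bisum (Eterm c' y z) (S n) - bisum (Eterm c' y z) n)) by ring.
    rewrite Cmod_mult, Rmult_assoc. apply Rmult_le_compat_l; [apply Cmod_ge_0|].
    apply HA; [easy|lra].
  - intros y Hy. apply Hcv. now apply Hnl.
  - apply ccv_scal. now apply Esum_ccv.
Qed.

(** Near u = 0 only the term m = 0 can be singular; this isolates the principal part. *)
Lemma Esum_rest_bound (c : C -> C) z : upper z -> decay c ->
  exists rho M : R, 0 < rho /\
  forall w, Cmod w < rho -> Cmod (Esum c w z - c (ee w)) <= M.
Proof.
  intros Hz Hc. pose proof (nome_bound z Hz) as Hq. pose proof PI_RGT_0 as Hpi.
  (* A radius strictly between |q| and 1. The ratio B = s/|q| > 1 is the room left for |ee w| and
     |ee (- w)|, so that every term with m <> 0 stays in the range of the decay bound. *)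
  set (s := ((1 + nome z) / 2)%R).
  destruct (Hc s ltac:(unfold s; lra)) as [K [HK Hc']].
  set (B := (s / nome z)%R).
  assert (HBq : (B * nome z = s)%R) by (unfold B; field; lra).
  assert (HB1 : 1 < B).
  { apply Rmult_lt_reg_r with (nome z); [lra|]. rewrite HBq. unfold s. lra. }
  assert (Hln : 0 < ln B) by (rewrite <- ln_1; apply ln_increasing; lra).
  exists (ln B / (2 * PI))%R, (2 * K * B * nome z / (1 - nome z) * nome z ^ 0)%R.
  split. { apply Rdiv_lt_0_compat; lra. }
  intros w Hw.
  assert (Hwe : exp (2 * PI * Cmod w) <= B).
  { rewrite <- (exp_ln B) by lra. apply exp_le.
    apply Rlt_le. replace (ln B) with (2 * PI * (ln B / (2 * PI)))%R by (field; lra).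
    apply Rmult_lt_compat_l; lra. }
  replace (c (ee w)) with (bisum (Eterm c w z) 0).
  2:{ cbn [bisum]. unfold Eterm. do 2 f_equal. ring. }
  apply (ccv_Cmod_le (fun n => bisum (Eterm c w z) n - bisum (Eterm c w z) 0) _ _ 0).
  - apply ccv_minus; [now apply Esum_ccv|apply ccv_const].
  - intros n _. apply (geo_Cauchy (bisum (Eterm c w z)) _ (nome z) 0) with (n := 0%nat) (k := n);
      [lra| |lia].
    intros k _. rewrite bisum_step.
    replace (2 * K * B * nome z * nome z ^ k)%R with (2 * K * B * nome z ^ S k)%R by (simpl; ring).
    apply Eterm_bound with (s := s); auto.
    + eapply Rle_trans; [apply Cmod_ee_le_exp|easy].
    + eapply Rle_trans; [apply Cmod_ee_le_exp|]. now rewrite Cmod_opp.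
    + simpl. rewrite <- Rmult_assoc, HBq.
      assert (Hp : 0 <= nome z ^ k <= 1).
      { split; [apply pow_le; lra|]. rewrite <- (pow1 k). apply pow_incr; lra. }
      assert (0 < s) by (unfold s; lra). nra.
Qed.

Lemma Esum_plus_1 (c : C -> C) u z : Esum c (u + 1) z = Esum c u z.
Proof.
  unfold Esum. f_equal. f_equal.
  apply FunctionalExtensionality.functional_extensionality. intros m. unfold Eterm. f_equal.
  replace (u + 1 + IZR m * z) with (u + IZR m * z + 1) by ring. apply (ee_plus_IZR _ 1).
Qed.

Lemma bisum_shift g n :
  bisum (fun m => g (m + 1)%Z) n = bisum g n + g (Z.of_nat (S n)) - g (- Z.of_nat n)%Z.
Proof.
  induction n as [|n IH].
  - cbn [bisum]. simpl. ring.
  - cbn [bisum]. rewrite IH.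
    replace (Z.of_nat (S n) + 1)%Z with (Z.of_nat (S (S n))) by lia.
    replace (- Z.of_nat (S n) + 1)%Z with (- Z.of_nat n)%Z by lia. ring.
Qed.

Lemma Cminus_0_r (a : C) : a - 0 = a.
Proof. ring. Qed.

Lemma Eterm_ccv_0 (c : C -> C) u z : upper z -> decay c ->
  ccv (fun n => Eterm c u z (Z.of_nat n)) 0 /\ ccv (fun n => Eterm c u z (- Z.of_nat n)%Z) 0.
Proof.
  intros Hz Hc. pose proof (nome_bound z Hz) as Hq.
  destruct (Hc (1 / 2)%R ltac:(lra)) as [K [HK Hc']].
  assert (Hev : forall v, exists N : nat, forall n, (N <= n)%nat ->
    Cmod (c (ee (v + IZR (Z.of_nat n) * z))%C) <= K * Cmod (ee v) * nome z ^ n /\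
    Cmod (c (/ ee (v + IZR (Z.of_nat n) * z))%C) <= K * Cmod (ee v) * nome z ^ n).
  { intros v. destruct (geo_small (Cmod (ee v)) (nome z) (1 / 2)) as [N HN]; [lra|lra|].
    exists N. intros n Hn. specialize (HN n Hn).
    rewrite !Rmult_assoc, <- Cmod_ee_pos_mult. apply Hc'; [apply ee_neq_0|].
    rewrite Cmod_ee_pos_mult. lra. }
  split; apply ccv_eps; intros eps He.
  - destruct (Hev u) as [N HN].
    destruct (geo_small (K * Cmod (ee u)) (nome z) eps) as [M HM]; [lra|lra|].
    exists (N + M)%nat. intros n Hn. unfold Eterm. rewrite Cminus_0_r.
    eapply Rle_lt_trans; [apply HN; lia|apply HM; lia].
  - destruct (Hev (- u)) as [N HN].
    destruct (geo_small (K * Cmod (ee (- u))) (nome z) eps) as [M HM]; [lra|lra|].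
    exists (N + M)%nat. intros n Hn. unfold Eterm. rewrite Cminus_0_r, ee_neg_mult.
    eapply Rle_lt_trans; [apply HN; lia|apply HM; lia].
Qed.

Lemma Esum_plus_z (c : C -> C) u z : upper z -> decay c -> Esum c (u + z) z = Esum c u z.
Proof.
  intros Hz Hc. apply clim_unique.
  destruct (Eterm_ccv_0 c u z Hz Hc) as [H1 H2].
  assert (H3 := Esum_ccv c u z Hz Hc).
  assert (H4 := ccv_minus _ _ _ _ (ccv_plus _ _ _ _ H3 (ccv_subseq _ _ S ltac:(lia) H1)) H2).
  replace (Esum c u z + 0 - 0) with (Esum c u z) in H4 by ring.
  eapply ccv_ext; [|exact H4]. intros n. cbv beta. rewrite <- bisum_shift.
  f_equal. apply FunctionalExtensionality.functional_extensionality. intros m.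
  unfold Eterm. do 2 f_equal. rewrite plus_IZR, RtoC_plus. ring.
Qed.

(* [tpi * c1 (ee u)] is the logarithmic derivative of [ee (u/2) - ee (-u/2)], and
   [c2], [c3], [c4] are its images under [x d/dx]. *)
Definition c1 (x : C) : C := (x + 1) / (2 * (x - 1)).
Definition c2 (x : C) : C := x * - (1) / (x - 1) ^ 2.
Definition c3 (x : C) : C := x * (x + 1) / (x - 1) ^ 3.
Definition c4 (x : C) : C := x * - (x * x + 4 * x + 1) / (x - 1) ^ 4.

Lemma Cminus_neq_0 (a b : C) : a <> b -> a - b <> 0.
Proof. apply Cminus_eq_contra. Qed.

Lemma C2_nz : RtoC 2 <> 0.
Proof. intros H. apply RtoC_inj in H. lra. Qed.

Lemma cder_sub_const (a y : C) : cder (fun x => x - a) y 1.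
Proof.
  apply cder_eq with (1 - 0); [ring|]. apply cder_minus; [apply cder_id|apply cder_const].
Qed.

Lemma cder_add_const (a y : C) : cder (fun x => x + a) y 1.
Proof.
  apply cder_eq with (1 + 0); [ring|]. apply cder_plus; [apply cder_id|apply cder_const].
Qed.

Lemma cder_sub_pow (a y : C) k : cder (fun x => (x - a) ^ k) y (INR k * (y - a) ^ (k - 1)).
Proof.
  eapply cder_eq; [|apply (cder_comp (fun x => x ^ k) (fun x => x - a));
    [apply cder_sub_const|apply cder_pow]]. ring.
Qed.

Lemma cder_c1 (y : C) : y <> 0 -> y <> 1 -> cder c1 y (c2 y / y).
Proof.
  intros H0 H1. apply Cminus_neq_0 in H1. pose proof C2_nz.
  eapply cder_eq; [|apply cder_div; [|apply cder_add_const|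
     apply cder_scal, cder_sub_const]].
  - unfold c2. field. auto.
  - now apply Cmult_neq_0.
Qed.

Lemma cder_c2 (y : C) : y <> 0 -> y <> 1 -> cder c2 y (c3 y / y).
Proof.
  intros H0 H1. apply Cminus_neq_0 in H1.
  eapply cder_eq; [|apply cder_div; [|apply (cder_mult (fun x => x) (fun _ => - (1)));
    [apply cder_id|apply cder_const]|apply cder_sub_pow]].
  - unfold c3. simpl. replace (RtoC (1 + 1)) with (RtoC 2) by (f_equal; ring). field. auto.
  - now apply Cpow_nz.
Qed.

Lemma cder_c3 (y : C) : y <> 0 -> y <> 1 -> cder c3 y (c4 y / y).
Proof.
  intros H0 H1. apply Cminus_neq_0 in H1.
  eapply cder_eq; [|apply cder_div; [|apply (cder_mult (fun x => x) (fun x => x + 1));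
    [apply cder_id|apply cder_add_const]|apply cder_sub_pow]].
  - unfold c4. simpl. replace (RtoC (1 + 1 + 1)) with (RtoC 3) by (f_equal; ring). field. auto.
  - now apply Cpow_nz.
Qed.

(** The symmetry under y -> 1/y turns the estimate at 0 into the estimate at infinity; away from 1
    the denominator is at least (1 - s)^k. *)
Lemma decay_rational (p : C -> C) (k : nat) (M : R) :
  (forall y : C, Cmod y <= 1 -> Cmod (p y) <= M) ->
  (forall y : C, y <> 0 -> y - 1 <> 0 -> 1 - y <> 0 ->
    Cmod (/ y * p (/ y) / (/ y - 1) ^ k) = Cmod (y * p y / (y - 1) ^ k)) ->
  decay (fun y => y * p y / (y - 1) ^ k).
Proof.
  intros HM Hsym s Hs.
  assert (HM0 : 0 <= M).
  { eapply Rle_trans; [apply Cmod_ge_0|apply (HM 0)]. rewrite Cmod_0. lra. }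
  assert (Hsk : 0 < (1 - s) ^ k) by (apply pow_lt; lra).
  exists (M / (1 - s) ^ k)%R. split. { apply Rdiv_le_0_compat; lra. }
  intros y Hy0 Hys.
  assert (H1 : y <> 1). { intros ->. rewrite Cmod_1 in Hys. lra. }
  assert (Hd : 1 - s <= Cmod (y - 1)).
  { pose proof (Cmod_triangle_rev 1 y) as H. rewrite Cmod_1 in H.
    rewrite Cmod_minus_sym. lra. }
  apply Cminus_neq_0 in H1 as H1'.
  assert (Hmain : Cmod (y * p y / (y - 1) ^ k) <= M / (1 - s) ^ k * Cmod y).
  { rewrite Cmod_div, Cmod_mult, Cmod_pow by now apply Cpow_nz.
    replace (M / (1 - s) ^ k * Cmod y)%R with (Cmod y * M / (1 - s) ^ k)%R by (field; lra).
    unfold Rdiv. apply Rmult_le_compat.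
    - apply Rmult_le_pos; apply Cmod_ge_0.
    - left. apply Rinv_0_lt_compat, pow_lt. lra.
    - apply Rmult_le_compat_l; [apply Cmod_ge_0|]. apply HM. lra.
    - apply Rinv_le_contravar; [easy|]. apply pow_incr. lra. }
  split; [easy|]. rewrite Hsym; auto using Cminus_neq_0.
Qed.

Lemma decay_c2 : decay c2.
Proof.
  apply (decay_rational (fun _ => - (1)) 2 1).
  - intros y _. rewrite Cmod_opp, Cmod_1. lra.
  - intros y H0 H1 H2. f_equal. simpl. field. auto.
Qed.

Lemma decay_c3 : decay c3.
Proof.
  apply (decay_rational (fun x => x + 1) 3 2).
  - intros y Hy. eapply Rle_trans; [apply Cmod_triangle|]. rewrite Cmod_1. lra.
  - intros y H0 H1 H2. rewrite <- (Cmod_opp (y * (y + 1) / (y - 1) ^ 3)).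
    f_equal. simpl. field. auto.
Qed.

Lemma decay_c4 : decay c4.
Proof.
  apply (decay_rational (fun x => - (x * x + 4 * x + 1)) 4 6).
  - intros y Hy. rewrite Cmod_opp. eapply Rle_trans; [apply Cmod_triangle|].
    eapply Rle_trans; [apply Rplus_le_compat_r, Cmod_triangle|].
    rewrite !Cmod_mult, Cmod_1, Cmod_R, Rabs_pos_eq by lra.
    pose proof (Cmod_ge_0 y). nra.
  - intros y H0 H1 H2. f_equal. simpl. field. auto.
Qed.

(** Apply x d/dx three times to log (1 - y) + log (1 + y) = log (1 - y^2): each application to a
    function of y^2 brings a factor 2, whence 8. *)
Lemma c3_dup (y : C) : y * y <> 1 -> c3 y + c3 (- y) = 8 * c3 (y * y).
Proof.
  intros H.
  assert (H1 : y - 1 <> 0).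
  { intros E. apply H. replace y with (1 + (y - 1)) by ring. rewrite E. ring. }
  assert (H2 : y + 1 <> 0).
  { intros E. apply H. replace y with ((y + 1) - 1) by ring. rewrite E. ring. }
  unfold c3. simpl. field. repeat split; try easy.
  - now apply Cminus_neq_0.
  - intros E. apply H2. replace (y + 1) with (- (- y - 1)) by ring. rewrite E. ring.
Qed.

(** * The third logarithmic derivative *)

Lemma period_Z (f : C -> C) (a : C) : (forall u, f (u + a) = f u) ->
  forall (m : Z) u, f (u + IZR m * a) = f u.
Proof.
  intros H.
  assert (Hn : forall (n : nat) u, f (u + INR n * a) = f u).
  { induction n as [|n IH]; intros u.
    - f_equal. simpl. ring.
    - rewrite S_INR, RtoC_plus. replace (u + (INR n + 1) * a) with (u + INR n * a + a) by ring.
      now rewrite H. }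
  intros m u. destruct (Z.le_ge_cases 0 m) as [Hm|Hm].
  - rewrite <- (Z2Nat.id m), <- INR_IZR_INZ by easy. apply Hn.
  - rewrite <- (Hn (Z.to_nat (- m)) (u + IZR m * a)). f_equal.
    rewrite INR_IZR_INZ, Z2Nat.id, opp_IZR, RtoC_opp by lia. ring.
Qed.

Lemma upper_neq_0 z : upper z -> z <> 0.
Proof. intros H E. rewrite E in H. unfold upper in H. simpl in H. lra. Qed.

Lemma upper_S z : upper z -> upper (- / z).
Proof.
  intros H. destruct z as [x y]. unfold upper in *. simpl in *.
  assert (0 < x * (x * 1) + y * (y * 1)) by nra.
  replace (- (- y / (x * (x * 1) + y * (y * 1))))%R with (y / (x * (x * 1) + y * (y * 1)))%R
    by (field; lra).
  now apply Rdiv_lt_0_compat.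
Qed.

Lemma nonlat_iff u z : nonlat u z <-> forall m n : Z, u <> IZR m * z + IZR n.
Proof.
  split.
  - intros H m n ->. apply (H (- m)%Z). rewrite opp_IZR, RtoC_opp.
    replace (IZR m * z + IZR n + - IZR m * z) with (RtoC (IZR n)) by ring. apply ee_IZR.
  - intros H m E. destruct (ee_eq_1 _ E) as [n Hn]. apply (H (- m)%Z n).
    rewrite opp_IZR, RtoC_opp, <- Hn. ring.
Qed.

Lemma nonlat_shift u z (m n : Z) : nonlat u z -> nonlat (u + IZR m * z + IZR n) z.
Proof.
  rewrite !nonlat_iff. intros H a b E. apply (H (a - m)%Z (b - n)%Z).
  rewrite !minus_IZR, !RtoC_minus.
  replace u with (u + IZR m * z + IZR n - IZR m * z - IZR n) by ring. rewrite E. ring.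
Qed.

Lemma nonlat_S u z : upper z -> nonlat u z -> nonlat (u / z) (- / z).
Proof.
  intros Hz. rewrite !nonlat_iff. intros H m n E. apply (H n (- m)%Z).
  pose proof (upper_neq_0 z Hz).
  replace u with (u / z * z) by (field; easy). rewrite E, opp_IZR, RtoC_opp. field. easy.
Qed.

Lemma nonlat_half u z (m n : Z) : nonlat u z -> nonlat ((u + IZR m * z + IZR n) / 2) z.
Proof.
  rewrite !nonlat_iff. intros H a b E. apply (H (2 * a - m)%Z (2 * b - n)%Z).
  rewrite !minus_IZR, !mult_IZR, !RtoC_minus, !RtoC_mult.
  replace u with ((u + IZR m * z + IZR n) / 2 * 2 - IZR m * z - IZR n) by field.
  rewrite E. ring.
Qed.

Lemma nonlat_neq_0 u z : nonlat u z -> u <> 0.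
Proof. intros H ->. apply (H 0%Z). rewrite Cmult_0_l, Cplus_0_l. apply ee_0. Qed.

Lemma nonlat_ee u z : nonlat u z -> ee u <> 1.
Proof. intros H E. apply (H 0%Z). now rewrite Cmult_0_l, Cplus_0_r. Qed.

(** The window |m| <= n sends 2m + 1 to the odd numbers from -2n + 1 to 2n + 1, one step beyond the
    window of size 2n; hence the additional term. *)
Lemma bisum_even_odd g n :
  bisum (fun m => g (2 * m)%Z) n + bisum (fun m => g (2 * m + 1)%Z) n
  = bisum g (2 * n) + g (Z.of_nat (S (2 * n))).
Proof.
  induction n as [|n IH]; [easy|].
  replace (2 * S n)%nat with (S (S (2 * n))) by lia. cbn [bisum].
  transitivity (bisum g (2 * n) + g (Z.of_nat (S (2 * n))) +
    (g (2 * Z.of_nat (S n))%Z + g (2 * - Z.of_nat (S n))%Z) +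
    (g (2 * Z.of_nat (S n) + 1)%Z + g (2 * - Z.of_nat (S n) + 1)%Z)).
  { rewrite <- IH. ring. }
  replace (2 * Z.of_nat (S n))%Z with (Z.of_nat (S (S (2 * n)))) by lia.
  replace (2 * - Z.of_nat (S n))%Z with (- Z.of_nat (S (S (2 * n))))%Z by lia.
  replace (Z.of_nat (S (S (2 * n))) + 1)%Z with (Z.of_nat (S (S (S (2 * n))))) by lia.
  replace (- Z.of_nat (S (S (2 * n))) + 1)%Z with (- Z.of_nat (S (2 * n)))%Z by lia.
  ring.
Qed.

Lemma bisum_plus g h n : bisum (fun m => g m + h m) n = bisum g n + bisum h n.
Proof. induction n as [|n IH]; cbn [bisum]; [easy|]. rewrite IH. ring. Qed.

Lemma bisum_ext g h n : (forall m, g m = h m) -> bisum g n = bisum h n.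
Proof. intros H. f_equal. now apply FunctionalExtensionality.functional_extensionality. Qed.

(** The two arguments differ by 1/2, so their exponentials are the two square roots of q^(2m+k)
    x. *)
Lemma Eterm_c3_dup u z (m k : Z) : nonlat u z ->
  Eterm c3 ((u + IZR k * z) / 2) z m + Eterm c3 ((u + IZR k * z + 1) / 2) z m
  = 8 * Eterm c3 u z (2 * m + k).
Proof.
  intros Hu. unfold Eterm.
  set (y := ee ((u + IZR k * z) / 2 + IZR m * z)).
  assert (Hy2 : ee (u + IZR (2 * m + k) * z) = y * y).
  { unfold y. rewrite <- ee_plus. f_equal. rewrite plus_IZR, mult_IZR, RtoC_plus, RtoC_mult.
    field. }
  assert (Hyn : ee ((u + IZR k * z + 1) / 2 + IZR m * z) = - y).
  { unfold y. replace ((u + IZR k * z + 1) / 2 + IZR m * z) with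
      ((u + IZR k * z) / 2 + IZR m * z + / 2) by field.
    rewrite ee_plus, ee_half. ring. }
  rewrite Hyn, Hy2. apply c3_dup. rewrite <- Hy2. apply Hu.
Qed.

(** Halving u covers the even indices, halving u + z the odd ones (k = 0 and k = 1 above). The
    surplus boundary term tends to 0 by decay. *)
Lemma Esum_c3_dup u z : upper z -> nonlat u z ->
  Esum c3 (u / 2) z + Esum c3 ((u + 1) / 2) z + (Esum c3 ((u + z) / 2) z
    + Esum c3 ((u + z + 1) / 2) z) = 8 * Esum c3 u z.
Proof.
  intros Hz Hu. pose proof decay_c3 as Hc.
  assert (HL := ccv_plus _ _ _ _
    (ccv_plus _ _ _ _ (Esum_ccv c3 (u / 2) z Hz Hc) (Esum_ccv c3 ((u + 1) / 2) z Hz Hc))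
    (ccv_plus _ _ _ _ (Esum_ccv c3 ((u + z) / 2) z Hz Hc)
       (Esum_ccv c3 ((u + z + 1) / 2) z Hz Hc))).
  destruct (Eterm_ccv_0 c3 u z Hz Hc) as [H0 _].
  assert (HR := ccv_scal 8 _ _ (ccv_plus _ _ _ _
    (ccv_subseq _ _ (fun n => 2 * n)%nat ltac:(intros n; cbv beta; lia) (Esum_ccv c3 u z Hz Hc))
    (ccv_subseq _ _ (fun n => S (2 * n))%nat ltac:(intros n; cbv beta; lia) H0))).
  replace (Esum c3 u z + 0) with (Esum c3 u z) in HR by ring.
  apply (ccv_unique _ _ _ HL). eapply ccv_ext; [|exact HR]. intros n. cbv beta.
  rewrite <- bisum_even_odd.
  rewrite Cmult_plus_distr_l, <- !bisum_scal.
  rewrite <- (bisum_plus (Eterm c3 (u / 2) z)), <- (bisum_plus (Eterm c3 ((u + z) / 2) z)).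
  f_equal; apply bisum_ext; intros m; symmetry.
  - pose proof (Eterm_c3_dup u z m 0 Hu) as H.
    replace (u + 0%R * z) with u in H by ring. now rewrite Z.add_0_r in H.
  - pose proof (Eterm_c3_dup u z m 1 Hu) as H.
    now replace (u + 1%R * z) with (u + z) in H by ring.
Qed.

(** Up to the factor [tpi]^3, the third logarithmic derivative in u of the ratio [Squot] introduced
    later; the goal is that it vanishes. *)
Definition Sdef3 (z u : C) : C := Esum c3 (u / z) (- / z) / (z * z * z) - Esum c3 u z.

Lemma Sdef3_plus_1 z u : upper z -> Sdef3 z (u + 1) = Sdef3 z u.
Proof.
  intros Hz. unfold Sdef3. rewrite Esum_plus_1. f_equal. f_equal.
  pose proof (upper_neq_0 z Hz).
  rewrite <- (Esum_plus_z c3 ((u + 1) / z)); [|now apply upper_S|apply decay_c3].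
  f_equal. field. easy.
Qed.

Lemma Sdef3_plus_z z u : upper z -> Sdef3 z (u + z) = Sdef3 z u.
Proof.
  intros Hz. unfold Sdef3. rewrite Esum_plus_z; [|easy|apply decay_c3]. f_equal. f_equal.
  pose proof (upper_neq_0 z Hz).
  rewrite <- (Esum_plus_1 c3 (u / z)). f_equal. field. easy.
Qed.

Lemma Sdef3_period z u (m n : Z) : upper z -> Sdef3 z (u + IZR m * z + IZR n) = Sdef3 z u.
Proof.
  intros Hz. replace (RtoC (IZR n)) with (IZR n * 1) by ring.
  rewrite (period_Z (Sdef3 z) 1) by (intros; now apply Sdef3_plus_1).
  apply (period_Z (Sdef3 z) z). intros. now apply Sdef3_plus_z.
Qed.

Lemma Sdef3_dup z u : upper z -> nonlat u z ->
  Sdef3 z (u / 2) + Sdef3 z ((u + 1) / 2) + Sdef3 z ((u + z) / 2) + Sdef3 z ((u + z + 1) / 2)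
  = 8 * Sdef3 z u.
Proof.
  intros Hz Hu. unfold Sdef3.
  pose proof (upper_neq_0 z Hz) as Hz0. pose proof (upper_S z Hz) as Hz'.
  pose proof (Esum_c3_dup u z Hz Hu) as H1.
  pose proof (Esum_c3_dup (u / z) (- / z) Hz' (nonlat_S u z Hz Hu)) as H2.
  replace ((u / z + 1) / 2) with ((u + z) / 2 / z) in H2 by (field; easy).
  replace (u / z / 2) with (u / 2 / z) in H2 by (field; easy).
  (* Passing from z to -1/z exchanges the roles of the periods 1 and z, so the four half points
     agree only up to order and a period; the period is put in here. *)
  assert (E1 : Esum c3 ((u / z + - / z) / 2) (- / z) = Esum c3 ((u + 1) / 2 / z) (- / z)).
  { rewrite <- (Esum_plus_z c3 ((u + 1) / 2 / z)); [|easy|apply decay_c3].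
    f_equal. field. easy. }
  assert (E2 : Esum c3 ((u / z + - / z + 1) / 2) (- / z) = Esum c3 ((u + z + 1) / 2 / z) (- / z)).
  { rewrite <- (Esum_plus_z c3 ((u + z + 1) / 2 / z)); [|easy|apply decay_c3].
    f_equal. field. easy. }
  rewrite E1, E2 in H2.
  transitivity (8 * Esum c3 (u / z) (- / z) / (z * z * z) - 8 * Esum c3 u z).
  - rewrite <- H1, <- H2. field. easy.
  - field. easy.
Qed.

Lemma Esum_c3_cder u z : upper z -> nonlat u z ->
  cder (fun y => Esum c3 y z) u (tpi * Esum c4 u z).
Proof.
  intros Hz Hu. apply (cder_Esum c3 c4); auto using decay_c4, cder_c3.
  intros y _. apply Esum_ccv; [easy|apply decay_c3].
Qed.

Lemma cder_div_const (z u : C) : z <> 0 -> cder (fun y => y / z) u (/ z).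
Proof.
  intros Hz. apply cder_ext with (fun y => / z * y). { intros; unfold Cdiv; ring. }
  apply cder_eq with (/ z * 1); [ring|]. apply cder_scal, cder_id.
Qed.

Lemma Sdef3_locally_bounded_nonlat z u : upper z -> nonlat u z ->
  exists rho M : R, 0 < rho /\ 0 <= M /\
  forall y, Cmod (y - u) < rho -> Cmod (Sdef3 z y) <= M.
Proof.
  intros Hz Hu. pose proof (upper_neq_0 z Hz) as Hz0.
  assert (Hd : exists l, cder (Sdef3 z) u l).
  { eexists. unfold Sdef3. apply cder_minus; [|now apply Esum_c3_cder].
    apply cder_ext with (fun y => / (z * z * z) * Esum c3 (y / z) (- / z)).
    { intros y. field. easy. }
    apply cder_scal. apply (cder_comp (fun v => Esum c3 v (- / z)) (fun y => y / z)).
    - now apply cder_div_const.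
    - apply Esum_c3_cder; [now apply upper_S|now apply nonlat_S]. }
  destruct Hd as [l Hd].
  destruct (cder_cont _ _ _ Hd 1%R ltac:(lra)) as [d [Hd0 H]].
  exists d, (Cmod (Sdef3 z u) + 1)%R. split; [easy|]. pose proof (Cmod_ge_0 (Sdef3 z u)).
  split; [lra|]. intros y Hy. specialize (H y Hy).
  pose proof (Cmod_triangle_rev (Sdef3 z y) (Sdef3 z u)). lra.
Qed.

Lemma ccv_ee_quotient (w : nat -> C) : ccv w 0 -> (forall n, w n <> 0) ->
  ccv (fun n => (ee (w n) - 1) / w n) tpi.
Proof.
  intros Hw Hn. apply ccv_eps. intros eps He.
  destruct (proj1 (cder_eps _ _ _) (cder_ee 0) (eps / 2)%R ltac:(lra)) as [d [Hd H]].
  destruct (proj1 (ccv_eps _ _) Hw d Hd) as [N HN]. exists N. intros n Hnn. specialize (HN n Hnn).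
  rewrite Cminus_0_r in HN. specialize (H (w n) HN). rewrite Cplus_0_l, ee_0 in H.
  replace ((ee (w n) - 1) / w n - tpi) with ((ee (w n) - 1 - tpi * 1 * w n) / w n)
    by (field; apply Hn).
  rewrite Cmod_div by apply Hn. pose proof (Cmod_pos_of_ne _ (Hn n)) as Hp.
  apply Rle_lt_trans with (eps / 2)%R; [|lra].
  apply Rmult_le_reg_r with (Cmod (w n)); [easy|].
  unfold Rdiv at 1. rewrite Rmult_assoc, Rinv_l, Rmult_1_r by lra. easy.
Qed.

(* The pole of [Esum c3] at 0 has leading term [2 / (tpi u)^3]. *)
Lemma Esum_c3_pole z (w : nat -> C) : upper z -> ccv w 0 ->
  (forall n, w n <> 0) -> (forall n, ee (w n) <> 1) ->
  ccv (fun n => w n * w n * w n * Esum c3 (w n) z) (2 / (tpi * tpi * tpi)).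
Proof.
  intros Hz Hw Hn Hn1.
  destruct (Esum_rest_bound c3 z Hz decay_c3) as [rho [M [Hrho HM]]].
  assert (Hx : ccv (fun n => ee (w n)) 1).
  { rewrite <- ee_0. eapply cder_ccv; [apply cder_ee|easy]. }
  assert (Hq := ccv_ee_quotient w Hw Hn).
  assert (Hq' := ccv_inv _ _ tpi_neq_0 Hq).
  assert (Hmain := ccv_mult _ _ _ _ (ccv_mult _ _ _ _ Hx (ccv_plus _ _ _ _ Hx (ccv_const 1)))
    (ccv_mult _ _ _ _ (ccv_mult _ _ _ _ Hq' Hq') Hq')).
  assert (Hrest : ccv (fun n => w n * w n * w n * (Esum c3 (w n) z - c3 (ee (w n)))) 0).
  { assert (Hw3 := ccv_mult _ _ _ _ (ccv_mult _ _ _ _ Hw Hw) Hw).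
    replace (0 * 0 * 0) with (RtoC 0) in Hw3 by ring.
    apply ccv_eps. intros eps He. destruct (proj1 (ccv_eps _ _) Hw rho Hrho) as [N1 HN1].
    destruct (proj1 (ccv_eps _ _) Hw3 (eps / (Rabs M + 1))%R) as [N2 HN2].
    { apply Rdiv_lt_0_compat; pose proof (Rabs_pos M); lra. }
    exists (N1 + N2)%nat. intros n Hnn.
    specialize (HN1 n ltac:(lia)). specialize (HN2 n ltac:(lia)).
    rewrite Cminus_0_r in *. rewrite Cmod_mult. specialize (HM _ HN1).
    pose proof (Rle_abs M). pose proof (Rabs_pos M).
    apply Rle_lt_trans with (Cmod (w n * w n * w n) * (Rabs M + 1))%R.
    { apply Rmult_le_compat_l; [apply Cmod_ge_0|lra]. }
    replace eps with (eps / (Rabs M + 1) * (Rabs M + 1))%R by (field; lra).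
    apply Rmult_lt_compat_r; lra. }
  assert (HH := ccv_plus _ _ _ _ Hmain Hrest).
  replace (2 / (tpi * tpi * tpi)) with (1 * (1 + 1) * (/ tpi * / tpi * / tpi) + 0)
    by (field; apply tpi_neq_0).
  eapply ccv_ext; [|exact HH]. intros n. cbv beta. unfold c3. simpl.
  assert (ee (w n) - 1 <> 0) by (apply Cminus_neq_0, Hn1).
  field. split; [easy|apply Hn].
Qed.

(** Division by z^3 undoes the scaling u/z, so both sums have the principal term 2 / (tpi u)^3. What
    is left is o(u^-3), not yet bounded. *)
Lemma Sdef3_pole z (w : nat -> C) : upper z -> ccv w 0 -> (forall n, nonlat (w n) z) ->
  ccv (fun n => w n * w n * w n * Sdef3 z (w n)) 0.
Proof.
  intros Hz Hw Hn. pose proof (upper_neq_0 z Hz) as Hz0.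
  assert (H1 := Esum_c3_pole z w Hz Hw (fun n => nonlat_neq_0 _ _ (Hn n)) (fun n => nonlat_ee _ _ (Hn n))).
  assert (H2 : ccv (fun n => w n / z) 0).
  { replace (RtoC 0) with (/ z * 0) by ring.
    eapply ccv_ext; [|apply (ccv_scal (/ z) _ _ Hw)]. intros n. unfold Cdiv. ring. }
  assert (Hn' : forall n, nonlat (w n / z) (- / z)) by (intros; now apply nonlat_S).
  assert (H3 := Esum_c3_pole (- / z) _ (upper_S z Hz) H2
    (fun n => nonlat_neq_0 _ _ (Hn' n)) (fun n => nonlat_ee _ _ (Hn' n))).
  assert (H4 := ccv_minus _ _ _ _ H3 H1).
  replace (2 / (tpi * tpi * tpi) - 2 / (tpi * tpi * tpi)) with (RtoC 0) in H4 by ring.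
  eapply ccv_ext; [|exact H4]. intros n. cbv beta. unfold Sdef3. field. easy.
Qed.

Lemma nonlat_basis z (m n : Z) : upper z -> (Z.odd m || Z.odd n = true)%bool ->
  nonlat ((IZR m * z + IZR n) / 2) z.
Proof.
  intros Hz Hodd. apply nonlat_iff. intros a b E.
  assert (E' : IZR (m - 2 * a) * z + IZR (n - 2 * b) = 0).
  { rewrite !minus_IZR, !mult_IZR, !RtoC_minus, !RtoC_mult.
    replace ((IZR m - 2 * IZR a) * z + (IZR n - 2 * IZR b)) with
      (2 * ((IZR m * z + IZR n) / 2 - (IZR a * z + IZR b))) by field.
    rewrite E. ring. }
  assert (Hm : (m - 2 * a = 0)%Z).
  { apply (f_equal Im) in E'. rewrite im_plus, im_scal_l in E'. cbn [Im RtoC snd] in E'.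
    rewrite Rplus_0_r in E'. unfold upper in Hz. apply eq_IZR.
    destruct (Rmult_integral _ _ E'); [easy|lra]. }
  rewrite Hm in E'. assert (Hn : (n - 2 * b = 0)%Z).
  { apply eq_IZR. apply RtoC_inj. rewrite <- E'. ring. }
  replace m with (2 * a)%Z in Hodd by lia. replace n with (2 * b)%Z in Hodd by lia.
  rewrite !Z.odd_mul in Hodd. discriminate.
Qed.

Lemma ccv_halving w : ccv (fun n => w / 2 ^ n) 0.
Proof.
  apply ccv_of_bound with (A := Cmod w) (r := (1 / 2)%R); [lra|].
  intros n. rewrite Cminus_0_r, Cmod_div by (apply Cpow_nz, C2_nz).
  rewrite Cmod_pow, Cmod_R, Rabs_pos_eq by lra.
  unfold Rdiv. rewrite Rpow_mult_distr, pow1, Rmult_1_l, pow_inv. lra.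
Qed.

Lemma nonlat_halving w z : nonlat w z -> forall n, nonlat (w / 2 ^ n) z.
Proof.
  intros H n. induction n as [|n IH].
  - simpl. replace (w / 1) with w by field. easy.
  - apply (nonlat_half _ _ 0 0) in IH.
    replace (w / 2 ^ S n) with ((w / 2 ^ n + 0%R * z + 0%R) / 2); [easy|].
    rewrite Cpow_S. field. apply Cpow_nz, C2_nz.
Qed.

Lemma Sdef3_dup_bound z u : upper z -> nonlat u z ->
  Cmod (Sdef3 z u) <= (Cmod (Sdef3 z (u / 2)%C) + Cmod (Sdef3 z ((u + 1) / 2)%C) +
     Cmod (Sdef3 z ((u + z) / 2)%C) + Cmod (Sdef3 z ((u + z + 1) / 2)%C)) / 8.
Proof.
  intros Hz Hu. assert (HD := Sdef3_dup z u Hz Hu). apply (f_equal Cmod) in HD.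
  rewrite Cmod_mult, (Cmod_R 8), (Rabs_pos_eq 8) in HD by lra.
  set (a := Sdef3 z (u / 2)) in *. set (b := Sdef3 z ((u + 1) / 2)) in *.
  set (c := Sdef3 z ((u + z) / 2)) in *. set (d := Sdef3 z ((u + z + 1) / 2)) in *.
  pose proof (Cmod_triangle (a + b + c) d). pose proof (Cmod_triangle (a + b) c).
  pose proof (Cmod_triangle a b). lra.
Qed.

(** Duplication near 0 involves w/2 and three points near the half periods, where the function is
    bounded: |f(w)| <= |f(w/2)|/8 + M. Iterating leaves |f(w/2^n)|/8^n + 2M, and the first term
    tends to 0 because f(w) = o(w^-3). *)
Lemma Sdef3_locally_bounded_0 z : upper z ->
  exists rho M : R, 0 < rho /\ 0 <= M /\
  forall w, Cmod w < rho -> nonlat w z -> Cmod (Sdef3 z w) <= M.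
Proof.
  intros Hz.
  destruct (Sdef3_locally_bounded_nonlat z (1 / 2) Hz) as [r1 [M1 [Hr1 [HM1 H1]]]].
  { replace (1 / 2) with ((0%R * z + 1%R) / 2) by field. now apply (nonlat_basis z 0 1). }
  destruct (Sdef3_locally_bounded_nonlat z (z / 2) Hz) as [r2 [M2 [Hr2 [HM2 H2]]]].
  { replace (z / 2) with ((1%R * z + 0%R) / 2) by field. now apply (nonlat_basis z 1 0). }
  destruct (Sdef3_locally_bounded_nonlat z ((z + 1) / 2) Hz) as [r3 [M3 [Hr3 [HM3 H3]]]].
  { replace (z + 1) with (1%R * z + 1%R) by ring. now apply (nonlat_basis z 1 1). }
  set (M := ((M1 + M2 + M3) / 8)%R).
  set (rho := Rmin r1 (Rmin r2 r3)).
  assert (Hrho : 0 < rho) by (unfold rho; repeat apply Rmin_pos; easy).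
  assert (HM : 0 <= M) by (unfold M; lra).
  assert (Hstep : forall w, Cmod w < rho -> nonlat w z ->
    Cmod (Sdef3 z w) <= Cmod (Sdef3 z (w / 2)%C) / 8 + M).
  { intros w Hw Hn. pose proof (Cmod_ge_0 w) as Hw0.
    assert (Hw2 : Cmod (w / 2) < rho).
    { rewrite Cmod_div, Cmod_R, Rabs_pos_eq by (lra || apply C2_nz). lra. }
    pose proof (Sdef3_dup_bound z w Hz Hn) as HD.
    specialize (H1 ((w + 1) / 2)). specialize (H2 ((w + z) / 2)). specialize (H3 ((w + z + 1) / 2)).
    replace ((w + 1) / 2 - 1 / 2) with (w / 2) in H1 by field.
    replace ((w + z) / 2 - z / 2) with (w / 2) in H2 by field.
    replace ((w + z + 1) / 2 - (z + 1) / 2) with (w / 2) in H3 by field.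
    assert (L1 : rho <= r1) by apply Rmin_l.
    assert (L2 : rho <= r2) by (eapply Rle_trans; [apply Rmin_r|apply Rmin_l]).
    assert (L3 : rho <= r3) by (eapply Rle_trans; [apply Rmin_r|apply Rmin_r]).
    specialize (H1 ltac:(lra)). specialize (H2 ltac:(lra)). specialize (H3 ltac:(lra)).
    unfold M. lra. }
  exists rho, (2 * M)%R. split; [easy|]. split; [lra|].
  intros w Hw Hn. pose proof (nonlat_neq_0 w z Hn) as Hw0.
  (* The n-th step adds M/8^n, which is at most M/2^n; summing the latter gives the closed form on
     the right. *)
  assert (Hiter : forall n, Cmod (Sdef3 z w) <=
    Cmod (Sdef3 z (w / 2 ^ n)%C) / 8 ^ n + 2 * M * (1 - (1 / 2) ^ n)).
  { induction n as [|n IH].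
    - simpl. replace (w / 1) with w by field. lra.
    - assert (Hp8 : 0 < 8 ^ n) by (apply pow_lt; lra).
      assert (Hwn : Cmod (w / 2 ^ n) < rho).
      { rewrite Cmod_div, Cmod_pow, Cmod_R, Rabs_pos_eq by (lra || apply Cpow_nz, C2_nz).
        eapply Rle_lt_trans; [|exact Hw].
        assert (1 <= 2 ^ n) by (apply pow_R1_Rle; lra).
        apply Rmult_le_reg_r with (2 ^ n)%R; [lra|].
        unfold Rdiv. rewrite Rmult_assoc, Rinv_l, Rmult_1_r by lra.
        pose proof (Cmod_ge_0 w). nra. }
      specialize (Hstep _ Hwn (nonlat_halving w z Hn n)).
      replace (w / 2 ^ n / 2) with (w / 2 ^ S n) in Hstep
        by (rewrite Cpow_S; field; apply Cpow_nz, C2_nz).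
      eapply Rle_trans; [exact IH|].
      apply Rle_trans with ((Cmod (Sdef3 z (w / 2 ^ S n)%C) / 8 + M) / 8 ^ n
        + 2 * M * (1 - (1 / 2) ^ n))%R.
      { apply Rplus_le_compat_r. apply Rmult_le_compat_r; [|easy].
        left. now apply Rinv_0_lt_compat. }
      assert (Hc : M / 8 ^ n <= M * (1 / 2) ^ n).
      { unfold Rdiv. apply Rmult_le_compat_l; [easy|].
        rewrite Rmult_1_l, <- pow_inv. apply pow_incr. lra. }
      simpl pow.
      replace ((Cmod (Sdef3 z (w / 2 ^ S n)) / 8 + M) / 8 ^ n)%R with
        (Cmod (Sdef3 z (w / 2 ^ S n)) / (8 * 8 ^ n) + M / 8 ^ n)%R by (field; lra).
      lra. }
  assert (Hpole := Sdef3_pole z (fun n => w / 2 ^ n) Hz (ccv_halving w) (nonlat_halving w z Hn)).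
  apply Rle_plus_epsilon. intros eps He.
  assert (Hw3 : 0 < Cmod (w * w * w))
    by (apply Cmod_pos_of_ne; repeat apply Cmult_neq_0; easy).
  destruct (proj1 (ccv_eps _ _) Hpole (eps * Cmod (w * w * w))%R) as [N HN]; [now apply Rmult_lt_0_compat|].
  specialize (HN N (Nat.le_refl N)). rewrite Cminus_0_r in HN. specialize (Hiter N).
  assert (Hp8 : 0 < 8 ^ N) by (apply pow_lt; lra).
  (* Since 8^N = (2^N)^3, this is |v^3 f(v)| / |w|^3 at v = w/2^N. *)
  assert (Hlast : Cmod (Sdef3 z (w / 2 ^ N)%C) / 8 ^ N < eps).
  { apply Rmult_lt_reg_r with (Cmod (w * w * w)); [easy|].
    eapply Rle_lt_trans; [|exact HN]. apply Req_le.
    replace (w / 2 ^ N * (w / 2 ^ N) * (w / 2 ^ N) * Sdef3 z (w / 2 ^ N)) with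
      (w * w * w * Sdef3 z (w / 2 ^ N) / (RtoC 8 ^ N)).
    2:{ replace (RtoC 8) with (RtoC 2 * RtoC 2 * RtoC 2) by ring.
        rewrite !Cpow_mult_l. field. apply Cpow_nz, C2_nz. }
    assert (C8 : RtoC 8 ^ N <> 0) by (apply Cpow_nz; intros E; apply RtoC_inj in E; lra).
    rewrite Cmod_div, (Cmod_mult (w * w * w)), Cmod_pow, (Cmod_R 8), (Rabs_pos_eq 8)
      by (lra || easy).
    field. lra. }
  assert (Hp : 0 < (1 / 2) ^ N) by (apply pow_lt; lra).
  nra.
Qed.

Lemma fundamental_domain z u : upper z -> exists (m n : Z) (a b : R),
  0 <= a < 1 /\ 0 <= b < 1 /\ u + IZR m * z + IZR n = a * z + b.
Proof.
  intros Hz. set (s := (Im u / Im z)%R). set (t := (Re u - s * Re z)%R).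
  assert (E : u = s * z + t).
  { unfold upper in Hz. destruct u as [a b], z as [x y]. unfold s, t, s.
    unfold Cplus, Cmult, RtoC, Re, Im in *; simpl in *. f_equal; field; lra. }
  exists (- Int_part s)%Z, (- Int_part t)%Z, (s - IZR (Int_part s))%R, (t - IZR (Int_part t))%R.
  destruct (base_Int_part s). destruct (base_Int_part t).
  split; [lra|]. split; [lra|]. rewrite E, !opp_IZR, !RtoC_minus, !RtoC_opp. ring.
Qed.

(** A single d is both the radius and the reciprocal of the bound: the compactness theorem for
    gauges then yields one lower bound for d, hence one global bound. *)
Lemma Sdef3_locally_bounded z (s t : R) : upper z ->
  exists d : posreal, forall s' t' : R, Rabs (s' - s) < d -> Rabs (t' - t) < d ->
  nonlat (s' * z + t') z -> Cmod (Sdef3 z (s' * z + t')%C) <= / d.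
Proof.
  intros Hz.
  assert (Hloc : exists rho M : R, 0 < rho /\ 0 <= M /\
    forall y, Cmod (y - (s * z + t)) < rho -> nonlat y z -> Cmod (Sdef3 z y) <= M).
  { destruct (classic (nonlat (s * z + t) z)) as [Hn|Hn].
    - destruct (Sdef3_locally_bounded_nonlat z _ Hz Hn) as [rho [M [H1 [H2 H3]]]].
      exists rho, M. auto.
    - rewrite nonlat_iff in Hn. apply not_all_ex_not in Hn as [m Hn].
      apply not_all_ex_not in Hn as [n Hn]. apply NNPP in Hn.
      destruct (Sdef3_locally_bounded_0 z Hz) as [rho [M [H1 [H2 H3]]]].
      exists rho, M. split; [easy|]. split; [easy|]. intros y Hy Hyn.
      rewrite <- (Sdef3_period z y (- m) (- n) Hz). apply H3.
      + rewrite Hn in Hy. rewrite !opp_IZR, !RtoC_opp.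
        replace (y + - IZR m * z + - IZR n) with (y - (IZR m * z + IZR n)) by ring. easy.
      + now apply nonlat_shift. }
  destruct Hloc as [rho [M [Hrho [HM H]]]].
  pose proof (Cmod_ge_0 z) as Hzz.
  assert (Hd : 0 < Rmin (rho / (Cmod z + 1)) (/ (M + 1))).
  { apply Rmin_pos; [apply Rdiv_lt_0_compat; lra|apply Rinv_0_lt_compat; lra]. }
  exists (mkposreal _ Hd). simpl. intros s' t' Hs Ht Hn.
  assert (Hs1 := Rlt_le_trans _ _ _ Hs (Rmin_l _ _)).
  assert (Ht1 := Rlt_le_trans _ _ _ Ht (Rmin_l _ _)).
  apply Rle_trans with M.
  - apply H; [|easy].
    replace (s' * z + t' - (s * z + t)) with (RtoC (s' - s) * z + RtoC (t' - t))
      by (rewrite !RtoC_minus; ring).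
    eapply Rle_lt_trans; [apply Cmod_triangle|]. rewrite Cmod_mult, !Cmod_R.
    apply Rle_lt_trans with (rho / (Cmod z + 1) * Cmod z + Rabs (t' - t))%R.
    { apply Rplus_le_compat_r, Rmult_le_compat_r; lra. }
    replace rho with (rho / (Cmod z + 1) * Cmod z + rho / (Cmod z + 1))%R at 2 by (field; lra).
    lra.
  - apply Rle_trans with (M + 1)%R; [lra|]. rewrite <- (Rinv_inv (M + 1)) at 1.
    apply Rinv_le_contravar; [easy|apply Rmin_r].
Qed.

Lemma Sdef3_bounded z : upper z ->
  exists M : R, forall u, nonlat u z -> Cmod (Sdef3 z u) <= M.
Proof.
  intros Hz.
  set (delta := fun s t : R => proj1_sig
    (constructive_indefinite_description _ (Sdef3_locally_bounded z s t Hz))).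
  destruct (compactness_value_2d 0 1 0 1 delta) as [d Hd].
  exists (/ d)%R. intros u Hu.
  destruct (fundamental_domain z u Hz) as [m [n [s [t [Hs [Ht E]]]]]].
  rewrite <- (Sdef3_period z u m n Hz), E.
  assert (Hn := nonlat_shift u z m n Hu). rewrite E in Hn.
  (* The compactness theorem concludes with a double negation. *)
  specialize (Hd s t ltac:(lra) ltac:(lra)). apply NNPP in Hd.
  destruct Hd as [a [b [_ [_ [Ha [Hb Hab]]]]]].
  unfold delta in Ha, Hb, Hab.
  destruct (constructive_indefinite_description _ (Sdef3_locally_bounded z a b Hz)) as [e He].
  simpl in *. eapply Rle_trans; [now apply He|].
  apply Rinv_le_contravar; [apply cond_pos|easy].
Qed.

(** Four terms against a factor 8: a bound M on all non-lattice points implies the bound M/2 there,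
    and so on. *)
Lemma Sdef3_zero z u : upper z -> nonlat u z -> Sdef3 z u = 0.
Proof.
  intros Hz Hu. destruct (Sdef3_bounded z Hz) as [M HM].
  assert (Hn : forall n u, nonlat u z -> Cmod (Sdef3 z u) <= M * (1 / 2) ^ n).
  { induction n as [|n IH]; intros v Hv.
    - simpl. rewrite Rmult_1_r. auto.
    - pose proof (Sdef3_dup_bound z v Hz Hv) as HD.
      pose proof (nonlat_half v z 0 0 Hv) as N1. pose proof (nonlat_half v z 0 1 Hv) as N2.
      pose proof (nonlat_half v z 1 0 Hv) as N3. pose proof (nonlat_half v z 1 1 Hv) as N4.
      replace (v + 0%R * z + 0%R) with v in N1 by ring.
      replace (v + 0%R * z + 1%R) with (v + 1) in N2 by ring.
      replace (v + 1%R * z + 0%R) with (v + z) in N3 by ring.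
      replace (v + 1%R * z + 1%R) with (v + z + 1) in N4 by ring.
      apply IH in N1, N2, N3, N4.
      simpl. lra. }
  apply Cmod_eq_0. apply Rle_antisym; [|apply Cmod_ge_0].
  apply Rle_plus_epsilon. intros eps He. rewrite Rplus_0_l.
  destruct (geo_small M (1 / 2) eps) as [N HN]; [lra|easy|].
  left. eapply Rle_lt_trans; [apply (Hn N u Hu)|apply HN; lia].
Qed.

(** * The transformation law under z -> -1/z *)

Fixpoint csum (f : nat -> C) (n : nat) : C :=
  match n with O => 0 | S k => csum f k + f k end.

Lemma qfac_neq_0 u z : nonlat u z -> forall n, qfac u z n <> 0.
Proof.
  intros H n E. apply (H (Z.of_nat (S n))). rewrite <- INR_IZR_INZ.
  unfold qfac in E. rewrite Cplus_comm.
  replace (ee (INR (S n) * z + u)) with (1 - (1 - ee (INR (S n) * z + u))) by ring.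
  rewrite E. ring.
Qed.

Lemma nonlat_opp u z : nonlat u z -> nonlat (- u) z.
Proof.
  rewrite !nonlat_iff. intros H m n E. apply (H (- m)%Z (- n)%Z).
  rewrite !opp_IZR, !RtoC_opp. replace u with (- - u) by ring. rewrite E. ring.
Qed.

Lemma cder_qprod_ex u z : upper z ->
  exists l, cder (fun y => qprod y z) u l /\
  ccv (partial_prod_der (qfac u z) (fun n => - (tpi * ee (INR (S n) * z + u)))) l.
Proof.
  intros Hz. pose proof (nome_bound z Hz) as Hq.
  destruct (Cmod_ee_near u) as [B [HB Hee]].
  pose proof (Cmod_ge_0 tpi) as Ht.
  apply (cder_inf_prod (fun n y => qfac y z n) (fun n y => - (tpi * ee (INR (S n) * z + y))))
    with (rho := 1%R) (A := ((1 + Cmod tpi) * B * nome z)%R) (r := nome z); [lra|lra| | |].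
  - intros n y _. unfold qfac.
    eapply cder_eq; [|apply cder_minus; [apply cder_const|
      apply (cder_ee_comp (fun y => INR (S n) * z + y)), cder_plus; [apply cder_const|apply cder_id]]].
    ring.
  - intros n y Hy. eapply Rle_trans; [apply qfac_bound|].
    apply Rmult_le_compat_r; [apply pow_le; lra|]. apply Rmult_le_compat_r; [lra|].
    destruct (Hee y Hy) as [Hy1 _]. nra.
  - intros n y Hy. rewrite Cmod_opp, Cmod_mult, Cmod_ee_step, <- !Rmult_assoc.
    apply Rmult_le_compat_r; [apply pow_le; lra|]. apply Rmult_le_compat_r; [lra|].
    destruct (Hee y Hy) as [Hy1 _]. pose proof (Cmod_ge_0 (ee y)).
    apply Rmult_le_compat; lra.
Qed.

Lemma cder_qprod u z : upper z -> nonlat u z ->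
  exists s, cder (fun y => qprod y z) u (qprod u z * s) /\
  ccv (csum (fun n => - (tpi * ee (INR (S n) * z + u)) / qfac u z n)) s.
Proof.
  intros Hz Hu. destruct (cder_qprod_ex u z Hz) as [l [Hl Hcv]].
  pose proof (qfac_neq_0 u z Hu) as Hf.
  assert (Hpp : forall n, partial_prod (qfac u z) n <> 0).
  { induction n as [|n IH]; cbn [partial_prod]; [apply C1_nz|now apply Cmult_neq_0]. }
  pose proof (qprod_neq_0 u z Hz Hf) as HP.
  exists (/ qprod u z * l). split.
  - apply cder_eq with l; [field; easy|easy].
  - eapply ccv_ext; [|apply ccv_mult; [apply (ccv_inv _ _ HP (qprod_ccv u z Hz))|exact Hcv]].
    intros n. cbv beta.
    rewrite (partial_prod_der_log _ _
      (csum (fun n => - (tpi * ee (INR (S n) * z + u)) / qfac u z n))); auto.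
    field. apply Hpp.
Qed.

Lemma half_factor_neq_0 u : ee u <> 1 -> ee (u / 2) - ee (- (u / 2)) <> 0.
Proof.
  intros Hu. rewrite ee_half_factor. apply Cmult_neq_0; [apply ee_neq_0|].
  intros E. apply Hu. rewrite ee_opp in E. pose proof (ee_neq_0 u).
  replace (ee u) with (ee u * (1 - / ee u) + 1) by (field; easy). rewrite E. ring.
Qed.

Lemma Phi_neq_0 u z : upper z -> nonlat u z -> Phi u z <> 0.
Proof.
  intros Hz Hu. unfold Phi. pose proof (qprod_0_neq_0 z Hz).
  apply Cmult_neq_0.
  - apply Cmult_neq_0; [apply half_factor_neq_0, (nonlat_ee u z Hu)|].
    apply Cmult_neq_0; apply qprod_neq_0; auto; apply qfac_neq_0; auto using nonlat_opp.
  - intros E. assert (E' : qprod 0 z * qprod 0 z * / (qprod 0 z * qprod 0 z) = 1) by (field; easy).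
    rewrite E, Cmult_0_r in E'. now apply C1_nz.
Qed.

(** The symmetric sum of [c1] is summed through the product: its partial sums are logarithmic
    derivatives of partial products, whose convergence is known. *)
Lemma Phi_logder u z : upper z -> nonlat u z ->
  ccv (bisum (Eterm c1 u z)) (Esum c1 u z) /\
  cder (fun y => Phi y z) u (Phi u z * (tpi * Esum c1 u z)).
Proof.
  intros Hz Hu. pose proof C2_nz as H2. pose proof tpi_neq_0 as Ht.
  destruct (cder_qprod u z Hz Hu) as [s1 [Hd1 Hs1]].
  destruct (cder_qprod (- u) z Hz (nonlat_opp u z Hu)) as [s2 [Hd2 Hs2]].
  assert (Hx1 : ee u - 1 <> 0) by apply Cminus_neq_0, (nonlat_ee u z Hu).
  (* With c1(X) = X/(X - 1) - 1/2 and c1(1/Y) = -Y/(Y - 1) + 1/2, the halves cancel in each pair and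
     the logarithmic derivatives of two factors remain. *)
  assert (Hsum : forall N, bisum (Eterm c1 u z) N = c1 (ee u) + / tpi *
    (csum (fun n => - (tpi * ee (INR (S n) * z + u)) / qfac u z n) N
     - csum (fun n => - (tpi * ee (INR (S n) * z + - u)) / qfac (- u) z n) N)).
  { induction N as [|N IH].
    - cbn [bisum csum]. unfold Eterm. replace (u + 0%R * z) with u by ring. ring.
    - cbn [bisum csum]. rewrite IH. unfold Eterm. rewrite ee_neg_mult.
      rewrite <- !INR_IZR_INZ, !(Cplus_comm _ (INR (S N) * z)).
      pose proof (qfac_neq_0 u z Hu N) as F1. pose proof (qfac_neq_0 (- u) z (nonlat_opp u z Hu) N) as F2.
      unfold qfac in *. pose proof (ee_neq_0 (INR (S N) * z + - u)).
      set (x := ee (INR (S N) * z + u)) in *. set (y := ee (INR (S N) * z + - u)) in *.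
      assert (G1 : x - 1 <> 0).
      { intros E. apply F1. replace (1 - x) with (- (x - 1)) by ring. rewrite E. ring. }
      unfold c1. field. repeat split; auto. }
  assert (Hcv : ccv (bisum (Eterm c1 u z)) (c1 (ee u) + / tpi * (s1 - s2))).
  { eapply ccv_ext; [intros n; symmetry; apply Hsum|].
    apply ccv_plus; [apply ccv_const|]. apply ccv_scal. now apply ccv_minus. }
  assert (HE : Esum c1 u z = c1 (ee u) + / tpi * (s1 - s2)) by now apply clim_unique.
  rewrite HE. split; [easy|].
  assert (Hd2' : cder (fun y => qprod (- y) z) u (qprod (- u) z * s2 * - (1))).
  { apply (cder_comp (fun v => qprod v z) (fun y => - y)); [|easy].
    apply cder_ext with (fun y => - (1) * y); [intros; ring|].
    apply cder_eq with (- (1) * 1); [ring|]. apply cder_scal, cder_id. }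
  assert (Hh : cder (fun y => y / 2) u (/ 2)) by now apply cder_div_const.
  assert (Hh' : cder (fun y => - (y / 2)) u (- (1) * / 2)).
  { apply cder_ext with (fun y => - (1) * (y / 2)); [intros; ring|]. now apply cder_scal. }
  assert (Hf : cder (fun y => ee (y / 2) - ee (- (y / 2))) u
    (tpi * ee (u / 2) * / 2 - tpi * ee (- (u / 2)) * (- (1) * / 2))).
  { apply cder_minus; [now apply (cder_ee_comp (fun y => y / 2))|
      now apply (cder_ee_comp (fun y => - (y / 2)))]. }
  assert (HPhi := cder_scal (/ (qprod 0 z * qprod 0 z)) _ _ _
    (cder_mult _ _ _ _ _ Hf (cder_mult _ _ _ _ _ Hd1 Hd2'))). cbv beta in HPhi.
  eapply cder_ext; [|eapply cder_eq; [|exact HPhi]].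
  - intros y. unfold Phi, Cdiv. ring.
  - unfold Phi. rewrite ee_opp. unfold c1.
    replace (ee u) with (ee (u / 2) * ee (u / 2)) in * by (rewrite <- ee_plus; f_equal; field).
    pose proof (ee_neq_0 (u / 2)). pose proof (qprod_0_neq_0 z Hz). field. repeat split; auto.
Qed.

Lemma Esum_c1_cder u z : upper z -> nonlat u z ->
  cder (fun y => Esum c1 y z) u (tpi * Esum c2 u z).
Proof.
  intros Hz Hu. apply (cder_Esum c1 c2); auto using decay_c2, cder_c1.
  intros y Hy. now apply Phi_logder.
Qed.

Lemma Esum_c2_cder u z : upper z -> nonlat u z ->
  cder (fun y => Esum c2 y z) u (tpi * Esum c3 u z).
Proof.
  intros Hz Hu. apply (cder_Esum c2 c3); auto using decay_c3, cder_c2.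
  intros y _. apply Esum_ccv; [easy|apply decay_c2].
Qed.

(** A convex set without lattice points, on which a vanishing derivative forces constancy; what its
    translates by multiples of z miss are the horizontal lines through the lattice points. *)
Definition strip (z u : C) : Prop := (0 < Im u < Im z).

Lemma strip_convex z a b (t : R) : strip z a -> strip z b -> 0 <= t <= 1 ->
  strip z (a + t * (b - a)).
Proof.
  unfold strip. intros Ha Hb Ht.
  replace (Im (a + t * (b - a))) with ((1 - t) * Im a + t * Im b)%R
    by (unfold Cminus; rewrite im_plus, im_scal_l, im_plus, im_opp; ring).
  destruct (Rle_lt_dec t (1 / 2)); split; nra.
Qed.

Lemma strip_nonlat z u : upper z -> strip z u -> nonlat u z.
Proof.
  intros Hz Hu. apply nonlat_iff. intros m n ->. unfold strip, upper in *.
  rewrite im_plus, im_scal_l in Hu. cbn [Im RtoC snd] in Hu. rewrite Rplus_0_r in Hu.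
  assert (0 < IZR m < 1) by nra. destruct H as [H1 H2].
  apply lt_IZR in H1, H2. lia.
Qed.

(** Ratio of the two sides of the law for z -> -1/z, to be shown equal to 1. Its logarithmic
    derivative is [tpi * Sdef1], and [Sdef2] is the derivative of [Sdef1]; their last terms come
    from the Gaussian factor. *)
Definition Squot (z u : C) : C :=
  z * Phi (u / z) (- / z) * ee (- (u * u / (2 * z))) / Phi u z.

Definition Sdef2 (z u : C) : C := tpi * (Esum c2 (u / z) (- / z) / (z * z) - Esum c2 u z) - / z.
Definition Sdef1 (z u : C) : C := Esum c1 (u / z) (- / z) / z - Esum c1 u z - u / z.

Lemma Sdef2_cder z u : upper z -> nonlat u z -> cder (Sdef2 z) u 0.
Proof.
  intros Hz Hu. pose proof (upper_neq_0 z Hz) as Hz0. pose proof (upper_S z Hz) as Hz'.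
  assert (H1 : cder (fun y => Esum c2 (y / z) (- / z)) u (tpi * Esum c3 (u / z) (- / z) * / z)).
  { apply (cder_comp (fun v => Esum c2 v (- / z)) (fun y => y / z)).
    - now apply cder_div_const.
    - apply Esum_c2_cder; [easy|now apply nonlat_S]. }
  assert (H2 := Esum_c2_cder u z Hz Hu).
  assert (H3 := cder_minus _ _ _ _ _
    (cder_scal tpi _ _ _ (cder_minus _ _ _ _ _ (cder_scal (/ (z * z)) _ _ _ H1) H2))
    (cder_const (/ z) u)).
  eapply cder_ext; [|eapply cder_eq; [|exact H3]].
  - intros y. unfold Sdef2. field. easy.
  - transitivity (tpi * tpi * Sdef3 z u).
    + unfold Sdef3. field. easy.
    + rewrite Sdef3_zero by easy. ring.
Qed.

Lemma Sdef1_cder z u : upper z -> nonlat u z -> cder (Sdef1 z) u (Sdef2 z u).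
Proof.
  intros Hz Hu. pose proof (upper_neq_0 z Hz) as Hz0. pose proof (upper_S z Hz) as Hz'.
  assert (H1 : cder (fun y => Esum c1 (y / z) (- / z)) u (tpi * Esum c2 (u / z) (- / z) * / z)).
  { apply (cder_comp (fun v => Esum c1 v (- / z)) (fun y => y / z)).
    - now apply cder_div_const.
    - apply Esum_c1_cder; [easy|now apply nonlat_S]. }
  assert (H2 := Esum_c1_cder u z Hz Hu).
  assert (H3 := cder_minus _ _ _ _ _
    (cder_minus _ _ _ _ _ (cder_scal (/ z) _ _ _ H1) H2) (cder_div_const z u Hz0)).
  eapply cder_ext; [|eapply cder_eq; [|exact H3]].
  - intros y. unfold Sdef1. field. easy.
  - unfold Sdef2. field. easy.
Qed.

Lemma Squot_cder z u : upper z -> nonlat u z -> cder (Squot z) u (Squot z u * (tpi * Sdef1 z u)).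
Proof.
  intros Hz Hu. pose proof (upper_neq_0 z Hz) as Hz0. pose proof (upper_S z Hz) as Hz'.
  destruct (Phi_logder u z Hz Hu) as [_ Hd].
  destruct (Phi_logder (u / z) (- / z) Hz' (nonlat_S u z Hz Hu)) as [_ Hd'].
  assert (H1 := cder_comp _ _ _ _ _ (cder_div_const z u Hz0) Hd').
  assert (Hsq : cder (fun y => - (/ (2 * z)) * (y * y)) u (- (/ (2 * z)) * (1 * u + u * 1))).
  { apply cder_scal, (cder_mult (fun y => y) (fun y => y)); apply cder_id. }
  assert (H2 := cder_ee_comp _ _ _ Hsq).
  assert (H3 := cder_div _ (fun y => Phi y z) _ _ _ (Phi_neq_0 u z Hz Hu)
    (cder_mult _ _ _ _ _ (cder_scal z _ _ _ H1) H2) Hd). cbv beta in H3.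
  pose proof C2_nz. pose proof (Phi_neq_0 u z Hz Hu).
  eapply cder_ext; [|eapply cder_eq; [|exact H3]].
  - intros y. unfold Squot. cbv beta. do 3 f_equal. field. auto.
  - unfold Squot, Sdef1. replace (- / (2 * z) * (u * u)) with (- (u * u / (2 * z))) by (field; auto).
    field. auto.
Qed.

Lemma Squot_plus_1 z u : upper z -> Squot z (u + 1) = Squot z u.
Proof.
  intros Hz. pose proof (upper_neq_0 z Hz) as Hz0. pose proof C2_nz.
  unfold Squot. rewrite Phi_plus_1.
  assert (E := Phi_plus_z ((u + 1) / z) (- / z) (upper_S z Hz)).
  replace ((u + 1) / z + - / z) with (u / z) in E by (field; easy).
  rewrite E.
  replace (- ((u + 1) * (u + 1) / (2 * z))) with
    (- (u * u / (2 * z)) + (- ((u + 1) / z) - - / z / 2)) by (field; auto).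
  rewrite ee_plus. set (a := ee (- ((u + 1) / z) - - / z / 2)).
  unfold Cdiv. rewrite Cinv_opp. ring.
Qed.

Lemma Squot_plus_z z u : upper z -> Squot z (u + z) = Squot z u.
Proof.
  intros Hz. pose proof (upper_neq_0 z Hz) as Hz0. pose proof C2_nz.
  unfold Squot. rewrite Phi_plus_z by easy.
  replace ((u + z) / z) with (u / z + 1) by (field; easy). rewrite Phi_plus_1.
  replace (- ((u + z) * (u + z) / (2 * z))) with
    (- (u * u / (2 * z)) + (- u - z / 2)) by (field; auto).
  rewrite ee_plus. pose proof (ee_neq_0 (- u - z / 2)) as Ha.
  set (a := ee (- u - z / 2)) in *.
  (* At a zero of the denominator both quotients are 0, as the inverse of 0 is 0 by convention; so
     the period holds for every u. *)
  destruct (Ceq_dec (Phi u z) 0) as [E0|E0]; [|field; auto].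
  rewrite E0, Cmult_0_r. unfold Cdiv.
  replace (/ 0) with (RtoC 0); [ring|]. unfold Cinv, RtoC; simpl. f_equal; unfold Rdiv; ring.
Qed.

Lemma eq_of_Cmod_small (a b : C) :
  (forall eps : R, 0 < eps -> Cmod (a - b) < eps) -> a = b.
Proof.
  intros H. apply Ceq_minus, Cmod_eq_0.
  destruct (Cmod_ge_0 (a - b)) as [Hp | Hp]; [|easy].
  specialize (H _ Hp); lra.
Qed.

Lemma cder_unique f z a b : cder f z a -> cder f z b -> a = b.
Proof.
  rewrite !cder_eps. intros Ha Hb. apply eq_of_Cmod_small. intros eps He.
  destruct (Ha (eps / 4)%R ltac:(lra)) as [d1 [Hd1 H1]].
  destruct (Hb (eps / 4)%R ltac:(lra)) as [d2 [Hd2 H2]].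
  set (d := (Rmin d1 d2 / 2)%R).
  assert (Hm : 0 < Rmin d1 d2) by now apply Rmin_pos.
  assert (Hd : Cmod d = d) by (rewrite Cmod_R; apply Rabs_pos_eq; unfold d; lra).
  specialize (H1 d). specialize (H2 d). rewrite Hd in H1, H2.
  pose proof (Rmin_l d1 d2). pose proof (Rmin_r d1 d2).
  specialize (H1 ltac:(unfold d; lra)). specialize (H2 ltac:(unfold d; lra)).
  assert (H3 : Cmod ((a - b) * d) <= eps / 2 * d).
  { replace ((a - b) * d) with ((f (z + d) - f z - b * d) - (f (z + d) - f z - a * d)) by ring.
    eapply Rle_trans; [apply Cmod_minus_le|]. lra. }
  rewrite Cmod_mult, Hd in H3. apply Rmult_le_reg_r in H3; [lra|unfold d; lra].
Qed.

Lemma strip_open z u : strip z u ->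
  exists r : R, 0 < r /\ forall y, Cmod (y - u) < r -> strip z y.
Proof.
  unfold strip. intros Hu. exists (Rmin (Im u) (Im z - Im u)). split.
  { apply Rmin_pos; lra. }
  intros y Hy. pose proof (Rmin_l (Im u) (Im z - Im u)). pose proof (Rmin_r (Im u) (Im z - Im u)).
  pose proof (im_le_Cmod (y - u)) as H1. unfold Cminus in H1.
  rewrite im_plus, im_opp in H1.
  pose proof (Rle_abs (Im y + - Im u)). pose proof (Rle_abs (- (Im y + - Im u))).
  rewrite Rabs_Ropp in *. unfold Cminus in Hy. lra.
Qed.

Lemma strip_half z : upper z -> strip z (z / 2).
Proof.
  intros Hz. unfold strip, upper in *. replace (z / 2) with (RtoC (/ 2) * z).
  - rewrite im_scal_l. lra.
  - rewrite RtoC_inv by lra. field.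
Qed.

(** Comparing derivatives at one interior point. It turns a periodicity of exp(polynomial) into the
    vanishing of a coefficient. *)
Lemma ee_affine_one z a k : upper z -> (forall u, strip z u -> ee (a * u + k) = 1) -> a = 0.
Proof.
  intros Hz H. set (u := z / 2). assert (Hu := strip_half z Hz).
  destruct (strip_open z u Hu) as [r [Hr Hop]].
  assert (H1 : cder (fun y => ee (a * y + k)) u (tpi * ee (a * u + k) * (a * 1 + 0))).
  { apply (cder_ee_comp (fun y => a * y + k)).
    apply (cder_plus (fun y => a * y)); [apply cder_scal, cder_id|apply cder_const]. }
  assert (H2 : cder (fun y => ee (a * y + k)) u 0).
  { apply cder_ext_loc with (fun _ => RtoC 1) r; [easy| |apply cder_const].
    intros y Hy. symmetry. apply H. now apply Hop. }
  assert (E := cder_unique _ _ _ _ H1 H2). rewrite (H u Hu) in E.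
  pose proof tpi_neq_0.
  replace a with (/ tpi * (tpi * 1 * (a * 1 + 0))) by (field; easy). rewrite E. ring.
Qed.

Lemma Squot_opp z u : Squot z (- u) = Squot z u.
Proof.
  unfold Squot. replace (- u / z) with (- (u / z)) by (unfold Cdiv; ring).
  rewrite !Phi_opp. replace (- u * - u) with (u * u) by ring.
  unfold Cdiv. rewrite Cinv_opp. ring.
Qed.

Lemma Squot_neq_0 z u : upper z -> nonlat u z -> Squot z u <> 0.
Proof.
  intros Hz Hu. unfold Squot. pose proof (Phi_neq_0 u z Hz Hu) as H.
  apply Cmult_neq_0.
  - apply Cmult_neq_0; [|apply ee_neq_0]. apply Cmult_neq_0; [now apply upper_neq_0|].
    apply Phi_neq_0; [now apply upper_S|now apply nonlat_S].
  - intros E. apply C1_nz. rewrite <- (Cinv_r _ H), E. ring.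
Qed.

(** On the strip the ratio is a constant times [ee] of the quadratic Q(u) = c u^2/2 + b u. Period 1
    gives c = 0. It would then only make b an integer, so evenness is used, together with period z,
    to get b = 0. *)
Lemma Squot_strip_const z : upper z -> exists A, forall u, strip z u -> Squot z u = A.
Proof.
  intros Hz. set (u0 := z / 2). assert (Hu0 := strip_half z Hz). fold u0 in Hu0.
  assert (Hconv := strip_convex z).
  set (c := Sdef2 z u0).
  assert (Hc : forall u, strip z u -> Sdef2 z u = c).
  { intros u Hu. apply (cder_zero_const (strip z)); auto.
    intros y Hy. apply Sdef2_cder; [easy|now apply strip_nonlat]. }
  set (b := Sdef1 z u0 - c * u0).
  assert (Hb : forall u, strip z u -> Sdef1 z u = c * u + b).
  { intros u Hu. assert (E : Sdef1 z u - c * u = b).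
    { apply (cder_zero_const (strip z) (fun u => Sdef1 z u - c * u)); auto.
      intros y Hy. apply cder_eq with (Sdef2 z y - c * 1); [rewrite Hc by easy; ring|].
      apply cder_minus; [apply Sdef1_cder; [easy|now apply strip_nonlat]|apply cder_scal, cder_id]. }
    rewrite <- E. ring. }
  set (Q := fun u => c * (u * u / 2) + b * u).
  assert (HQ : forall u, cder Q u (c * u + b)).
  { intros u. unfold Q. apply cder_ext with (fun u => c / 2 * (u * u) + b * u); [intros; field|].
    apply cder_eq with (c / 2 * (1 * u + u * 1) + b * 1); [field|].
    apply cder_plus; [apply cder_scal, (cder_mult (fun y => y) (fun y => y)); apply cder_id|
      apply cder_scal, cder_id]. }
  set (A := Squot z u0 / ee (Q u0)).
  assert (HA : forall u, strip z u -> Squot z u = A * ee (Q u)).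
  { intros u Hu. assert (E : Squot z u / ee (Q u) = A).
    { apply (cder_zero_const (strip z) (fun u => Squot z u / ee (Q u))); auto.
      intros y Hy. pose proof (strip_nonlat z y Hz Hy) as Hn. pose proof (ee_neq_0 (Q y)).
      eapply cder_eq; [|apply cder_div; [easy|now apply Squot_cder|apply cder_ee_comp, HQ]].
      rewrite Hb by easy. field. assumption. }
    rewrite <- E. field. apply ee_neq_0. }
  assert (HA0 : A <> 0).
  { intros E. apply (Squot_neq_0 z u0 Hz); [now apply strip_nonlat|]. rewrite HA, E by easy. ring. }
  assert (Hshift : forall u v, strip z u -> strip z v -> Squot z u = Squot z v ->
    ee (Q u - Q v) = 1).
  { intros u v Hu Hv E. rewrite !HA in E by easy. rewrite ee_minus.
    pose proof (ee_neq_0 (Q v)).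
    replace (ee (Q u)) with (/ A * (A * ee (Q u))) by (field; easy). rewrite E. field. split; assumption. }
  assert (Hstrip1 : forall u, strip z u -> strip z (u + 1)).
  { intros u Hu. unfold strip in *. rewrite im_plus. cbn [Im RtoC snd]. lra. }
  (* The map u -> -u does not preserve the strip, but u -> z - u does. *)
  assert (Hstrip2 : forall u, strip z u -> strip z (- u + z)).
  { intros u Hu. unfold strip in *. rewrite im_plus, im_opp. lra. }
  (* Q(u + 1) - Q(u) = c u + c/2 + b. *)
  assert (Hc0 : c = 0).
  { apply (ee_affine_one z c (c / 2 + b) Hz). intros u Hu.
    rewrite <- (Hshift (u + 1) u); auto; [|now apply Squot_plus_1].
    f_equal. unfold Q. field. }
  (* With c = 0, Q(z - u) - Q(u) = -2 b u + b z. *)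
  assert (Hb0 : - (2) * b = 0).
  { apply (ee_affine_one z (- (2) * b) (b * z) Hz). intros u Hu.
    rewrite <- (Hshift (- u + z) u); auto.
    - f_equal. unfold Q. rewrite Hc0. field.
    - rewrite Squot_plus_z by easy. apply Squot_opp. }
  exists A. intros u Hu. rewrite HA by easy.
  assert (Hb1 : b = 0).
  { pose proof C2_nz. replace b with (- / 2 * (- (2) * b)) by (field; easy). rewrite Hb0. ring. }
  unfold Q. rewrite Hc0, Hb1. replace (0 * (u * u / 2) + 0 * u) with (RtoC 0) by field.
  rewrite ee_0. ring.
Qed.

(** The division by [qprod 0 z]^2 normalises the slope at 0 to a number independent of z; this makes
    the constant in the transformation law equal to 1. *)
Lemma Phi_quotient_lim z (w : nat -> C) : upper z -> ccv w 0 -> (forall n, w n <> 0) ->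
  ccv (fun n => Phi (w n) z / w n) tpi.
Proof.
  intros Hz Hw Hn. pose proof (qprod_0_neq_0 z Hz) as HP.
  destruct (cder_qprod_ex 0 z Hz) as [l [Hl _]].
  assert (H1 := cder_ccv _ _ _ _ Hl Hw).
  assert (Hw' : ccv (fun n => - w n) 0).
  { replace (RtoC 0) with (- (1) * 0) by ring.
    eapply ccv_ext; [|apply (ccv_scal (- (1)) _ _ Hw)]. intros; cbv beta; ring. }
  assert (H2 := cder_ccv _ _ _ _ Hl Hw').
  assert (Hh : ccv (fun n => - (w n / 2)) 0).
  { replace (RtoC 0) with (- (/ 2) * 0) by ring.
    eapply ccv_ext; [|apply (ccv_scal (- (/ 2)) _ _ Hw)]. intros; cbv beta; unfold Cdiv; ring. }
  assert (H3 := cder_ccv _ _ _ _ (cder_ee 0) Hh).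
  assert (H4 := ccv_ee_quotient w Hw Hn).
  assert (H5 := ccv_mult _ _ _ _ (ccv_mult _ _ _ _ H3 H4)
    (ccv_scal (/ (qprod 0 z * qprod 0 z)) _ _ (ccv_mult _ _ _ _ H1 H2))). cbv beta in H5.
  rewrite ee_0 in H5.
  replace tpi with (1 * tpi * (/ (qprod 0 z * qprod 0 z) * (qprod 0 z * qprod 0 z))) by (field; easy).
  eapply ccv_ext; [|exact H5]. intros n. cbv beta. unfold Phi.
  replace (ee (w n / 2)) with (ee (w n) * ee (- (w n / 2))).
  - field. split; [easy|apply Hn].
  - rewrite <- ee_plus. f_equal. field.
Qed.

Lemma Squot_strip z u : upper z -> strip z u -> Squot z u = 1.
Proof.
  intros Hz Hu. destruct (Squot_strip_const z Hz) as [A HA]. rewrite HA by easy.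
  pose proof (upper_neq_0 z Hz) as Hz0. pose proof (upper_S z Hz) as Hz'.
  (* A sequence inside the strip that tends to 0, along which the constant can be evaluated. *)
  set (w := fun n => (z / 2) / 2 ^ n).
  assert (Hw : ccv w 0) by apply ccv_halving.
  assert (Hws : forall n, strip z (w n)).
  { intros n. unfold w.
    replace (z / 2 / 2 ^ n) with (RtoC (/ 2 / 2 ^ n) * z).
    - unfold strip, upper in *. rewrite im_scal_l.
      assert (1 <= 2 ^ n) by (apply pow_R1_Rle; lra).
      assert (0 < / 2 ^ n <= 1).
      { split; [apply Rinv_0_lt_compat; lra|]. rewrite <- Rinv_1. apply Rinv_le_contravar; lra. }
      unfold Rdiv. split; [apply Rmult_lt_0_compat; [|easy]; lra|nra].
    - rewrite RtoC_div, RtoC_inv, RtoC_pow by (try lra; apply pow_nonzero; lra).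
      field. apply Cpow_nz, C2_nz. }
  assert (Hwn : forall n, nonlat (w n) z) by (intros; apply strip_nonlat; auto).
  assert (Hw0 : forall n, w n <> 0) by (intros n; apply (nonlat_neq_0 _ z), Hwn).
  assert (Hv : ccv (fun n => w n / z) 0).
  { replace (RtoC 0) with (/ z * 0) by ring.
    eapply ccv_ext; [|apply (ccv_scal (/ z) _ _ Hw)]. intros n. unfold Cdiv. ring. }
  assert (Hv0 : forall n, w n / z <> 0).
  { intros n. apply (nonlat_neq_0 _ (- / z)), nonlat_S; auto. }
  assert (H1 := Phi_quotient_lim z w Hz Hw Hw0).
  assert (H2 := Phi_quotient_lim (- / z) _ Hz' Hv Hv0).
  assert (Hsq : ccv (fun n => - (w n * w n / (2 * z))) 0).
  { replace (RtoC 0) with (- / (2 * z) * (0 * 0)) by ring.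
    eapply ccv_ext; [|apply (ccv_scal (- / (2 * z)) _ _ (ccv_mult _ _ _ _ Hw Hw))].
    intros n. cbv beta. unfold Cdiv. ring. }
  assert (H3 := cder_ccv _ _ _ _ (cder_ee 0) Hsq).
  assert (H4 := ccv_mult _ _ _ _ (ccv_mult _ _ _ _ H2 (ccv_inv _ _ tpi_neq_0 H1)) H3).
  cbv beta in H4. rewrite ee_0 in H4.
  replace (tpi * / tpi * 1) with (RtoC 1) in H4 by (field; apply tpi_neq_0).
  apply (ccv_unique (fun _ => A)); [apply ccv_const|].
  eapply ccv_ext; [|exact H4]. intros n. cbv beta. rewrite <- (HA (w n)) by auto.
  unfold Squot. pose proof (Hw0 n). pose proof (Phi_neq_0 (w n) z Hz (Hwn n)).
  field. auto.
Qed.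

Lemma Squot_one z u : upper z -> nonlat u z -> Squot z u = 1.
Proof.
  intros Hz Hu. pose proof (upper_neq_0 z Hz) as Hz0. pose proof C2_nz as H2.
  destruct (fundamental_domain z u Hz) as [m [n [a [b [Ha [Hb E]]]]]].
  assert (Hn := nonlat_shift u z m n Hu). rewrite E in Hn.
  assert (Hper : Squot z u = Squot z (a * z + b)).
  { rewrite <- E, <- (Cmult_1_r (IZR n)).
    rewrite (period_Z (Squot z) 1) by (intros; now apply Squot_plus_1).
    symmetry. apply (period_Z (Squot z) z). intros. now apply Squot_plus_z. }
  rewrite Hper. clear Hper E Hu u m n.
  (* For a = 0 the point is a real b, on the boundary of the strip. The result for -1/z at the point
     -b/z, inside the strip of -1/z for 0 < b < 1, is the reciprocal relation. *)
  destruct (Req_dec a 0) as [->|Ha0].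
  - replace (0%R * z + b) with (RtoC b) in * by ring.
    assert (Hb0 : b <> 0%R).
    { intros ->. rewrite nonlat_iff in Hn. apply (Hn 0%Z 0%Z). ring. }
    pose proof (upper_S z Hz) as Hz'. pose proof (upper_neq_0 _ Hz') as Hz'0.
    assert (Hs : strip (- / z) (b * - / z)).
    { unfold strip, upper in *. rewrite im_scal_l. nra. }
    assert (HR := Squot_strip _ _ Hz' Hs).
    assert (Hnb := Phi_neq_0 _ _ Hz' (strip_nonlat _ _ Hz' Hs)).
    unfold Squot in HR |- *.
    replace (- / - / z) with z in HR by (field; easy).
    replace (b * - / z / - / z) with (RtoC b) in HR by (field; easy).
    replace (b * - / z) with (- (b / z)) in HR, Hnb by (field; easy).
    rewrite Phi_opp in HR, Hnb.
    replace (- (- (b / z) * - (b / z) / (2 * - / z))) with (b * b / (2 * z)) in HR by (field; auto).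
    pose proof (Phi_neq_0 b z Hz Hn) as Hb1. rewrite ee_opp.
    pose proof (ee_neq_0 (b * b / (2 * z))) as He.
    set (P := Phi (b / z) (- / z)) in *. set (P' := Phi b z) in *.
    set (e := ee (b * b / (2 * z))) in *.
    assert (HP : P <> 0). { intros EP. apply Hnb. rewrite EP. ring. }
    assert (HE : P' * e = z * P).
    { replace (P' * e) with (z * P * (- / z * P' * e / - P)) by (field; auto).
      rewrite HR. ring. }
    replace (z * P) with (P' * e) by easy. field. auto.
  - apply Squot_strip; [easy|]. unfold strip, upper in *.
    rewrite im_plus, im_scal_l. cbn [Im RtoC snd]. nra.
Qed.

Lemma Phi_S z u : upper z ->
  Phi (u / z) (- / z) = / z * ee (u * u / (2 * z)) * Phi u z.
Proof.
  intros Hz. pose proof (upper_neq_0 z Hz) as Hz0. pose proof (upper_S z Hz) as Hz'.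
  destruct (classic (nonlat u z)) as [Hn|Hn].
  - assert (HR := Squot_one z u Hz Hn). unfold Squot in HR. rewrite ee_opp in HR.
    pose proof (ee_neq_0 (u * u / (2 * z))). pose proof (Phi_neq_0 u z Hz Hn).
    set (e := ee (u * u / (2 * z))) in *. set (P := Phi (u / z) (- / z)) in *.
    replace P with (/ z * e * Phi u z * (z * P * / e / Phi u z)) by (field; auto).
    rewrite HR. ring.
  - rewrite nonlat_iff in Hn. apply not_all_ex_not in Hn as [m Hn].
    apply not_all_ex_not in Hn as [n Hn]. apply NNPP in Hn. subst u.
    rewrite Phi_lattice by easy.
    replace ((IZR m * z + IZR n) / z) with (IZR (- n) * (- / z) + IZR m)
      by (rewrite opp_IZR, RtoC_opp; field; easy).
    rewrite Phi_lattice by easy. ring.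
Qed.

(** * The transformation law under SL2(Z) *)

(** Stability of the upper half-plane is carried along, since each step of the induction over
    generators needs it to apply the law again. *)
Definition Phi_law (a b c d : Z) : Prop := forall z, upper z ->
  upper (mobius a b c d z) /\
  forall u, Phi (u / automorphy c d z) (mobius a b c d z) =
    / automorphy c d z * ee (IZR c * (u * u) / (2 * automorphy c d z)) * Phi u z.

Lemma automorphy_neq_0 (a b c d : Z) z :
  in_SL2Z a b c d -> upper z -> automorphy c d z <> 0.
Proof.
  intros Hs Hz E. unfold automorphy in E. unfold in_SL2Z in Hs.
  assert (Hc : c = 0%Z).
  { apply (f_equal Im) in E. rewrite im_plus, im_scal_l in E. cbn [Im RtoC snd] in E.
    rewrite Rplus_0_r in E. unfold upper in Hz. apply eq_IZR.
    destruct (Rmult_integral _ _ E); [easy|lra]. }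
  subst c. assert (Hd : d = 0%Z).
  { apply eq_IZR, RtoC_inj. rewrite <- E. ring. }
  subst d. lia.
Qed.

Lemma im_RtoC (r : R) : Im (RtoC r) = 0%R.
Proof. easy. Qed.

Lemma qprod_plus_IZR_tau u z (k : Z) : qprod u (z + IZR k) = qprod u z.
Proof.
  apply inf_prod_ext. intros n. unfold qfac.
  replace (INR (S n) * (z + IZR k) + u) with (INR (S n) * z + u + IZR (Z.of_nat (S n) * k)).
  - now rewrite ee_plus_IZR.
  - rewrite mult_IZR, <- INR_IZR_INZ, RtoC_mult. ring.
Qed.

Lemma Phi_plus_IZR_tau u z (k : Z) : Phi u (z + IZR k) = Phi u z.
Proof. unfold Phi. now rewrite !qprod_plus_IZR_tau. Qed.

Lemma mobius_T (a b c d k : Z) z : in_SL2Z a b c d -> upper z ->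
  mobius (a + k * c) (b + k * d) c d z = mobius a b c d z + IZR k.
Proof.
  intros Hs Hz. pose proof (automorphy_neq_0 a b c d z Hs Hz) as Hj.
  unfold mobius, automorphy in *. rewrite !plus_IZR, !mult_IZR, !RtoC_plus, !RtoC_mult.
  field. easy.
Qed.

Lemma mobius_S (a b c d : Z) z : in_SL2Z a b c d -> upper z ->
  mobius (- c) (- d) a b z = - / mobius a b c d z.
Proof.
  intros Hs Hz. pose proof (automorphy_neq_0 a b c d z Hs Hz) as Hj.
  assert (Hs' : in_SL2Z (- c) (- d) a b) by (unfold in_SL2Z in *; lia).
  pose proof (automorphy_neq_0 _ _ _ _ z Hs' Hz) as Hj'.
  unfold mobius, automorphy in *. rewrite !opp_IZR, !RtoC_opp. field. auto.
Qed.

Lemma Phi_law_T (a b c d k : Z) : in_SL2Z a b c d ->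
  Phi_law a b c d -> Phi_law (a + k * c) (b + k * d) c d.
Proof.
  intros Hs H z Hz. destruct (H z Hz) as [Hu HP].
  pose proof (automorphy_neq_0 a b c d z Hs Hz) as Hj.
  rewrite mobius_T by easy. split.
  - unfold upper in *. rewrite im_plus, im_RtoC. lra.
  - intros u. rewrite Phi_plus_IZR_tau. apply HP.
Qed.

Lemma Phi_law_S (a b c d : Z) : in_SL2Z a b c d ->
  Phi_law a b c d -> Phi_law (- c) (- d) a b.
Proof.
  intros Hs H z Hz. destruct (H z Hz) as [Hu HP].
  pose proof (automorphy_neq_0 a b c d z Hs Hz) as Hj.
  assert (Hs' : in_SL2Z (- c) (- d) a b) by (unfold in_SL2Z in *; lia).
  pose proof (automorphy_neq_0 _ _ _ _ z Hs' Hz) as Hj'.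
  assert (Ew : mobius a b c d z = automorphy a b z / automorphy c d z) by easy.
  rewrite mobius_S by easy. split; [now apply upper_S|].
  intros u. pose proof C2_nz.
  set (j := automorphy c d z) in *. set (j' := automorphy a b z) in *.
  replace (u / j') with (u / j / mobius a b c d z) by (rewrite Ew; field; auto).
  rewrite Phi_S, HP by easy. rewrite Ew.
  replace (IZR a * (u * u) / (2 * j')) with
    (u / j * (u / j) / (2 * (j' / j)) + IZR c * (u * u) / (2 * j)).
  - rewrite ee_plus. field. auto.
  (* The two Gaussian exponents combine by the determinant condition, in the form a j = 1 + c j'. *)
  - assert (Hdet : IZR a * j = 1 + IZR c * j').
    { unfold j, j', automorphy. unfold in_SL2Z in Hs.
      apply (f_equal IZR) in Hs. rewrite minus_IZR, !mult_IZR in Hs.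
      apply (f_equal RtoC) in Hs. rewrite RtoC_minus, !RtoC_mult in Hs.
      rewrite <- Hs. ring. }
    transitivity ((1 + IZR c * j') * (u * u) / (2 * j * j')); [field; auto|].
    rewrite <- Hdet. field. auto.
Qed.

(* [SL2(Z)] is generated by [S] and [T]: Euclid's algorithm on the first column. *)
Lemma SL2Z_ind (P : Z -> Z -> Z -> Z -> Prop) :
  P 1%Z 0%Z 0%Z 1%Z ->
  (forall a b c d k, in_SL2Z a b c d -> P a b c d -> P (a + k * c)%Z (b + k * d)%Z c d) ->
  (forall a b c d, in_SL2Z a b c d -> P a b c d -> P (- c)%Z (- d)%Z a b) ->
  forall a b c d, in_SL2Z a b c d -> P a b c d.
Proof.
  intros HI HT HS a b c d.
  remember (Z.to_nat (Z.abs c)) as n eqn:Hn.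
  revert a b c d Hn. induction n as [n IH] using lt_wf_ind. intros a b c d Hn Hs.
  destruct (Z.eq_dec c 0) as [->|Hc].
  - unfold in_SL2Z in Hs. destruct (Z.eq_mul_1 d a) as [-> | ->]; [lia| |].
    + assert (H := HT 1%Z 0%Z 0%Z 1%Z b eq_refl HI).
      replace a with (1 + b * 0)%Z by lia. now replace b with (0 + b * 1)%Z at 2 by lia.
    (* Minus the identity is S applied twice. *)
    + assert (H := HS 0%Z (-1)%Z 1%Z 0%Z eq_refl (HS 1%Z 0%Z 0%Z 1%Z eq_refl HI)).
      apply (HT (-1)%Z 0%Z 0%Z (-1)%Z (- b)%Z eq_refl) in H.
      replace a with (-1 + - b * 0)%Z by lia. now replace b with (0 + - b * -1)%Z at 2 by lia.
  - set (k := (a / c)%Z). set (a' := (a mod c)%Z).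
    assert (Ha : (a = a' + k * c)%Z) by (unfold a', k; rewrite (Z.div_mod a c) at 1 by easy; lia).
    assert (Hlt : (Z.abs a' < Z.abs c)%Z)
      by (unfold a'; pose proof (Z.mod_pos_bound a c); pose proof (Z.mod_neg_bound a c); lia).
    set (b' := (b - k * d)%Z).
    assert (Hs' : in_SL2Z a' b' c d) by (unfold in_SL2Z, b' in *; nia).
    replace b with (b' + k * d)%Z by (unfold b'; lia). rewrite Ha.
    apply HT; [easy|].
    (* The reduced matrix is S applied to one whose lower left entry is -a', of smaller absolute
       value than c. *)
    replace a' with (- - a')%Z by lia. replace b' with (- - b')%Z by lia.
    apply HS; [unfold in_SL2Z in *; lia|].
    apply (IH (Z.to_nat (Z.abs (- a')))); [lia|easy|unfold in_SL2Z in *; lia].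
Qed.

Lemma mobius_id z : mobius 1 0 0 1 z = z.
Proof. unfold mobius. field. Qed.

Lemma Phi_SL2Z (a b c d : Z) : in_SL2Z a b c d -> Phi_law a b c d.
Proof.
  apply (SL2Z_ind Phi_law); auto using Phi_law_T, Phi_law_S.
  intros z Hz. rewrite mobius_id. split; [easy|]. intros u.
  replace (automorphy 0 1 z) with (RtoC 1) by (unfold automorphy; ring).
  replace (0%R * (u * u) / (2 * 1)) with (RtoC 0) by field.
  replace (u / 1) with u by field. rewrite ee_0. field.
Qed.

(** * Products over torsion points *)

(* The monic polynomial whose lower coefficients, in increasing degree, are listed in [l]. *)
Fixpoint monic_eval (l : list C) (x : C) : C :=
  match l with nil => 1 | cons a l => a + x * monic_eval l x end.

Definition root_prod (rs : list C) (x : C) : C :=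
  fold_right (fun r acc => (x - r) * acc) 1 rs.

Lemma monic_eval_factor (l : list C) (a r : C) :
  exists l', length l' = length l /\
  forall x, monic_eval (a :: l) x = monic_eval (a :: l) r + (x - r) * monic_eval l' x.
Proof.
  revert a. induction l as [|b l IH]; intros a.
  - exists nil. split; [easy|]. intros x. simpl. ring.
  - destruct (IH b) as [l' [Hl' H]].
    exists (monic_eval (b :: l) r :: l'). split; [simpl; now rewrite Hl'|].
    intros x. change (monic_eval (a :: b :: l) x) with (a + x * monic_eval (b :: l) x).
    change (monic_eval (a :: b :: l) r) with (a + r * monic_eval (b :: l) r).
    change (monic_eval (monic_eval (b :: l) r :: l') x) with (monic_eval (b :: l) r + x * monic_eval l' x).
    rewrite (H x). ring.
Qed.

Lemma monic_eval_root_prod (rs : list C) : NoDup rs -> forall l, length l = length rs ->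
  (forall r, In r rs -> monic_eval l r = 0) -> forall x, monic_eval l x = root_prod rs x.
Proof.
  induction rs as [|r rs IH]; intros Hnd l Hlen Hr x.
  - destruct l; [easy|discriminate].
  - destruct l as [|a l]; [discriminate|]. inversion Hnd as [|? ? Hnotin Hnd']. subst.
    destruct (monic_eval_factor l a r) as [l' [Hl' Hf]].
    rewrite (Hr r) in Hf by now left.
    rewrite Hf. cbn [root_prod fold_right]. rewrite Cplus_0_l. f_equal.
    apply IH; [easy|simpl in Hlen; lia|].
    intros s Hs. assert (E := Hr s (or_intror Hs)). rewrite Hf, Cplus_0_l in E.
    assert (Hsr : s - r <> 0). { apply Cminus_neq_0. intros ->. easy. }
    replace (monic_eval l' s) with (/ (s - r) * ((s - r) * monic_eval l' s)) by (field; easy).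
    rewrite E. ring.
Qed.

Lemma monic_eval_zeros n x : monic_eval (repeat (RtoC 0) n) x = x ^ n.
Proof. induction n as [|n IH]; simpl; [easy|]. rewrite IH. ring. Qed.

(** Residues modulo 2M + 1 in an order that exposes the pairs k, -k, matching [qprod u] and
    [qprod (- u)] in [Phi]. *)
Fixpoint sym_list (M : nat) : list Z :=
  match M with
  | O => [0%Z]
  | S m => Z.of_nat (S m) :: (- Z.of_nat (S m))%Z :: sym_list m
  end.

Lemma sym_list_bound M i : In i (sym_list M) -> (Z.abs i <= Z.of_nat M)%Z.
Proof.
  induction M as [|M IH]; cbn [sym_list].
  - intros [<-|[]]. lia.
  - intros [<-|[<-|H]]; [lia|lia|]. specialize (IH H). lia.
Qed.

Lemma sym_list_NoDup M : NoDup (sym_list M).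
Proof.
  induction M as [|M IH]; cbn [sym_list].
  - constructor; [easy|constructor].
  - constructor; [|constructor; [|easy]].
    + intros [H|H]; [lia|]. apply sym_list_bound in H. lia.
    + intros H. apply sym_list_bound in H. lia.
Qed.

Lemma sym_list_length M : length (sym_list M) = (2 * M + 1)%nat.
Proof. induction M as [|M IH]; cbn [sym_list length]; [easy|]. rewrite IH. lia. Qed.

Lemma INR_C_neq_0 (n : nat) : n <> 0%nat -> RtoC (INR n) <> 0.
Proof. intros H E. apply RtoC_inj in E. now apply (not_0_INR n). Qed.

(** Factorisation of 1 - y^N over the N-th roots of unity, N = 2M + 1, with the roots grouped in
    conjugate pairs. *)
Lemma root_of_unity_prod (M : nat) (y : C) :
  (1 - y) * partial_prod (fun k =>
     (1 - ee (INR (S k) / INR (2 * M + 1)) * y) *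
     (1 - ee (- (INR (S k) / INR (2 * M + 1))) * y)) M = 1 - y ^ (2 * M + 1).
Proof.
  set (N := (2 * M + 1)%nat). set (rt := fun i : Z => ee (IZR i / INR N)).
  assert (HN0 : RtoC (INR N) <> 0) by (apply INR_C_neq_0; unfold N; lia).
  assert (Hpow : forall i, rt i ^ N = 1).
  { intros i. unfold rt. rewrite <- ee_nat.
    replace (INR N * (IZR i / INR N)) with (RtoC (IZR i)) by (field; easy). apply ee_IZR. }
  (* Indices of absolute value below N/2 differ by less than N, so the roots are distinct. *)
  assert (Hnd : forall L, NoDup L -> (forall i, In i L -> (2 * Z.abs i < Z.of_nat N)%Z) ->
    NoDup (map rt L)).
  { induction L as [|i L IH]; intros HL HB; [constructor|].
    inversion HL as [|? ? Hi HL']. subst. simpl. constructor.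
    - intros Hin. apply in_map_iff in Hin as [j [Ej Hj]].
      assert (i <> j) by (intros ->; easy).
      assert (Hd : ee ((IZR (i - j)) / INR N) = 1).
      { rewrite minus_IZR, RtoC_minus.
        replace ((IZR i - IZR j) / INR N) with (IZR i / INR N - IZR j / INR N) by (field; easy).
        rewrite ee_minus. unfold rt in Ej. rewrite Ej. field. apply ee_neq_0. }
      destruct (ee_eq_1 _ Hd) as [m Hm].
      assert (Hm' : (i - j = m * Z.of_nat N)%Z).
      { apply eq_IZR, RtoC_inj. rewrite mult_IZR, RtoC_mult, <- Hm, IZR_nat_C. field. easy. }
      assert (H1 := HB i (or_introl eq_refl)). assert (H2 := HB j (or_intror Hj)).
      assert (m <> 0%Z) by lia. nia.
    - apply IH; [easy|]. intros k Hk. apply HB. now right. }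
  assert (Hfac : forall x, x ^ N - 1 = root_prod (map rt (sym_list M)) x).
  { intros x. rewrite <- (monic_eval_root_prod (map rt (sym_list M)))
      with (l := - (1) :: repeat (RtoC 0) (2 * M)).
    - cbn [monic_eval]. rewrite monic_eval_zeros. unfold N. rewrite Nat.add_1_r, Cpow_S. ring.
    - apply Hnd; [apply sym_list_NoDup|]. intros i Hi. apply sym_list_bound in Hi. unfold N. lia.
    - rewrite length_map, sym_list_length. simpl. rewrite repeat_length. lia.
    - intros r Hr. apply in_map_iff in Hr as [i [<- _]].
      cbn [monic_eval]. rewrite monic_eval_zeros, <- Cpow_S.
      replace (S (2 * M)) with N by (unfold N; lia). rewrite Hpow. ring. }
  assert (Hsplit : forall m x, root_prod (map rt (sym_list m)) x =
    (x - 1) * partial_prod (fun k => (x - ee (INR (S k) / INR N)) * (x - ee (- (INR (S k) / INR N)))) m).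
  { induction m as [|m IH]; intros x.
    - simpl. unfold rt. replace (0%R / INR N) with (RtoC 0) by (field; easy). rewrite ee_0. ring.
    - cbn [sym_list map partial_prod]. unfold root_prod. cbn [fold_right].
      fold (root_prod (map rt (sym_list m)) x). rewrite IH. unfold rt.
      rewrite opp_IZR, RtoC_opp, IZR_nat_C.
      replace (- INR (S m) / INR N) with (- (INR (S m) / INR N)) by (field; easy). ring. }
  (* The factorisation of x^N - 1 is used at x = 1/y. *)
  destruct (Ceq_dec y 0) as [->|Hy].
  - replace (partial_prod _ M) with (partial_prod (fun _ => RtoC 1) M).
    + rewrite partial_prod_one. unfold N. rewrite Nat.add_1_r, Cpow_S. ring.
    + apply partial_prod_ext. intros k _. ring.
  - assert (E := Hfac (/ y)). rewrite Hsplit in E.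
    assert (Hscale : forall m, y ^ (2 * m) * partial_prod (fun k =>
        (/ y - ee (INR (S k) / INR N)) * (/ y - ee (- (INR (S k) / INR N)))) m =
      partial_prod (fun k => (1 - ee (INR (S k) / INR N) * y) * (1 - ee (- (INR (S k) / INR N)) * y)) m).
    { induction m as [|m IH]; [simpl; ring|]. cbn [partial_prod]. rewrite <- IH.
      replace (2 * S m)%nat with (2 + 2 * m)%nat by lia. rewrite Cpow_add_r. simpl (y ^ 2). field. easy. }
    rewrite <- Hscale.
    transitivity (y ^ N * ((/ y - 1) * partial_prod (fun k =>
        (/ y - ee (INR (S k) / INR N)) * (/ y - ee (- (INR (S k) / INR N)))) M)).
    + replace (y ^ N) with (y * y ^ (2 * M)) by (unfold N; now rewrite Nat.add_1_r, Cpow_S).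
      field. easy.
    + rewrite <- E, Cpow_inv by easy. field. now apply Cpow_nz.
Qed.

Lemma ccv_partial_prod (s : nat -> nat -> C) (l : nat -> C) M :
  (forall k, ccv (s k) (l k)) ->
  ccv (fun n => partial_prod (fun k => s k n) M) (partial_prod l M).
Proof.
  intros H. induction M as [|M IH]; cbn [partial_prod]; [apply ccv_const|].
  now apply ccv_mult.
Qed.

Lemma partial_prod_exchange (f : nat -> nat -> C) M n :
  partial_prod (fun k => partial_prod (f k) n) M =
  partial_prod (fun j => partial_prod (fun k => f k j) M) n.
Proof.
  induction n as [|n IH]; cbn [partial_prod]; [apply partial_prod_one|].
  now rewrite partial_prod_mult, IH.
Qed.

(** The previous identity at y = q^j, for every j, after exchanging the finite product with the
    product over j. *)
Lemma qprod_torsion_prod (M : nat) z : upper z ->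
  qprod 0 z * partial_prod (fun k => qprod (INR (S k) / INR (2 * M + 1)) z *
     qprod (- (INR (S k) / INR (2 * M + 1))) z) M = qprod 0 (INR (2 * M + 1) * z).
Proof.
  intros Hz. symmetry. apply inf_prod_unique.
  assert (H := ccv_mult _ _ _ _ (qprod_ccv 0 z Hz) (ccv_partial_prod _ _ M (fun k =>
    ccv_mult _ _ _ _ (qprod_ccv (INR (S k) / INR (2 * M + 1)) z Hz)
      (qprod_ccv (- (INR (S k) / INR (2 * M + 1))) z Hz)))).
  eapply ccv_ext; [|exact H]. intros n. cbv beta.
  transitivity (partial_prod (qfac 0 z) n * partial_prod (fun k => partial_prod (fun j =>
    qfac (INR (S k) / INR (2 * M + 1)) z j * qfac (- (INR (S k) / INR (2 * M + 1))) z j) n) M).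
  { f_equal. apply partial_prod_ext. intros k _. now rewrite partial_prod_mult. }
  rewrite partial_prod_exchange, <- partial_prod_mult.
  apply partial_prod_ext. intros j _. unfold qfac.
  rewrite Cplus_0_r.
  replace (ee (INR (S j) * (INR (2 * M + 1) * z) + 0)) with (ee (INR (S j) * z) ^ (2 * M + 1)).
  2:{ rewrite <- ee_nat. f_equal. ring. }
  rewrite <- root_of_unity_prod. f_equal. apply partial_prod_ext. intros k _.
  now rewrite !ee_plus, !(Cmult_comm (ee (INR (S j) * z))).
Qed.

(** Half of the nonzero torsion points suffice, because [Phi u] contains both [qprod u] and
    [qprod (- u)]. With N = 2M + 1 this is a constant times eta(N z) / eta(z)^N, where the
    fractional powers of q cancel. *)
Definition tprod (M : nat) (z : C) : C :=
  partial_prod (fun k => Phi (INR (S k) / INR (2 * M + 1)) z) M.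

Definition tconst (M : nat) : C :=
  partial_prod (fun k => ee (INR (S k) / INR (2 * M + 1) / 2)
     - ee (- (INR (S k) / INR (2 * M + 1) / 2))) M.

Lemma partial_prod_neq_0 (u : nat -> C) n :
  (forall k, (k < n)%nat -> u k <> 0) -> partial_prod u n <> 0.
Proof.
  induction n as [|n IH]; intros H; cbn [partial_prod]; [apply C1_nz|].
  apply Cmult_neq_0; auto.
Qed.

Lemma ee_frac_neq_1 (i : Z) (n : nat) : (0 < i < Z.of_nat n)%Z -> ee (IZR i / INR n) <> 1.
Proof.
  intros Hi E. destruct (ee_eq_1 _ E) as [m Hm].
  assert (H : (i = m * Z.of_nat n)%Z).
  { apply eq_IZR, RtoC_inj. rewrite mult_IZR, RtoC_mult, <- Hm, IZR_nat_C. field.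
    apply INR_C_neq_0. lia. }
  destruct (Z.le_gt_cases m 0); nia.
Qed.

Lemma tconst_neq_0 M : tconst M <> 0.
Proof.
  apply partial_prod_neq_0. intros k Hk. apply half_factor_neq_0.
  rewrite <- IZR_nat_C. apply ee_frac_neq_1. lia.
Qed.

Lemma partial_prod_const (c : C) n : partial_prod (fun _ => c) n = c ^ n.
Proof. induction n as [|n IH]; cbn [partial_prod]; [easy|]. rewrite IH, Cpow_S. ring. Qed.

Lemma tprod_eq M z : upper z ->
  tprod M z * qprod 0 z ^ (2 * M + 1) = tconst M * qprod 0 (INR (2 * M + 1) * z).
Proof.
  intros Hz. rewrite <- qprod_torsion_prod by easy. pose proof (qprod_0_neq_0 z Hz) as H0.
  assert (E : tprod M z * (qprod 0 z * qprod 0 z) ^ M = tconst M * partial_prod (fun k =>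
    qprod (INR (S k) / INR (2 * M + 1)) z * qprod (- (INR (S k) / INR (2 * M + 1))) z) M).
  { unfold tprod, tconst. rewrite <- partial_prod_const, <- !partial_prod_mult.
    apply partial_prod_ext. intros k _. unfold Phi. field. easy. }
  rewrite Cpow_add_r, Cpow_mult_r. simpl (qprod 0 z ^ 1). rewrite Cmult_1_r.
  replace (qprod 0 z ^ 2) with (qprod 0 z * qprod 0 z) by (simpl; ring).
  rewrite Cmult_assoc, E. ring.
Qed.

(** * The discriminant *)

(** The 24th power of [eta]; this form has an integral power of q and no root to choose. *)
Definition Delta (z : C) : C := ee z * qprod 0 z ^ 24.

Definition hprod (z : C) : C := Phi (/ 2) z * Phi (z / 2) z * Phi ((z + 1) / 2) z.

(* Euler: [prod (1 + q^n) (1 - q^(2n-1)) = 1]. *)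
Lemma qprod_half_prod z : upper z -> qprod (/ 2) z * (qprod (- (z / 2)) z * qprod (- ((z + 1) / 2)) z) = 1.
Proof.
  intros Hz. pose proof (qprod_0_neq_0 z Hz) as H0.
  assert (E : qprod 0 z * (qprod (/ 2) z * (qprod (- (z / 2)) z * qprod (- ((z + 1) / 2)) z)) = qprod 0 z).
  { apply (ccv_unique (fun n => partial_prod (qfac 0 z) (2 * n))).
    2:{ apply (ccv_subseq _ _ (fun n => 2 * n)%nat); [intros n; cbv beta; lia|now apply qprod_ccv]. }
    eapply ccv_ext; [|exact (ccv_mult _ _ _ _ (qprod_ccv 0 z Hz) (ccv_mult _ _ _ _ (qprod_ccv (/ 2) z Hz)
      (ccv_mult _ _ _ _ (qprod_ccv (- (z / 2)) z Hz) (qprod_ccv (- ((z + 1) / 2)) z Hz))))].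
    intros n. cbv beta. induction n as [|n IH]; [cbn; ring|].
    replace (2 * S n)%nat with (S (S (2 * n))) by lia. cbn [partial_prod].
    rewrite <- IH. unfold qfac.
    set (a := ee (INR (S n) * z)). set (h := ee (z / 2)).
    pose proof (ee_neq_0 (z / 2)) as Hh. fold h in Hh.
    assert (E1 : ee (INR (S n) * z + 0) = a) by (now rewrite Cplus_0_r).
    assert (E2 : ee (INR (S n) * z + / 2) = - a) by (rewrite ee_plus, ee_half; unfold a; ring).
    assert (E3 : ee (INR (S n) * z + - (z / 2)) = a / h) by (now rewrite ee_plus, ee_opp).
    assert (E4 : ee (INR (S n) * z + - ((z + 1) / 2)) = - (a / h)).
    { replace (INR (S n) * z + - ((z + 1) / 2)) with (INR (S n) * z + - (z / 2) - / 2) by field.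
      rewrite ee_minus, E3, ee_half. field. easy. }
    assert (E5 : ee (INR (S (S (2 * n))) * z + 0) = a * a).
    { unfold a. rewrite <- ee_plus. f_equal. rewrite !S_INR, mult_INR. simpl (INR 2).
      rewrite !RtoC_plus, RtoC_mult, RtoC_plus. ring. }
    assert (E6 : ee (INR (S (2 * n)) * z + 0) = (a / h) * (a / h)).
    { unfold a, h. unfold Cdiv. rewrite <- !ee_opp, <- !ee_plus. f_equal.
      rewrite !S_INR, mult_INR. simpl (INR 2).
      rewrite !RtoC_plus, RtoC_mult, RtoC_plus. field. }
    rewrite E1, E2, E3, E4, E5, E6. ring. }
  replace (qprod (/ 2) z * (qprod (- (z / 2)) z * qprod (- ((z + 1) / 2)) z)) with
    (/ qprod 0 z * (qprod 0 z * (qprod (/ 2) z * (qprod (- (z / 2)) z * qprod (- ((z + 1) / 2)) z)))) by (field; easy).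
  rewrite E. field. easy.
Qed.

(** At each half period the products at u and -u agree up to the sine factor, so the three products
    of the preceding identity occur twice and disappear. *)
Lemma hprod_eq z : upper z ->
  hprod z * qprod 0 z ^ 6 = (ee (/ 4) - ee (- / 4)) * ee (- / 4) * ee (- (z / 2)).
Proof.
  intros Hz. pose proof (qprod_0_neq_0 z Hz) as H0.
  assert (W := qprod_half_prod z Hz).
  assert (S1 : qprod (- (z / 2)) z = (1 - ee (z / 2)) * qprod (z / 2) z).
  { rewrite qprod_shift by easy. now replace (- (z / 2) + z) with (z / 2) by field. }
  assert (S2 : qprod (- ((z + 1) / 2)) z = (1 - ee ((z + 1) / 2)) * qprod ((z + 1) / 2) z).
  { rewrite qprod_shift by easy.
    replace (- ((z + 1) / 2) + z) with ((z + 1) / 2 - 1) by field.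
    rewrite qprod_minus_1, ee_minus, ee_1. now replace (ee ((z + 1) / 2) / 1) with (ee ((z + 1) / 2)) by field. }
  assert (S3 : qprod (- / 2) z = qprod (/ 2) z).
  { replace (- / 2) with (/ 2 - 1) by field. apply qprod_minus_1. }
  assert (F : forall u, ee (u / 2) - ee (- (u / 2)) = - ee (- (u / 2)) * (1 - ee u)).
  { intros u. replace (ee (u / 2)) with (ee (- (u / 2)) * ee u); [ring|].
    rewrite <- ee_plus. f_equal. field. }
  unfold hprod, Phi. rewrite S3, (F (z / 2)), (F ((z + 1) / 2)).
  replace (/ 2 / 2) with (/ 4) by field.
  replace (ee (- (z / 2))) with (ee (- (z / 2 / 2)) * ee (- (z / 2 / 2)))
    by (rewrite <- ee_plus; f_equal; field).
  replace (ee (- ((z + 1) / 2 / 2))) with (ee (- (z / 2 / 2)) * ee (- / 4))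
    by (rewrite <- ee_plus; f_equal; field).
  transitivity ((ee (/ 4) - ee (- / 4)) * ee (- / 4) * (ee (- (z / 2 / 2)) * ee (- (z / 2 / 2))) *
    (qprod (/ 2) z * (qprod (- (z / 2)) z * qprod (- ((z + 1) / 2)) z)) *
    (qprod (/ 2) z * (qprod (- (z / 2)) z * qprod (- ((z + 1) / 2)) z))).
  - rewrite S1, S2. simpl (qprod 0 z ^ 6). field. easy.
  - rewrite W. ring.
Qed.

Definition hconst : C := ((ee (/ 4) - ee (- / 4)) * ee (- / 4)) ^ 4.

(** Expresses the discriminant through values of [Phi], so that its transformation law is inherited
    from that of [Phi]. *)
Lemma Delta_hprod z : upper z -> Delta z * hprod z ^ 4 = hconst * ee (- z).
Proof.
  intros Hz. unfold Delta.
  replace (qprod 0 z ^ 24) with ((qprod 0 z ^ 6) ^ 4) by (now rewrite <- Cpow_mult_r).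
  transitivity (ee z * (hprod z * qprod 0 z ^ 6) ^ 4). { rewrite Cpow_mult_l. ring. }
  rewrite hprod_eq, Cpow_mult_l by easy. fold hconst.
  rewrite <- ee_nat. replace (ee (- z)) with (ee z * ee (INR 4 * - (z / 2))); [ring|].
  rewrite <- ee_plus. f_equal. replace (INR 4) with 4%R by (simpl; lra). field.
Qed.

Lemma ee_quarter_pow : ee (/ 4) ^ 4 = 1.
Proof.
  rewrite <- ee_nat. replace (INR 4 * / 4) with (RtoC 1); [apply ee_1|].
  replace (INR 4) with 4%R by (simpl; lra). field.
Qed.

(** The map z -> -1/z exchanges the half periods 1/2 and z/2 and fixes (z + 1)/2, up to sign and
    periods. The fourth power removes the sign and the stray factor [ee (/ 4)]. *)
Lemma hprod_S z : upper z -> z ^ 12 * hprod (- / z) ^ 4 = ee (z + / z) * hprod z ^ 4.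
Proof.
  intros Hz. pose proof (upper_neq_0 z Hz) as Hz0. pose proof C2_nz.
  assert (P1 : z * Phi (/ 2) (- / z) = ee (z / 8) * Phi (z / 2) z).
  { replace (/ 2) with (z / 2 / z) by (field; auto). rewrite Phi_S by easy.
    replace (z / 2 * (z / 2) / (2 * z)) with (z / 8) by (field; auto). field. easy. }
  assert (P2 : z * Phi (- / z / 2) (- / z) = - (ee (/ z / 8) * Phi (/ 2) z)).
  { replace (- / z / 2) with (- (/ 2 / z)) by (field; auto). rewrite Phi_opp, Phi_S by easy.
    replace (/ 2 * / 2 / (2 * z)) with (/ z / 8) by (field; auto). field. easy. }
  assert (P3 : z * Phi ((- / z + 1) / 2) (- / z) = ee (z / 8 + / 4 + / z / 8) * Phi ((z + 1) / 2) z).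
  { rewrite <- (Copp_opp (Phi ((- / z + 1) / 2) (- / z))), <- Phi_opp, <- Phi_plus_1.
    replace (- ((- / z + 1) / 2) + 1) with ((z + 1) / 2 / z) by (field; auto).
    rewrite Phi_S by easy.
    replace ((z + 1) / 2 * ((z + 1) / 2) / (2 * z)) with (z / 8 + / 4 + / z / 8) by (field; auto).
    field. easy. }
  replace (z ^ 12) with ((z ^ 3) ^ 4) by (now rewrite <- Cpow_mult_r).
  rewrite <- Cpow_mult_l.
  replace (z ^ 3 * hprod (- / z)) with (- (ee (z / 4 + / z / 4) * ee (/ 4) * hprod z)).
  - replace (- (ee (z / 4 + / z / 4) * ee (/ 4) * hprod z)) with
      ((- (1)) * (ee (z / 4 + / z / 4) * ee (/ 4) * hprod z)) by ring.
    rewrite !Cpow_mult_l, ee_quarter_pow, <- ee_nat.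
    replace (INR 4 * (z / 4 + / z / 4)) with (z + / z).
    + simpl. ring.
    + replace (INR 4) with 4%R by (simpl; lra). field. auto.
  - transitivity ((z * Phi (/ 2) (- / z)) * (z * Phi (- / z / 2) (- / z)) *
      (z * Phi ((- / z + 1) / 2) (- / z))); [|unfold hprod; simpl; ring].
    rewrite P1, P2, P3. unfold hprod.
    replace (ee (z / 4 + / z / 4)) with (ee (z / 8) * ee (/ z / 8) * (ee (z / 8) * ee (/ z / 8))).
    + rewrite !ee_plus. ring.
    + rewrite <- !ee_plus. f_equal. field. auto.
Qed.

Lemma hprod_neq_0 z : upper z -> hprod z <> 0.
Proof.
  intros Hz. unfold hprod. apply Cmult_neq_0; [apply Cmult_neq_0|]; apply Phi_neq_0; auto.
  - replace (/ 2) with ((0%R * z + 1%R) / 2) by field. now apply (nonlat_basis z 0 1).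
  - replace (z / 2) with ((1%R * z + 0%R) / 2) by field. now apply (nonlat_basis z 1 0).
  - replace (z + 1) with (1%R * z + 1%R) by ring. now apply (nonlat_basis z 1 1).
Qed.

Lemma Cmult_eq_reg_r (a b c : C) : c <> 0 -> a * c = b * c -> a = b.
Proof.
  intros Hc E. replace a with (a * c / c) by (field; exact Hc). rewrite E. field. exact Hc.
Qed.

Lemma Delta_S z : upper z -> Delta (- / z) = z ^ 12 * Delta z.
Proof.
  intros Hz. pose proof (upper_neq_0 z Hz) as Hz0. pose proof (upper_S z Hz) as Hz'.
  assert (E1 := Delta_hprod z Hz). assert (E2 := Delta_hprod (- / z) Hz').
  assert (E3 := hprod_S z Hz).
  assert (N1 := Cpow_nz _ 4 (hprod_neq_0 z Hz)).
  assert (N2 := Cpow_nz _ 4 (hprod_neq_0 _ Hz')).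
  assert (N3 := Cpow_nz _ 12 Hz0). assert (N4 := ee_neq_0 z).
  rewrite Copp_opp in E2. rewrite ee_plus in E3. rewrite ee_opp in E1.
  set (X := hprod z ^ 4) in *. set (Y := hprod (- / z) ^ 4) in *. set (Z := z ^ 12) in *.
  clearbody X Y Z.
  apply (Cmult_eq_reg_r _ _ Y); [exact N2|].
  rewrite E2. apply (Cmult_eq_reg_r _ _ X); [exact N1|].
  transitivity (Z * Y * (Delta z * X)); [|ring].
  rewrite E1, E3. field. exact N4.
Qed.

Lemma Delta_SL2Z (a b c d : Z) : in_SL2Z a b c d -> forall z, upper z ->
  Delta (mobius a b c d z) = automorphy c d z ^ 12 * Delta z.
Proof.
  apply (SL2Z_ind (fun a b c d => forall z, upper z ->
    Delta (mobius a b c d z) = automorphy c d z ^ 12 * Delta z)).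
  - intros z Hz. rewrite mobius_id.
    replace (automorphy 0 1 z) with (RtoC 1) by (unfold automorphy; ring).
    rewrite Cpow_1_l. ring.
  - clear a b c d. intros a b c d k Hs H z Hz.
    rewrite <- H, mobius_T by easy. unfold Delta. rewrite ee_plus_IZR, qprod_plus_IZR_tau. easy.
  - clear a b c d. intros a b c d Hs H z Hz.
    pose proof (automorphy_neq_0 a b c d z Hs Hz) as Hj.
    assert (Hs' : in_SL2Z (- c) (- d) a b) by (unfold in_SL2Z in *; lia).
    pose proof (automorphy_neq_0 _ _ _ _ z Hs' Hz) as Hj'.
    destruct (Phi_SL2Z a b c d Hs z Hz) as [Hu _].
    assert (Ew : mobius a b c d z = automorphy a b z / automorphy c d z) by easy.
    rewrite mobius_S, Delta_S, H by easy. rewrite Ew.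
    unfold Cdiv. rewrite Cpow_mult_l, Cpow_inv by easy. field. exact Hj.
Qed.

(** * Expansions at the cusps *)

(** A power of q^(1/h), possibly negative, times a zero-free holomorphic function on the whole disc.
    Zero-freeness closes the class under inverses, hence under the quotients that occur below. *)
Definition unit_mero (g : C -> C) : Prop :=
  exists (h : nat) (k : Z) (H : C -> C), (0 < h)%nat /\
  (forall w, Cmod w < 1 -> H w <> 0 /\ exists l, cder H w l) /\
  forall z, upper z -> g z = ee (IZR k / INR h * z) * H (ee (z / INR h)).

Lemma unit_mero_ext g1 g2 : (forall z, upper z -> g1 z = g2 z) ->
  unit_mero g1 -> unit_mero g2.
Proof.
  intros E [h [k [H [Hh [HH Hg]]]]]. exists h, k, H. split; [easy|]. split; [easy|].
  intros z Hz. rewrite <- E by easy. now apply Hg.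
Qed.

Lemma Cmod_ee_frac_lt_1 z (h : nat) : (0 < h)%nat -> upper z -> Cmod (ee (z / INR h)) < 1.
Proof.
  intros Hh Hz. rewrite Cmod_ee, <- exp_0. apply exp_increasing.
  assert (Hp : 0 < INR h) by now apply lt_0_INR.
  replace (z / INR h) with (RtoC (/ INR h) * z)
    by (rewrite RtoC_inv by lra; field; apply INR_C_neq_0; lia).
  rewrite im_scal_l. unfold upper in Hz. pose proof PI_RGT_0.
  assert (0 < / INR h) by now apply Rinv_0_lt_compat.
  assert (0 < / INR h * Im z) by now apply Rmult_lt_0_compat. nra.
Qed.

Lemma Cmod_pow_lt_1 w (n : nat) : (0 < n)%nat -> Cmod w < 1 -> Cmod (w ^ n) < 1.
Proof.
  intros Hn Hw. destruct n as [|n]; [lia|]. rewrite Cpow_S, Cmod_mult, Cmod_pow.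
  pose proof (Cmod_ge_0 w).
  assert (0 <= Cmod w ^ n <= 1).
  { split; [apply pow_le; lra|]. rewrite <- (pow1 n). apply pow_incr; lra. }
  nra.
Qed.

Lemma unit_mero_const (c : C) : c <> 0 -> unit_mero (fun _ => c).
Proof.
  intros Hc. exists 1%nat, 0%Z, (fun _ => c). split; [lia|]. split.
  - intros w _. split; [easy|]. exists 0. apply cder_const.
  - intros z _. replace (0%R / INR 1 * z) with (RtoC 0) by (simpl; field). rewrite ee_0. ring.
Qed.

Lemma unit_mero_mult g1 g2 : unit_mero g1 -> unit_mero g2 -> unit_mero (fun z => g1 z * g2 z).
Proof.
  intros [h1 [k1 [H1 [Hh1 [HH1 Hg1]]]]] [h2 [k2 [H2 [Hh2 [HH2 Hg2]]]]].
  assert (N1 : RtoC (INR h1) <> 0) by (apply INR_C_neq_0; lia).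
  assert (N2 : RtoC (INR h2) <> 0) by (apply INR_C_neq_0; lia).
  exists (h1 * h2)%nat, (k1 * Z.of_nat h2 + k2 * Z.of_nat h1)%Z, (fun w => H1 (w ^ h2) * H2 (w ^ h1)).
  split; [nia|]. split.
  - intros w Hw.
    destruct (HH1 (w ^ h2) (Cmod_pow_lt_1 w h2 Hh2 Hw)) as [A1 [l1 B1]].
    destruct (HH2 (w ^ h1) (Cmod_pow_lt_1 w h1 Hh1 Hw)) as [A2 [l2 B2]].
    split; [now apply Cmult_neq_0|].
    eexists. apply (cder_mult (fun w => H1 (w ^ h2)) (fun w => H2 (w ^ h1))).
    + apply (cder_comp H1 (fun w => w ^ h2)); [apply cder_pow|exact B1].
    + apply (cder_comp H2 (fun w => w ^ h1)); [apply cder_pow|exact B2].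
  - intros z Hz. rewrite Hg1, Hg2 by easy.
    rewrite <- !ee_nat, mult_INR, RtoC_mult, plus_IZR, !mult_IZR, RtoC_plus, !RtoC_mult, !IZR_nat_C.
    replace (INR h2 * (z / (INR h1 * INR h2))) with (z / INR h1) by (field; auto).
    replace (INR h1 * (z / (INR h1 * INR h2))) with (z / INR h2) by (field; auto).
    replace ((IZR k1 * INR h2 + IZR k2 * INR h1) / (INR h1 * INR h2) * z) with
      (IZR k1 / INR h1 * z + IZR k2 / INR h2 * z) by (field; auto).
    rewrite ee_plus. ring.
Qed.

Lemma unit_mero_inv g : unit_mero g -> unit_mero (fun z => / g z).
Proof.
  intros [h [k [H [Hh [HH Hg]]]]].
  exists h, (- k)%Z, (fun w => / H w). split; [easy|]. split.
  - intros w Hw. destruct (HH w Hw) as [A [l B]]. split.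
    + intros E. apply C1_nz. rewrite <- (Cinv_r _ A), E. ring.
    + eexists. exact (cder_inv H w l A B).
  - intros z Hz. rewrite Hg by easy.
    destruct (HH (ee (z / INR h)) (Cmod_ee_frac_lt_1 z h Hh Hz)) as [A _].
    replace (IZR (- k) / INR h * z) with (- (IZR k / INR h * z))
      by (rewrite opp_IZR, RtoC_opp; unfold Cdiv; ring).
    rewrite ee_opp. pose proof (ee_neq_0 (IZR k / INR h * z)). field. auto.
Qed.

Lemma unit_mero_partial_prod (g : nat -> C -> C) n :
  (forall k, (k < n)%nat -> unit_mero (g k)) ->
  unit_mero (fun z => partial_prod (fun k => g k z) n).
Proof.
  induction n as [|n IH]; intros H.
  - apply (unit_mero_const 1), C1_nz.
  - apply (unit_mero_mult (fun z => partial_prod (fun k => g k z) n) (g n)); auto.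
Qed.

Lemma unit_mero_pow g n : unit_mero g -> unit_mero (fun z => g z ^ n).
Proof.
  intros Hg. apply unit_mero_ext with (fun z => partial_prod (fun _ => g z) n).
  - intros z _. apply partial_prod_const.
  - now apply unit_mero_partial_prod with (g := fun _ => g).
Qed.

Lemma unit_mero_exp (k : Z) (h : nat) (b : C) : (0 < h)%nat ->
  unit_mero (fun z => ee (IZR k / INR h * z + b)).
Proof.
  intros Hh. exists h, k, (fun _ => ee b). split; [easy|]. split.
  - intros w _. split; [apply ee_neq_0|]. exists 0. apply cder_const.
  - intros z _. apply ee_plus.
Qed.

Lemma linear_geo_bound (s : R) : 0 < s < 1 -> exists B r : R, 0 < r < 1 /\ 0 < B /\
  s <= r /\ forall n, (1 + INR n) * s ^ n <= B * r ^ n.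
Proof.
  (* Bernoulli's inequality bounds 1 + n d by (1 + d)^n, and this d keeps (1 + d) s below 1. *)
  intros Hs. set (d := ((1 - s) / 2)%R). assert (Hd : 0 < d) by (unfold d; lra).
  exists (1 + / d)%R, ((1 + d) * s)%R.
  assert (Hi : 0 < / d) by now apply Rinv_0_lt_compat.
  split. { split; [apply Rmult_lt_0_compat; lra|]. unfold d. nra. }
  split; [lra|]. split; [nra|]. intros n. rewrite Rpow_mult_distr.
  assert (Hp : 0 < s ^ n) by (apply pow_lt; lra).
  assert (Hb := poly n d Hd).
  assert (Hn : 0 <= INR n) by apply pos_INR.
  assert (H1 : 1 + INR n <= (1 + / d) * (1 + INR n * d)).
  { assert (E : ((1 + / d) * (1 + INR n * d) = 1 + INR n * d + / d + INR n)%R) by (field; lra).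
    rewrite E. nra. }
  rewrite <- Rmult_assoc. apply Rmult_le_compat_r; [lra|].
  eapply Rle_trans; [exact H1|]. apply Rmult_le_compat_l; lra.
Qed.

(** An expansion at a cusp must be holomorphic in the local parameter w up to and including w = 0,
    so differentiability in z is not enough. The derivatives of the factors grow linearly in n,
    which [linear_geo_bound] absorbs. *)
Lemma lacunary_prod_holo (h e : nat) (c w : C) : (0 < h)%nat -> (0 < e)%nat -> Cmod c = 1%R ->
  Cmod w < 1 ->
  inf_prod (fun n => 1 - c * w ^ (h * n + e)) <> 0 /\
  exists l, cder (fun w => inf_prod (fun n => 1 - c * w ^ (h * n + e))) w l.
Proof.
  intros Hh He Hc Hw. pose proof (Cmod_ge_0 w) as Hw0.
  set (rho := ((1 - Cmod w) / 2)%R). set (s := (Cmod w + rho)%R).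
  assert (Hrho : 0 < rho) by (unfold rho; lra).
  assert (Hs : 0 < s < 1) by (unfold s, rho; lra).
  destruct (linear_geo_bound s Hs) as [B [r [Hr [HB [Hsr Hlin]]]]].
  set (A := (1 + INR (h + e) * B)%R).
  assert (Hhe : 1 <= INR (h + e)) by (apply (le_INR 1); lia).
  assert (Hball : forall y, Cmod (y - w) < rho -> Cmod y <= s).
  { intros y Hy. pose proof (Cmod_triangle_rev y w). unfold s. lra. }
  assert (Hpow : forall y m n, Cmod y <= s -> (n <= m)%nat -> Cmod (y ^ m) <= s ^ n).
  { intros y m n Hy Hn. rewrite Cmod_pow.
    replace m with (n + (m - n))%nat by lia. rewrite pow_add.
    assert (H1 : Cmod y ^ n <= s ^ n) by (apply pow_incr; split; [apply Cmod_ge_0|easy]).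
    assert (H2 : 0 <= Cmod y ^ (m - n) <= 1).
    { split; [apply pow_le, Cmod_ge_0|]. rewrite <- (pow1 (m - n)). apply pow_incr.
      split; [apply Cmod_ge_0|lra]. }
    assert (0 <= Cmod y ^ n) by (apply pow_le, Cmod_ge_0). nra. }
  assert (Hrn : forall n, 0 < s ^ n <= r ^ n).
  { intros n. split; [apply pow_lt; lra|apply pow_incr; lra]. }
  assert (Hb1 : forall n y, Cmod (y - w) < rho ->
    Cmod (1 - c * y ^ (h * n + e) - 1) <= A * r ^ n).
  { intros n y Hy. replace (1 - c * y ^ (h * n + e) - 1) with (- (c * y ^ (h * n + e))) by ring.
    rewrite Cmod_opp, Cmod_mult, Hc, Rmult_1_l.
    eapply Rle_trans; [apply (Hpow y _ n); [now apply Hball|nia]|].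
    specialize (Hrn n). unfold A. assert (0 < INR (h + e) * B * r ^ n); [|lra].
    repeat apply Rmult_lt_0_compat; lra. }
  assert (Hz0 : Cmod (w - w) < rho).
  { replace (w - w) with (RtoC 0) by ring. now rewrite Cmod_0. }
  split.
  - apply inf_prod_neq_0 with (A := A) (r := r); [easy|auto|].
    intros n. apply one_minus_neq_0. rewrite Cmod_mult, Hc, Rmult_1_l.
    apply Cmod_pow_lt_1; [nia|easy].
  - destruct (cder_inf_prod (fun n w => 1 - c * w ^ (h * n + e))
      (fun n w => - (c * (INR (h * n + e) * w ^ (h * n + e - 1)))) w rho A r) as [l [Hl _]];
      [easy|lra| |exact Hb1| |].
    + intros n y _. eapply cder_eq; [|apply cder_minus; [apply cder_const|apply cder_scal, cder_pow]].
      ring.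
    + intros n y Hy. rewrite Cmod_opp, !Cmod_mult, Hc, Rmult_1_l, Cmod_R, Rabs_pos_eq by apply pos_INR.
      apply Rle_trans with (INR (h + e) * (1 + INR n) * s ^ n)%R.
      * apply Rmult_le_compat; [apply pos_INR|apply Cmod_ge_0| |].
        -- replace (1 + INR n)%R with (INR (S n)) by (rewrite S_INR; ring).
           rewrite <- mult_INR. apply le_INR. nia.
        -- apply Hpow; [now apply Hball|nia].
      * specialize (Hlin n). specialize (Hrn n). unfold A. rewrite Rmult_assoc.
        apply Rle_trans with (INR (h + e) * (B * r ^ n))%R.
        { apply Rmult_le_compat_l; [lra|easy]. }
        lra.
    + exists l. exact Hl.
Qed.

Lemma Cmod_ee_real (b : R) : Cmod (ee b) = 1%R.
Proof. rewrite Cmod_ee, im_RtoC, Rmult_0_r. apply exp_0. Qed.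

(** In terms of w = q^(1/h) the first factor is 1 - ee(b) w^(h+i): the hypothesis says that its
    exponent is positive. *)
Lemma unit_mero_qprod (i : Z) (h : nat) (b : R) : (0 < Z.of_nat h + i)%Z -> (0 < h)%nat ->
  unit_mero (fun z => qprod (IZR i / INR h * z + b) z).
Proof.
  intros Hi Hh. set (e := Z.to_nat (Z.of_nat h + i)).
  assert (N : RtoC (INR h) <> 0) by (apply INR_C_neq_0; lia).
  exists h, 0%Z, (fun w => inf_prod (fun n => 1 - ee b * w ^ (h * n + e))).
  split; [easy|]. split.
  - intros w Hw. apply lacunary_prod_holo; [easy|unfold e; lia|apply Cmod_ee_real|easy].
  - intros z Hz. replace (0%R / INR h * z) with (RtoC 0) by (field; easy).
    rewrite ee_0, Cmult_1_l. apply inf_prod_ext. intros n. unfold qfac.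
    rewrite <- ee_nat, <- ee_plus.
    replace (INR (h * n + e) * (z / INR h)) with (INR (S n) * z + IZR i / INR h * z).
    + do 2 f_equal. ring.
    + rewrite plus_INR, mult_INR, S_INR. unfold e.
      rewrite (INR_IZR_INZ (Z.to_nat _)), Z2Nat.id, plus_IZR, <- INR_IZR_INZ by lia.
      rewrite !RtoC_plus, RtoC_mult. field. easy.
Qed.

Lemma unit_mero_qprod_0 : unit_mero (fun z => qprod 0 z).
Proof.
  apply unit_mero_ext with (fun z => qprod (0%R / INR 1 * z + 0%R) z).
  - intros z _. f_equal. simpl. field.
  - apply (unit_mero_qprod 0 1 0); lia.
Qed.

Lemma unit_mero_Delta : unit_mero Delta.
Proof.
  apply (unit_mero_mult ee (fun z => qprod 0 z ^ 24)).
  - apply unit_mero_ext with (fun z => ee (1%R / INR 1 * z + 0)).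
    + intros z _. f_equal. simpl. field.
    + apply (unit_mero_exp 1 1 0). lia.
  - apply unit_mero_pow, unit_mero_qprod_0.
Qed.

(** For i = 0 the factor 1 - x is a nonzero constant. For i > 0 it is absorbed as one more factor of
    the product, [qprod (u - z)], whose first exponent is i. *)
Lemma unit_mero_Phi_reduced (i : Z) (h : nat) (b : R) : (0 < h)%nat ->
  (0 <= i < Z.of_nat h)%Z -> (i = 0%Z -> ee b <> 1) ->
  unit_mero (fun z => Phi (IZR i / INR h * z + b) z).
Proof.
  intros Hh Hi Hb.
  assert (N : RtoC (INR h) <> 0) by (apply INR_C_neq_0; lia). pose proof C2_nz.
  assert (Hm : unit_mero (fun z => qprod (- (IZR i / INR h * z + b)) z)).
  { apply unit_mero_ext with (fun z => qprod (IZR (- i) / INR h * z + RtoC (- b)) z).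
    - intros z _. f_equal. rewrite opp_IZR, !RtoC_opp. field. easy.
    - apply unit_mero_qprod; lia. }
  pose proof (unit_mero_inv _ (unit_mero_mult _ _ unit_mero_qprod_0 unit_mero_qprod_0)) as H0.
  destruct (Z.eq_dec i 0) as [->|Hi0].
  - specialize (Hb eq_refl).
    eapply unit_mero_ext; [|apply (unit_mero_mult _ _
      (unit_mero_const _ (half_factor_neq_0 b Hb))
      (unit_mero_mult _ _ (unit_mero_mult _ _ (unit_mero_qprod 0 h b ltac:(lia) Hh) Hm) H0))].
    intros z Hz. cbv beta. unfold Phi.
    replace ((0%R / INR h * z + b) / 2) with (b / 2) by (field; easy). unfold Cdiv. ring.
  - assert (He : unit_mero (fun z => ee (IZR (- i) / INR (2 * h) * z + - (b / 2))))
      by (apply unit_mero_exp; lia).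
    assert (Hp : unit_mero (fun z => qprod (IZR (i - Z.of_nat h) / INR h * z + b) z))
      by (apply unit_mero_qprod; lia).
    eapply unit_mero_ext; [|apply (unit_mero_mult _ _ (unit_mero_const (- (1)) ltac:(
        intros E; apply (f_equal Re) in E; simpl in E; lra))
      (unit_mero_mult _ _ He (unit_mero_mult _ _ (unit_mero_mult _ _ Hp Hm) H0)))].
    intros z Hz. cbv beta. unfold Phi.
    set (u := IZR i / INR h * z + b).
    replace (IZR (i - Z.of_nat h) / INR h * z + b) with (u - z)
      by (unfold u; rewrite minus_IZR, RtoC_minus, IZR_nat_C; field; easy).
    replace (IZR (- i) / INR (2 * h) * z + - (b / 2)) with (- (u / 2)).
    2:{ unfold u. rewrite opp_IZR, RtoC_opp, mult_INR, RtoC_mult. replace (INR 2) with 2%R by (simpl; lra). field. auto. }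
    rewrite (qprod_shift (u - z)) by easy. replace (u - z + z) with u by ring.
    replace (ee (u / 2)) with (ee (- (u / 2)) * ee u).
    + unfold Cdiv. ring.
    + rewrite <- ee_plus. f_equal. field.
Qed.

(** Quasi-periodicity reduces i modulo h at the price of an exponential, which is itself a power of
    the local parameter times a constant. *)
Lemma unit_mero_Phi (i : Z) (h : nat) (b : R) : (0 < h)%nat ->
  ((Z.of_nat h | i)%Z -> ee b <> 1) ->
  unit_mero (fun z => Phi (IZR i / INR h * z + b) z).
Proof.
  intros Hh Hb. set (m := (i / Z.of_nat h)%Z). set (i0 := (i mod Z.of_nat h)%Z).
  assert (N : RtoC (INR h) <> 0) by (apply INR_C_neq_0; lia). pose proof C2_nz.
  assert (Ei : (i = Z.of_nat h * m + i0)%Z) by (apply Z.div_mod; lia).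
  assert (Hi0 : (0 <= i0 < Z.of_nat h)%Z) by (apply Z.mod_pos_bound; lia).
  assert (H1 : unit_mero (fun z => Phi (IZR i0 / INR h * z + b) z)).
  { apply unit_mero_Phi_reduced; auto. intros E0. apply Hb. exists m. lia. }
  assert (H2 : unit_mero (fun z => ee (IZR (- 2 * m * i0 - m * m * Z.of_nat h) / INR (2 * h) * z
     + (IZR m / 2 - IZR m * b)))) by (apply unit_mero_exp; lia).
  eapply unit_mero_ext; [|apply (unit_mero_mult _ _ H2 H1)].
  intros z Hz. cbv beta.
  replace (IZR i / INR h * z + b) with (IZR i0 / INR h * z + b + IZR m * z).
  - rewrite Phi_plus_IZR_z by easy. f_equal. f_equal.
    rewrite minus_IZR, !mult_IZR, RtoC_minus, !RtoC_mult, IZR_nat_C, mult_INR, RtoC_mult.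
    replace (INR 2) with 2%R by (simpl; lra).
    replace (RtoC (-2)%R) with (- RtoC 2) by (rewrite <- RtoC_opp; f_equal; lra).
    field. auto.
  - rewrite Ei, plus_IZR, mult_IZR, RtoC_plus, RtoC_mult, IZR_nat_C. field. easy.
Qed.

(** * The crank function *)

Lemma pow_n_Cpow (x : C) (n : nat) : pow_n x n = x ^ n.
Proof.
  induction n as [|n IH]; [easy|].
  change (pow_n x (S n)) with (x * pow_n x n). now rewrite IH, Cpow_S.
Qed.

Lemma qpow_ee (r : R) z : qpow r z = ee (r * z).
Proof. unfold qpow, ee. f_equal. rewrite RtoC_mult. ring. Qed.

Lemma eta_qprod w : eta w = ee (w / 24) * qprod 0 w.
Proof.
  unfold eta. rewrite qpow_ee. f_equal.
  - f_equal. rewrite RtoC_div by lra. field.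
  - apply inf_prod_ext. intros n. unfold qfac. now rewrite qpow_ee, Cplus_0_r.
Qed.

Lemma qpoch_qprod u z : qpoch (ee u * ee z) (ee z) = qprod u z.
Proof.
  apply inf_prod_ext. intros n. unfold qfac. rewrite pow_n_Cpow, ee_plus, ee_nat, Cpow_S.
  ring.
Qed.

Lemma crank_qprod u z : crank (ee u) (ee z) = qprod 0 z / (qprod u z * qprod (- u) z).
Proof.
  assert (E := qpoch_qprod 0 z). rewrite ee_0, Cmult_1_l in E.
  unfold crank. now rewrite <- ee_opp, !qpoch_qprod, E.
Qed.

Lemma zeta_pow (N l : nat) : N <> O -> pow_n (zeta (Z.of_nat N)) l = ee (INR l / INR N).
Proof.
  intros HN. rewrite pow_n_Cpow. pose proof (INR_C_neq_0 N HN).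
  replace (zeta (Z.of_nat N)) with (ee (/ INR N)).
  - rewrite <- ee_nat. f_equal.
  - unfold zeta, ee. f_equal. rewrite <- INR_IZR_INZ, RtoC_div by (now apply not_0_INR).
    field. easy.
Qed.

Definition sfac (u : C) : C := ee (u / 2) - ee (- (u / 2)).

(** The powers of q combine to q^((N^2 - 1)/24) = q^t, and q^t with 24t Euler products is [Delta]^t.
    The products at the torsion point cancel against those in [Phi]. *)
Lemma Fcrank_Phi (N l t : nat) z : N <> O -> (N * N = 24 * t + 1)%nat -> upper z ->
  nonlat (INR l / INR N) z ->
  Fcrank (Z.of_nat N) l z * Phi (INR l / INR N) z * qprod 0 z ^ (N * N) =
  sfac (INR l / INR N) * Delta z ^ t * qprod 0 (INR (N * N) * z).
Proof.
  intros HN Ht Hz Hu. unfold Fcrank.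
  replace (IZR (Z.of_nat N ^ 2)) with (INR (N * N))
    by (rewrite INR_IZR_INZ; f_equal; lia).
  rewrite zeta_pow, !qpow_ee, eta_qprod by easy.
  replace (1%R * z) with z by ring. rewrite crank_qprod.
  set (u := INR l / INR N) in *.
  pose proof (qprod_neq_0 u z Hz (qfac_neq_0 u z Hu)).
  pose proof (qprod_neq_0 (- u) z Hz (qfac_neq_0 _ z (nonlat_opp u z Hu))).
  pose proof (qprod_0_neq_0 z Hz).
  unfold Phi, sfac, Delta. rewrite Cpow_mult_l, <- Cpow_mult_r.
  rewrite Ht, (Cpow_add_r _ (24 * t) 1), Cpow_1_r.
  replace (ee z ^ t) with (ee (INR (24 * t + 1) * z / 24) * ee ((-1 / 24)%R * z)).
  - field. auto.
  - rewrite <- ee_plus, <- ee_nat. f_equal.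
    rewrite RtoC_div, plus_INR, mult_INR, RtoC_plus, RtoC_mult by lra.
    replace (INR 24) with 24%R by (simpl; lra).
    replace (RtoC (-1)%R) with (- (1)) by (rewrite <- RtoC_opp; f_equal; lra).
    simpl (INR 1). field.
Qed.

Lemma upper_nat_mult (n : nat) z : n <> O -> upper z -> upper (INR n * z).
Proof.
  intros Hn Hz. unfold upper in *. rewrite im_scal_l.
  apply Rmult_lt_0_compat; [apply lt_0_INR; lia|easy].
Qed.

Lemma frac_nonlat (l N : nat) z : upper z -> (0 < l < N)%nat -> nonlat (INR l / INR N) z.
Proof.
  intros Hz Hl. assert (HN : RtoC (INR N) <> 0) by (apply INR_C_neq_0; lia).
  assert (HN' : INR N <> 0%R) by (apply not_0_INR; lia).
  apply nonlat_iff. intros m n E. rewrite <- RtoC_div in E by easy.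
  assert (Hm : m = 0%Z).
  { apply (f_equal Im) in E. rewrite im_plus, im_scal_l, !im_RtoC, Rplus_0_r in E.
    unfold upper in Hz. apply eq_IZR. symmetry in E. destruct (Rmult_integral _ _ E); [easy|lra]. }
  subst m. apply (ee_frac_neq_1 (Z.of_nat l) N); [lia|].
  rewrite IZR_nat_C, <- RtoC_div, E, Cmult_0_l, Cplus_0_l by easy. apply ee_IZR.
Qed.

(** The points of order N^2 = 2 (12 t) + 1: every factor is taken at z itself, so any matrix of
    SL2(Z) can be applied. Used for the cusps. *)
Lemma Fcrank_cusp_form (N l t : nat) z : (N * N = 24 * t + 1)%nat -> (0 < l < N)%nat -> upper z ->
  Fcrank (Z.of_nat N) l z =
  sfac (INR l / INR N) / tconst (12 * t) * Delta z ^ t * tprod (12 * t) z / Phi (INR l / INR N) z.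
Proof.
  intros Ht Hl Hz. pose proof (frac_nonlat l N z Hz Hl) as Hu.
  assert (H1 := Fcrank_Phi N l t z ltac:(lia) Ht Hz Hu).
  assert (H2 := tprod_eq (12 * t) z Hz).
  replace (2 * (12 * t) + 1)%nat with (N * N)%nat in H2 by lia.
  pose proof (Phi_neq_0 _ z Hz Hu). pose proof (tconst_neq_0 (12 * t)).
  assert (H3 := Cpow_nz _ (N * N) (qprod_0_neq_0 z Hz)).
  set (F := Fcrank (Z.of_nat N) l z) in *. set (X := qprod 0 z ^ (N * N)) in *.
  set (Y := qprod 0 (INR (N * N) * z)) in *. set (D := Delta z ^ t) in *.
  set (A := tprod (12 * t) z) in *. set (c := tconst (12 * t)) in *.
  set (P := Phi (INR l / INR N) z) in *. set (s := sfac (INR l / INR N)) in *.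
  clearbody F X Y D A c P s.
  apply (Cmult_eq_reg_r _ _ (P * X)); [now apply Cmult_neq_0|].
  transitivity (F * P * X); [ring|]. rewrite H1.
  transitivity (s * D / c * (A * X)); [|field; auto]. rewrite H2. field. auto.
Qed.

(** With N = 2M + 1, eta(N^2 z) / eta(z)^(N^2) is split as eta(N^2 z) / eta(N z)^N times (eta(N z) /
    eta(z)^N)^N: only points of order N occur, which the group fixes modulo periods. *)
Lemma Fcrank_invariant_form (M l t : nat) z :
  ((2 * M + 1) * (2 * M + 1) = 24 * t + 1)%nat -> (0 < l < 2 * M + 1)%nat -> upper z ->
  Fcrank (Z.of_nat (2 * M + 1)) l z =
  sfac (INR l / INR (2 * M + 1)) / (tconst M * tconst M ^ (2 * M + 1)) * Delta z ^ t *
  (tprod M (INR (2 * M + 1) * z) * tprod M z ^ (2 * M + 1)) / Phi (INR l / INR (2 * M + 1)) z.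
Proof.
  intros Ht Hl Hz. pose proof (frac_nonlat l _ z Hz Hl) as Hu.
  set (N := (2 * M + 1)%nat) in *.
  pose proof (upper_nat_mult N z ltac:(lia) Hz) as HNz.
  assert (H1 := Fcrank_Phi N l t z ltac:(lia) Ht Hz Hu).
  assert (H2 := tprod_eq M z Hz). assert (H2' := tprod_eq M _ HNz). fold N in H2, H2'.
  replace (INR N * (INR N * z)) with (INR (N * N) * z) in H2' by (rewrite mult_INR, RtoC_mult; ring).
  apply (f_equal (fun x => x ^ N)) in H2. rewrite !Cpow_mult_l, <- Cpow_mult_r in H2.
  pose proof (Phi_neq_0 _ z Hz Hu).
  pose proof (tconst_neq_0 M) as Hc. pose proof (Cpow_nz _ N Hc) as Hc'.
  assert (H3 := Cpow_nz _ (N * N) (qprod_0_neq_0 z Hz)).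
  assert (H4 := Cpow_nz _ N (qprod_0_neq_0 _ HNz)).
  set (F := Fcrank (Z.of_nat N) l z) in *. set (X := qprod 0 z ^ (N * N)) in *.
  set (Y := qprod 0 (INR (N * N) * z)) in *. set (D := Delta z ^ t) in *.
  set (A := tprod M z ^ N) in *. set (A' := tprod M (INR N * z)) in *.
  set (X' := qprod 0 (INR N * z) ^ N) in *.
  set (c' := tconst M ^ N) in *. set (c := tconst M) in *.
  set (P := Phi (INR l / INR N) z) in *. set (s := sfac (INR l / INR N)) in *.
  clearbody F X Y D A A' X' c c' P s.
  apply (Cmult_eq_reg_r _ _ (P * X)); [now apply Cmult_neq_0|].
  transitivity (F * P * X); [ring|]. rewrite H1.
  transitivity (s * D / (c * c') * A' * (A * X)); [|field; auto]. rewrite H2.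
  transitivity (s * D / c * (A' * X')); [|field; auto]. rewrite H2'. field. auto.
Qed.

Lemma ee_half_even (n : Z) : Z.even n = true -> ee (IZR n / 2) = 1.
Proof.
  intros H. apply Z.even_spec in H as [m ->]. rewrite mult_IZR, RtoC_mult.
  replace (2 * IZR m / 2) with (RtoC (IZR m)) by field. apply ee_IZR.
Qed.

(** The transformation law at u = r (c z + d). For a rational r this is again a torsion point, to be
    reduced by periods. *)
Lemma Phi_real (r : C) (a b c d : Z) z : in_SL2Z a b c d -> upper z ->
  Phi r (mobius a b c d z) = / automorphy c d z *
    (ee (IZR c * (r * r) * automorphy c d z / 2) * Phi (r * automorphy c d z) z).
Proof.
  intros Hs Hz. destruct (Phi_SL2Z a b c d Hs z Hz) as [_ H].
  pose proof (automorphy_neq_0 a b c d z Hs Hz) as Hj. pose proof C2_nz.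
  specialize (H (r * automorphy c d z)). set (j := automorphy c d z) in *.
  replace (r * j / j) with r in H by (field; easy). rewrite H.
  replace (IZR c * (r * j * (r * j)) / (2 * j)) with (IZR c * (r * r) * j / 2) by (field; auto).
  ring.
Qed.

Lemma Phi_torsion (N k : nat) (a b c2 d' : Z) z : N <> O ->
  in_SL2Z a b (Z.of_nat N * c2) (1 + Z.of_nat N * d') -> upper z ->
  Phi (INR k / INR N) (mobius a b (Z.of_nat N * c2) (1 + Z.of_nat N * d') z) =
  / automorphy (Z.of_nat N * c2) (1 + Z.of_nat N * d') z *
  (ee (- (INR k * INR k * IZR c2) / (2 * INR N) +
       IZR (Z.of_nat k * (c2 + d' + Z.of_nat k * c2 * d')) / 2) * Phi (INR k / INR N) z).
Proof.
  intros HN Hs Hz. pose proof (INR_C_neq_0 N HN) as HN0. pose proof C2_nz.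
  rewrite (Phi_real _ a b _ _ z Hs Hz). f_equal.
  replace (INR k / INR N * automorphy (Z.of_nat N * c2) (1 + Z.of_nat N * d') z) with
    (INR k / INR N + IZR (Z.of_nat k * c2) * z + IZR (Z.of_nat k * d')).
  2:{ unfold automorphy. rewrite plus_IZR, !mult_IZR, RtoC_plus, !RtoC_mult, !IZR_nat_C. field. easy. }
  rewrite Phi_plus_IZR, Phi_plus_IZR_z, !Cmult_assoc, <- !ee_plus by easy. f_equal. f_equal.
  unfold automorphy. rewrite !mult_IZR, !plus_IZR, !mult_IZR, !RtoC_mult, !RtoC_plus, !RtoC_mult, !IZR_nat_C.
  field. auto.
Qed.

Lemma partial_prod_ee (x : nat -> C) n : partial_prod (fun k => ee (x k)) n = ee (csum x n).
Proof.
  induction n as [|n IH]; cbn [partial_prod csum]; [now rewrite ee_0|]. now rewrite IH, ee_plus.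
Qed.

(** If c' is even, the determinant forces 1 + N d' to be odd, hence d' even. This decides all the
    signs below. *)
Lemma Gamma1_parity (N a b c' d' : Z) : Z.odd N = true ->
  in_SL2Z a b (N * c') (1 + N * d') -> Z.odd c' = true \/ Z.odd d' = false.
Proof.
  unfold in_SL2Z. intros HN Hs. apply (f_equal Z.odd) in Hs.
  rewrite Z.odd_sub, !Z.odd_mul, Z.odd_add, Z.odd_mul, HN in Hs.
  destruct (Z.odd c'), (Z.odd d'), (Z.odd a), (Z.odd b); auto; discriminate.
Qed.

(** When N^2 divides c the root of unity in [Phi_torsion] is only a sign, and parity makes it 1:
    each torsion value is separately modular of weight -1. *)
Lemma Phi_torsion_Gamma (M k : nat) (a b c' d' : Z) z (N : Z) : N = Z.of_nat (2 * M + 1) ->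
  in_SL2Z a b (N * (N * c')) (1 + N * d') -> upper z ->
  Phi (INR k / INR (2 * M + 1)) (mobius a b (N * (N * c')) (1 + N * d') z) =
  / automorphy (N * (N * c')) (1 + N * d') z * Phi (INR k / INR (2 * M + 1)) z.
Proof.
  intros EN Hs Hz. assert (HN : RtoC (INR (2 * M + 1)) <> 0) by (apply INR_C_neq_0; lia).
  pose proof (Phi_torsion (2 * M + 1) k a b (N * c') d' z ltac:(lia)) as HT.
  rewrite <- EN in HT. rewrite HT by easy. f_equal.
  set (K := Z.of_nat k).
  replace (- (INR k * INR k * IZR (N * c')) / (2 * INR (2 * M + 1)) +
       IZR (K * (N * c' + d' + K * (N * c') * d')) / 2) with
    (IZR (- (K * K * c') + K * (N * c' + d' + K * (N * c') * d')) / 2).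
  2:{ rewrite plus_IZR, opp_IZR, RtoC_plus, RtoC_opp.
      assert (EN' : RtoC (INR (2 * M + 1)) = IZR N) by (now rewrite EN, IZR_nat_C).
      rewrite EN' in HN |- *. rewrite <- (IZR_nat_C k). fold K.
      rewrite !mult_IZR, !plus_IZR, !mult_IZR, !RtoC_mult, !RtoC_plus, !RtoC_mult.
      pose proof C2_nz. field. auto. }
  rewrite ee_half_even; [ring|].
  assert (HNodd : Z.odd N = true).
  { rewrite EN, Nat2Z.inj_add, Nat2Z.inj_mul, Z.odd_add, Z.odd_mul. easy. }
  assert (Hpar : Z.odd c' = true \/ Z.odd d' = false).
  { apply (Gamma1_parity N a (b * N) c' d'); [easy|]. unfold in_SL2Z in *. lia. }
  rewrite <- Z.negb_odd.
  rewrite Z.odd_add, Z.odd_opp, !Z.odd_mul, !Z.odd_add, !Z.odd_mul, HNodd.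
  destruct (Z.odd K), (Z.odd c'), (Z.odd d'), Hpar; easy.
Qed.

Lemma csum_torsion (c : C) (N m : nat) : RtoC (INR N) <> 0 ->
  csum (fun k => c * INR (S k) * (INR N - INR (S k)) / (2 * INR N)) m =
  c * INR m * (INR m + 1) * (3 * INR N - 2 * INR m - 1) / (12 * INR N).
Proof.
  intros HN. pose proof C2_nz. assert (RtoC 12 <> 0) by (intros E; apply RtoC_inj in E; lra).
  induction m as [|m IH]; cbn [csum].
  - simpl. field. auto.
  - rewrite IH, !S_INR, !RtoC_plus. field. auto.
Qed.

(** Here only N divides c, as for the matrix acting on N z, and each factor acquires a root of
    unity. Only their product is trivial: the exponents k (N - k) c' / (2N) sum to the integer c' M
    (M + 1) / 6. *)
Lemma tprod_Gamma_pz (M t : nat) (a b c' d' : Z) w (N : Z) : N = Z.of_nat (2 * M + 1) ->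
  (M * (M + 1) = 6 * t)%nat ->
  in_SL2Z a b (N * c') (1 + N * d') -> upper w ->
  tprod M (mobius a b (N * c') (1 + N * d') w) =
  (/ automorphy (N * c') (1 + N * d') w) ^ M * tprod M w.
Proof.
  intros EN Ht Hs Hw. assert (HN : RtoC (INR (2 * M + 1)) <> 0) by (apply INR_C_neq_0; lia).
  pose proof C2_nz as H2.
  set (j := automorphy (N * c') (1 + N * d') w).
  set (x := fun k : nat => IZR c' * INR (S k) * (INR (2 * M + 1) - INR (S k)) / (2 * INR (2 * M + 1))).
  assert (HNodd : Z.odd N = true).
  { rewrite EN, Nat2Z.inj_add, Nat2Z.inj_mul, Z.odd_add, Z.odd_mul. easy. }
  transitivity (partial_prod (fun k => / j * ee (x k) * Phi (INR (S k) / INR (2 * M + 1)) w) M).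
  - apply partial_prod_ext. intros k _.
    pose proof (Phi_torsion (2 * M + 1) (S k) a b c' d' w ltac:(lia)) as HT.
    rewrite <- EN in HT. rewrite HT by easy. fold j.
    rewrite <- (Cmult_assoc (/ j) (ee (x k))). f_equal. f_equal.
    set (K := Z.of_nat (S k)).
    (* The part of the exponent that does not belong to x k is an integer, by parity. *)
    assert (HE : ee (IZR (K * (d' + K * c' * d')) / 2) = 1).
    { apply ee_half_even.
      rewrite <- Z.negb_odd, Z.odd_mul, Z.odd_add, !Z.odd_mul.
      destruct (Gamma1_parity N a b c' d' HNodd Hs), (Z.odd K), (Z.odd c'), (Z.odd d'); easy. }
    rewrite <- (Cmult_1_r (ee (x k))), <- HE, <- ee_plus. f_equal.
    unfold x. rewrite <- (IZR_nat_C (S k)), <- (IZR_nat_C (2 * M + 1)), <- EN. fold K.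
    rewrite !mult_IZR, !plus_IZR, !mult_IZR, !RtoC_mult, !RtoC_plus, !RtoC_mult.
    assert (RtoC (IZR N) <> 0) by (now rewrite EN, IZR_nat_C).
    field. auto.
  - rewrite !partial_prod_mult, partial_prod_const, partial_prod_ee. unfold x.
    rewrite csum_torsion by easy.
    (* The last numerator factor is 3N - 2M - 1 = 2N, so the sum is c' M (M + 1) / 6 = c' t. *)
    replace (IZR c' * INR M * (INR M + 1) * (3 * INR (2 * M + 1) - 2 * INR M - 1) / (12 * INR (2 * M + 1)))
      with (RtoC (IZR (c' * Z.of_nat t))).
    + rewrite ee_IZR. unfold tprod. ring.
    + apply (f_equal INR) in Ht. rewrite !mult_INR, plus_INR in Ht.
      apply (f_equal RtoC) in Ht. rewrite !RtoC_mult, RtoC_plus in Ht.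
      replace (INR 6) with 6%R in Ht by (simpl; lra).
      replace (RtoC (INR 1)) with (RtoC 1) in Ht by easy.
      assert (H6 : RtoC 6 <> 0) by (intros E; apply RtoC_inj in E; lra).
      assert (H12 : RtoC 12 <> 0) by (intros E; apply RtoC_inj in E; lra).
      rewrite mult_IZR, RtoC_mult, IZR_nat_C.
      rewrite plus_INR, mult_INR, RtoC_plus, RtoC_mult in HN |- *.
      replace (INR 2) with 2%R in HN |- * by (simpl; lra).
      replace (RtoC (INR 1)) with (RtoC 1) in HN |- * by easy.
      transitivity (IZR c' * (6 * INR t) / 6); [field; auto|]. rewrite <- Ht. field. auto.
Qed.

Lemma tprod_Gamma (M : nat) (a b c' d' : Z) z (N : Z) : N = Z.of_nat (2 * M + 1) ->
  in_SL2Z a b (N * (N * c')) (1 + N * d') -> upper z ->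
  tprod M (mobius a b (N * (N * c')) (1 + N * d') z) =
  (/ automorphy (N * (N * c')) (1 + N * d') z) ^ M * tprod M z.
Proof.
  intros EN Hs Hz. unfold tprod. rewrite <- partial_prod_const, <- partial_prod_mult.
  apply partial_prod_ext. intros k _. now apply Phi_torsion_Gamma.
Qed.

Lemma Fcrank_invariant (M l t : nat) (a b c' d' : Z) z (N : Z) : N = Z.of_nat (2 * M + 1) ->
  (M * (M + 1) = 6 * t)%nat -> (0 < l < 2 * M + 1)%nat ->
  in_SL2Z a b (N * (N * c')) (1 + N * d') -> upper z ->
  Fcrank N l (mobius a b (N * (N * c')) (1 + N * d') z) =
  automorphy (N * (N * c')) (1 + N * d') z * Fcrank N l z.
Proof.
  intros EN Ht Hl Hs Hz.
  destruct (Phi_SL2Z _ _ _ _ Hs z Hz) as [Hw _].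
  pose proof (automorphy_neq_0 _ _ _ _ z Hs Hz) as Hj.
  assert (HN : RtoC (INR (2 * M + 1)) <> 0) by (apply INR_C_neq_0; lia).
  assert (HF : forall y, upper y -> Fcrank N l y = _)
    by (rewrite EN; intros y Hy; apply (Fcrank_invariant_form M l t); lia || easy).
  rewrite (HF _ Hw), (HF _ Hz).
  rewrite Phi_torsion_Gamma, tprod_Gamma, Delta_SL2Z by easy.
  (* Multiplication by N conjugates the matrix to one with upper right entry N b and lower left
     entry c/N, still integral and with the same automorphy factor. *)
  assert (Hpw : INR (2 * M + 1) * mobius a b (N * (N * c')) (1 + N * d') z =
    mobius a (N * b) (N * c') (1 + N * d') (INR (2 * M + 1) * z)).
  { unfold mobius, automorphy in *. rewrite !(mult_IZR N), !RtoC_mult in *.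
    rewrite <- (IZR_nat_C (2 * M + 1)), <- EN in *. field.
    intros E. apply Hj. rewrite <- E. ring. }
  assert (Hj' : automorphy (N * c') (1 + N * d') (INR (2 * M + 1) * z) =
    automorphy (N * (N * c')) (1 + N * d') z).
  { unfold automorphy. rewrite !(mult_IZR N), !RtoC_mult, <- (IZR_nat_C (2 * M + 1)), <- EN. ring. }
  rewrite Hpw, (tprod_Gamma_pz M t).
  2: easy. 2: easy. 2: unfold in_SL2Z in *; lia. 2: apply upper_nat_mult; [lia|easy].
  rewrite Hj'.
  pose proof (Phi_neq_0 _ z Hz (frac_nonlat l _ z Hz Hl)) as HP.
  set (j := automorphy (N * (N * c')) (1 + N * d') z) in *.
  pose proof (tconst_neq_0 M) as Hc. pose proof (Cpow_nz _ (2 * M + 1) Hc) as Hc'.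
  rewrite !Cpow_mult_l, <- !Cpow_mult_r.
  set (A1 := tprod M z ^ (2 * M + 1)). set (c1 := tconst M ^ (2 * M + 1)) in *.
  (* The weights of the discriminant and of the two torsion products add up to 12 t - M - M (2M + 1)
     = 12 t - 2M (M + 1) = 0; the weight 1 comes from dividing by [Phi]. *)
  assert (E : j ^ (12 * t) * (/ j) ^ M * (/ j) ^ (M * (2 * M + 1)) = 1).
  { rewrite !Cpow_inv by easy. pose proof (Cpow_nz j M Hj).
    pose proof (Cpow_nz j (M * (2 * M + 1)) Hj).
    replace (j ^ (12 * t)) with (j ^ M * j ^ (M * (2 * M + 1))).
    - field. auto.
    - rewrite <- Cpow_add_r. f_equal. lia. }
  set (x := j ^ (12 * t)) in *. set (y := (/ j) ^ M) in *.
  set (y' := (/ j) ^ (M * (2 * M + 1))) in *. set (D := Delta z ^ t).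
  set (P := Phi (INR l / INR (2 * M + 1)) z) in *. set (c := tconst M) in *.
  set (A2 := tprod M (INR (2 * M + 1) * z)). set (s := sfac (INR l / INR (2 * M + 1))).
  clearbody x y y' D P c c1 A1 A2 s.
  transitivity (j * (x * y * y') * (s / (c * c1) * D * (A2 * A1) / P)).
  - field. repeat split; auto.
  - rewrite E. field. auto.
Qed.

(** What [Phi_real] leaves of the transformed value once 1/(c z + d) is taken out; this is the part
    that has an expansion in a root of q. *)
Definition slfac (r : C) (c d : Z) (z : C) : C :=
  ee (IZR c * (r * r) * automorphy c d z / 2) * Phi (r * automorphy c d z) z.

Lemma unit_mero_slfac (k h : nat) (a b c d : Z) : in_SL2Z a b c d -> (0 < k < h)%nat ->
  unit_mero (slfac (INR k / INR h) c d).
Proof.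
  intros Hs Hk. assert (HN : RtoC (INR h) <> 0) by (apply INR_C_neq_0; lia). pose proof C2_nz.
  assert (HN' : INR h <> 0%R) by (apply not_0_INR; lia).
  apply unit_mero_mult.
  - apply unit_mero_ext with (fun z => ee (IZR (c * c * Z.of_nat k * Z.of_nat k) / INR (2 * h * h) * z
      + IZR c * (INR k / INR h * (INR k / INR h)) * IZR d / 2)).
    + intros z _. f_equal. unfold automorphy.
      rewrite !mult_IZR, !mult_INR, !RtoC_mult, !IZR_nat_C.
      replace (INR 2) with 2%R by (simpl; lra). field. auto.
    + apply unit_mero_exp. nia.
  - apply unit_mero_ext with (fun z => Phi (IZR (Z.of_nat k * c) / INR h * z
      + RtoC (INR k * IZR d / INR h)) z).
    + intros z _. f_equal. unfold automorphy.
      rewrite RtoC_div, mult_IZR, !RtoC_mult, IZR_nat_C by easy. field. easy.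
    + apply unit_mero_Phi; [lia|]. intros [q Hq] E.
      destruct (ee_eq_1 _ E) as [m Hm]. apply RtoC_inj in Hm.
      assert (Hd : (Z.of_nat k * d = m * Z.of_nat h)%Z).
      { apply eq_IZR. rewrite !mult_IZR, <- !INR_IZR_INZ, <- Hm. field. easy. }
      (* If h divided both k c and k d, then by the determinant it would divide k, contrary to 0 < k
         < h; so the argument is not a lattice point. *)
      assert (Hk' : (Z.of_nat k = (a * m - b * q) * Z.of_nat h)%Z).
      { unfold in_SL2Z in Hs. transitivity (Z.of_nat k * (a * d - b * c))%Z; [rewrite Hs; ring|].
        transitivity (a * (Z.of_nat k * d) - b * (Z.of_nat k * c))%Z; [ring|]. rewrite Hd, Hq. ring. }
      destruct (Z.le_gt_cases (a * m - b * q) 0); nia.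
Qed.

(** All automorphy factors cancel: 12 t from the discriminant against 12 t torsion values, and the
    one from 1/[Phi] against the slash in weight 1. *)
Lemma unit_mero_slash (N l t : nat) (a b c d : Z) : (N * N = 24 * t + 1)%nat -> (0 < l < N)%nat ->
  in_SL2Z a b c d -> unit_mero (slash 1 (Fcrank (Z.of_nat N) l) a b c d).
Proof.
  intros Ht Hl Hs.
  assert (Hc0 := tconst_neq_0 (12 * t)).
  assert (Hs0 : sfac (INR l / INR N) <> 0).
  { apply half_factor_neq_0. rewrite <- IZR_nat_C. apply ee_frac_neq_1. lia. }
  set (M := (12 * t)%nat) in *.
  assert (Hconst : sfac (INR l / INR N) / tconst M <> 0).
  { apply Cmult_neq_0; [easy|]. intros E. apply C1_nz. rewrite <- (Cinv_r _ Hc0), E. ring. }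
  assert (HA : unit_mero (fun z =>
    partial_prod (fun k => slfac (INR (S k) / INR (2 * M + 1)) c d z) M)).
  { apply unit_mero_partial_prod with (g := fun k => slfac (INR (S k) / INR (2 * M + 1)) c d).
    intros k Hk. apply (unit_mero_slfac _ _ a b); [easy|lia]. }
  assert (HG := unit_mero_inv _ (unit_mero_slfac l N a b c d Hs Hl)).
  eapply unit_mero_ext; [|exact (unit_mero_mult _ _ (unit_mero_mult _ _ (unit_mero_mult _ _
    (unit_mero_const _ Hconst) (unit_mero_pow _ t unit_mero_Delta)) HA) HG)].
  intros z Hz. cbv beta. unfold slash. rewrite (pow_n_Cpow (automorphy c d z) 1), Cpow_1_r.
  destruct (Phi_SL2Z _ _ _ _ Hs z Hz) as [Hw _].
  pose proof (automorphy_neq_0 _ _ _ _ z Hs Hz) as Hj.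
  rewrite (Fcrank_cusp_form N l t) by easy. fold M.
  pose proof (Phi_neq_0 _ _ Hw (frac_nonlat l N _ Hw Hl)) as HP.
  rewrite Delta_SL2Z by easy. unfold tprod.
  rewrite (Phi_real _ a b c d z Hs Hz) in HP |- *.
  replace (partial_prod (fun k => Phi (INR (S k) / INR (2 * M + 1)) (mobius a b c d z)) M) with
    ((/ automorphy c d z) ^ M *
     partial_prod (fun k => slfac (INR (S k) / INR (2 * M + 1)) c d z) M).
  2:{ rewrite <- partial_prod_const, <- partial_prod_mult. apply partial_prod_ext.
      intros k _. symmetry. now apply Phi_real. }
  fold (slfac (INR l / INR N) c d z) in HP |- *.
  set (j := automorphy c d z) in *. set (G := slfac (INR l / INR N) c d z) in *.
  assert (HG0 : G <> 0). { intros E. apply HP. rewrite E. ring. }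
  rewrite Cpow_mult_l, <- Cpow_mult_r, Cpow_inv by easy. fold M.
  pose proof (Cpow_nz j M Hj) as HjM.
  set (x := j ^ M) in *. set (D := Delta z ^ t).
  set (A := partial_prod _ M). set (s := sfac (INR l / INR N)) in *. set (c0 := tconst M) in *.
  clearbody x D A s c0 G. field. auto.
Qed.

Lemma holo_of_unit_mero g : unit_mero g -> holo_on upper g.
Proof.
  intros [h [k [H [Hh [HH Hg]]]]] z Hz.
  assert (HN : RtoC (INR h) <> 0) by (apply INR_C_neq_0; lia).
  destruct (HH _ (Cmod_ee_frac_lt_1 z h Hh Hz)) as [_ [l Hl]].
  assert (Hd : exists l, cder (fun z => ee (IZR k / INR h * z) * H (ee (z / INR h))) z l).
  { eexists. apply (cder_mult (fun z => ee (IZR k / INR h * z)) (fun z => H (ee (z / INR h)))).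
    - apply (cder_ee_comp (fun z => IZR k / INR h * z)). apply cder_scal, cder_id.
    - apply (cder_comp H (fun z => ee (z / INR h))); [|exact Hl].
      apply (cder_ee_comp (fun z => z / INR h)). now apply cder_div_const. }
  destruct Hd as [l' Hd]. apply cder_ex_derive with l'.
  (* The ball of radius [Im z] about z lies in the upper half-plane, where the expansion is
     valid. *)
  apply (cder_ext_loc (fun z => ee (IZR k / INR h * z) * H (ee (z / INR h))) g z l' (Im z) Hz);
    [|exact Hd].
  intros y Hy. symmetry. apply Hg. unfold upper.
  pose proof (im_le_Cmod (y - z)) as H1. unfold Cminus in H1. rewrite im_plus, im_opp in H1.
  pose proof (Rle_abs (- (Im y + - Im z))). rewrite Rabs_Ropp in *. unfold Cminus in Hy. lra.
Qed.

Lemma mero_of_unit_mero g : unit_mero g -> mero_at_infty g.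
Proof.
  intros [h [k [H [Hh [HH Hg]]]]].
  assert (HN : RtoC (INR h) <> 0) by (apply INR_C_neq_0; lia).
  assert (HN' : INR h <> 0%R) by (apply not_0_INR; lia).
  (* A pole order of |k| is enough: k + |k| is never negative, so it can be the exponent of an
     ordinary power. *)
  set (m := Z.to_nat (Z.abs k)). set (m' := Z.to_nat (Z.abs k + k)).
  exists h, m, (fun w => w ^ m' * H w). split; [easy|]. split.
  - intros w Hw. destruct (HH w Hw) as [_ [l Hl]].
    eapply cder_ex_derive. apply (cder_mult (fun w => w ^ m') H); [apply cder_pow|exact Hl].
  - intros z Hz. rewrite Hg, qpow_ee, pow_n_Cpow by easy.
    replace (RtoC (1 / INR h)%R * z) with (z / INR h)
      by (rewrite RtoC_div by easy; field; easy).
    rewrite <- !ee_nat.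
    replace (ee (INR m' * (z / INR h))) with (ee (IZR k / INR h * z) * ee (INR m * (z / INR h))).
    + ring.
    + rewrite <- ee_plus. f_equal. unfold m, m'.
      rewrite !INR_IZR_INZ, !Z2Nat.id, plus_IZR, RtoC_plus by lia.
      rewrite <- INR_IZR_INZ. field. easy.
Qed.

Lemma slash_id f z : slash 1 f 1 0 0 1 z = f z.
Proof.
  unfold slash. rewrite mobius_id, pow_n_Cpow, Cpow_1_r.
  replace (automorphy 0 1 z) with (RtoC 1) by (unfold automorphy; ring). field.
Qed.

(** With M = (p - 1)/2, the product M (M + 1) is even, and it is divisible by 3 unless M is 1 or 4
    modulo 6, in which case 3 divides p. *)
Lemma prime_gt_3_form (p : Z) : prime p -> (3 < p)%Z ->
  exists M t : nat, p = Z.of_nat (2 * M + 1) /\ (M * (M + 1) = 6 * t)%nat.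
Proof.
  intros Hp H3.
  assert (H2 : (p mod 2 <> 0)%Z).
  { intros E. apply Z.mod_divide in E; [|lia]. apply (prime_divisors p Hp) in E. lia. }
  assert (H3' : (p mod 3 <> 0)%Z).
  { intros E. apply Z.mod_divide in E; [|lia]. apply (prime_divisors p Hp) in E. lia. }
  set (m := (p / 2)%Z).
  assert (Hm : (p = 2 * m + 1)%Z) by (unfold m; pose proof (Z.div_mod p 2); pose proof (Z.mod_pos_bound p 2); lia).
  assert (Ht : exists t, (m * (m + 1) = 6 * t)%Z).
  { set (q := (m / 6)%Z).
    assert (Hq : (m = 6 * q + m mod 6)%Z) by (apply Z.div_mod; lia).
    pose proof (Z.mod_pos_bound m 6 ltac:(lia)) as Hb.
    set (r := (m mod 6)%Z) in *.
    destruct (ltac:(lia) : (r = 0 \/ r = 1 \/ r = 2 \/ r = 3 \/ r = 4 \/ r = 5)%Z)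
      as [E|[E|[E|[E|[E|E]]]]]; rewrite E in Hq.
    - exists (q * (6 * q + 1))%Z. rewrite Hq. ring.
    - exfalso. apply H3'. rewrite Hm, Hq. replace (2 * (6 * q + 1) + 1)%Z with ((4 * q + 1) * 3)%Z by ring.
      apply Z.mod_mul. lia.
    - exists ((3 * q + 1) * (2 * q + 1))%Z. rewrite Hq. ring.
    - exists ((2 * q + 1) * (3 * q + 2))%Z. rewrite Hq. ring.
    - exfalso. apply H3'. rewrite Hm, Hq. replace (2 * (6 * q + 4) + 1)%Z with ((4 * q + 3) * 3)%Z by ring.
      apply Z.mod_mul. lia.
    - exists ((6 * q + 5) * (q + 1))%Z. rewrite Hq. ring. }
  destruct Ht as [t Ht]. exists (Z.to_nat m), (Z.to_nat t). split; [lia|].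
  apply Nat2Z.inj. rewrite !Nat2Z.inj_mul, Nat2Z.inj_add, !Z2Nat.id by lia. exact Ht.
Qed.

Theorem theorem2p4 (p : Z) (l : nat) :
  prime p -> (3 < p)%Z -> (1 <= l)%nat -> (Z.of_nat l <= p - 1)%Z ->
  weakly_hol_modular_form 1 (in_Gamma0p2_Gamma1p p) (Fcrank p l).
Proof.
  intros Hp Hp3 Hl1 Hl2. destruct (prime_gt_3_form p Hp Hp3) as [M [t [Ep Ht]]].
  assert (HN2 : ((2 * M + 1) * (2 * M + 1) = 24 * t + 1)%nat) by lia.
  assert (Hl : (0 < l < 2 * M + 1)%nat) by lia.
  assert (Hum : forall a b c d, in_SL2Z a b c d -> unit_mero (slash 1 (Fcrank p l) a b c d)).
  { intros a b c d Hs. rewrite Ep. now apply (unit_mero_slash (2 * M + 1) l t). }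
  split; [|split].
  (* Holomorphy on the half-plane is read off from the expansion for the identity matrix. *)
  - apply holo_of_unit_mero. apply unit_mero_ext with (slash 1 (Fcrank p l) 1 0 0 1).
    + intros z _. apply slash_id.
    + now apply Hum.
  - intros a b c d [Hs [[c' Hc] [_ [d' Hd]]]] z Hz.
    rewrite pow_n_Cpow, Cpow_1_r, Ep.
    set (N := Z.of_nat (2 * M + 1)) in *.
    replace c with (N * (N * c'))%Z in * by (rewrite Hc, Ep; ring).
    replace d with (1 + N * d')%Z in * by lia.
    now apply (Fcrank_invariant M l t).
  - intros a b c d Hs. now apply mero_of_unit_mero, Hum.
Qed.
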